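(* The CSNNI verification problem (given a timed automaton $A$ over $\Sigma=\Sigma_l\uplus\Sigma_h$, decide whether $A\backslash\Sigma_h$ and $A/\Sigma_h$ each weakly simulate the other) and the BSNNI verification problem (given such $A$, decide whether $A\backslash\Sigma_h$ and $A/\Sigma_h$ are weakly bisimilar) are both EXPTIME-complete for timed automata.
   Context: A timed automaton (TA) is a tuple $A=(Q,q_0,X,\Sigma^\varepsilon,E,Inv)$ with finite locations $Q$, initial $q_0$, finite clock set $X$, finite alphabet $\Sigma$, $\Sigma^\varepsilon=\Sigma\cup\{\varepsilon\}$, finite edge set $E\subseteq Q\times\mathcal{C}(X)\times\Sigma^\varepsilon\times2^X\times Q$ ($\mathcal{C}(X)$: conjunctions of constraints $x\bowtie c$, $c\in\mathbb{N}$, $\bowtie\in\{<,\le,=,\ge,>\}$), and invariants $Inv:Q\to\mathcal{C}(X)$ using only $<,\le$. Its semantics is the timed transition system (TTS) with states $(q,v)$, $v\in\mathbb{R}_{\ge0}^X$, initial $(q_0,\vec0)$, discrete transitions $(q,v)\xrightarrow{a}(q',v')$ via an edge $(q,\gamma,a,R,q')$ with $\gamma(v)$ true, $v'=v[R\mapsto0]$, $Inv(q')(v')$ true, and delays $(q,v)\xrightarrow{\delta}(q,v+\delta)$ when $Inv(q)$ holds at $v+\delta'$ for all $0\le\delta'\le\delta$. In a TTS write $s\xRightarrow{\varepsilon}s'$ for a (possibly empty) sequence of $\varepsilon$-transitions and, for $a\in\Sigma\cup\mathbb{R}_{\ge0}$, $\xRightarrow{a}=\xRightarrow{\varepsilon}\xrightarrow{a}\xRightarrow{\varepsilon}$.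 A TTS $T_1$ weakly simulates $T_2$ if there is a relation $\mathcal{R}$ between states of $T_1$ and of $T_2$ relating their initial states such that whenever $s\,\mathcal{R}\,p$ and $p\xRightarrow{a}p'$ in $T_2$ with $a\in\Sigma\cup\mathbb{R}_{\ge0}\cup\{\varepsilon\}$, there is $s'$ with $s\xRightarrow{a}s'$ in $T_1$ and $s'\,\mathcal{R}\,p'$. Two TTS are weakly bisimilar if there is such a weak simulation $\mathcal{R}$ of $T_2$ by $T_1$ whose inverse $\mathcal{R}^{-1}$ is a weak simulation of $T_1$ by $T_2$. These notions apply to TA via their semantics. For $L\subseteq\Sigma$, $A/L$ relabels every edge with action in $L$ by $\varepsilon$ and $A\backslash L$ deletes every edge with action in $L$. The alphabet is partitioned into low-level actions $\Sigma_l$ and high-level actions $\Sigma_h$. *)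

(* Defs.v *)
From mathcomp Require Import all_boot all_order all_algebra.
From mathcomp Require Import reals interval_inference.
From Stdlib Require Import Relation_Operators.
From Stdlib Require List.

Set Implicit Arguments.
Unset Strict Implicit.
Unset Printing Implicit Defensive.

Import Order.TTheory GRing.Theory Num.Theory.
Local Open Scope ring_scope.
Local Open Scope nat_scope.

Section TTS.
Variables (R : realType) (S : finType).

Inductive label := Eps | Act of S | Delay of {nonneg R}.

Record TTS := MkTTS {
  tstate :> Type;
  tinit : tstate;
  tstep : label -> tstate -> tstate -> Prop }.

Definition eps_steps (T : TTS) : T -> T -> Prop :=
  clos_refl_trans T (tstep (t := T) Eps).

Definition weak_step (T : TTS) (a : label) (s s' : T) : Prop :=
  match a with
  | Eps => eps_steps s s'
  | _ => exists s1 s2 : T,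
           [/\ eps_steps s s1, tstep a s1 s2 & eps_steps s2 s']
  end.

(* [Rel] witnesses that [T1] weakly simulates [T2]. *)
Definition weak_simulation (T1 T2 : TTS) (Rel : T1 -> T2 -> Prop) : Prop :=
  Rel (tinit T1) (tinit T2) /\
  forall (s : T1) (p : T2) (a : label) (p' : T2),
    Rel s p -> weak_step a p p' ->
    exists s' : T1, weak_step a s s' /\ Rel s' p'.

Definition weakly_simulates (T1 T2 : TTS) : Prop :=
  exists Rel : T1 -> T2 -> Prop, weak_simulation Rel.

Definition weakly_bisimilar (T1 T2 : TTS) : Prop :=
  exists Rel : T1 -> T2 -> Prop,
    weak_simulation Rel /\ weak_simulation (fun p s => Rel s p).

End TTS.

Variant cmp_op := CLt | CLe | CEq | CGe | CGt.

Definition is_upper (c : cmp_op) : bool :=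
  match c with CLt | CLe => true | _ => false end.

Section TimedAutomata.
Variables Q X S : finType.

Record atom := Atom { aclock : X; acmp : cmp_op; aconst : nat }.

(* A list of atoms stands for their conjunction; [::] is "true". *)
Definition constraint := seq atom.

Record edge := Edge {
  esrc : Q;
  eguard : constraint;
  elabel : option S;    (* [None] is the silent action *)
  ereset : {set X};
  etgt : Q }.

Record timed_automaton := TA {
  ta_init : Q;
  ta_edges : seq edge;
  ta_inv : {ffun Q -> constraint};
  ta_inv_upper : [forall q, all (fun g => is_upper (acmp g)) (ta_inv q)] }.

Definition hide_edge (L : {set S}) (e : edge) : edge :=
  Edge (esrc e) (eguard e)
    (if elabel e is Some a then if a \in L then None else Some a else None)
    (ereset e) (etgt e).

Definition ta_hide (A : timed_automaton) (L : {set S}) : timed_automaton :=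
  TA (ta_init A) [seq hide_edge L e | e <- ta_edges A] (ta_inv_upper A).

Definition ta_restrict (A : timed_automaton) (L : {set S}) : timed_automaton :=
  TA (ta_init A)
    [seq e <- ta_edges A | if elabel e is Some a then a \notin L else true]
    (ta_inv_upper A).

End TimedAutomata.

Section Semantics.
Local Open Scope ring_scope.
Variables (R : realType) (Q X S : finType).

Definition valuation := {ffun X -> {nonneg R}}.

Definition val0 : valuation := [ffun=> 0%:nng].

Definition val_delay (v : valuation) (d : {nonneg R}) : valuation :=
  [ffun x => ((v x)%:num + d%:num)%:nng].

Definition val_reset (v : valuation) (Y : {set X}) : valuation :=
  [ffun x => if x \in Y then 0%:nng else v x].

Definition compare_sem (c : cmp_op) (x y : R) : bool :=
  match c with
  | CLt => x < y
  | CLe => x <= y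
  | CEq => x == y
  | CGe => x >= y
  | CGt => x > y
  end.

Definition sat (g : constraint X) (v : valuation) : bool :=
  all (fun a => compare_sem (acmp a) (v (aclock a))%:num (aconst a)%:R) g.

Variable A : timed_automaton Q X S.

Definition discrete_step (a : option S) (s s' : Q * valuation) : Prop :=
  exists e : edge Q X S,
    [/\ List.In e (ta_edges A),
        [/\ esrc e = s.1, elabel e = a & etgt e = s'.1],
        sat (eguard e) s.2,
        s'.2 = val_reset s.2 (ereset e)
      & sat (ta_inv A s'.1) s'.2].

Definition delay_step (d : {nonneg R}) (s s' : Q * valuation) : Prop :=
  s' = (s.1, val_delay s.2 d) /\
  forall d' : {nonneg R}, d'%:num <= d%:num ->
    sat (ta_inv A s.1) (val_delay s.2 d').

Definition ta_step (l : label R S) : Q * valuation -> Q * valuation -> Prop :=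
  match l with
  | Eps => discrete_step None
  | Act a => discrete_step (Some a)
  | Delay d => delay_step d
  end.

Definition ta_tts : TTS R S := MkTTS (ta_init A, val0) ta_step.

End Semantics.

Section NonInterference.
Variables (R : realType) (Q X S : finType).

(* [H] is the set of high-level actions, its complement that of low-level
   ones. *)
Definition is_CSNNI (A : timed_automaton Q X S) (H : {set S}) : Prop :=
  weakly_simulates (ta_tts R (ta_restrict A H)) (ta_tts R (ta_hide A H)) /\
  weakly_simulates (ta_tts R (ta_hide A H)) (ta_tts R (ta_restrict A H)).

Definition is_BSNNI (A : timed_automaton Q X S) (H : {set S}) : Prop :=
  weakly_bisimilar (ta_tts R (ta_restrict A H)) (ta_tts R (ta_hide A H)).

End NonInterference.

(* Up to renaming, every timed automaton has ordinals as locations, clocks and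
   actions. *)
Record instance := Instance {
  nloc : nat;
  nclock : nat;
  nact : nat;
  inst_ta : timed_automaton 'I_nloc 'I_nclock 'I_nact;
  inst_high : {set 'I_nact} }.

Definition enc_seq (T : Type) (enc : T -> seq bool) (s : seq T) : seq bool :=
  flatten [seq true :: enc x | x <- s] ++ [:: false].

Definition enc_bool (b : bool) : seq bool := [:: b].

(* Least significant bit first. *)
Fixpoint pos_bits (p : BinNums.positive) : seq bool :=
  match p with
  | BinNums.xH => [:: true]
  | BinNums.xO p' => false :: pos_bits p'
  | BinNums.xI p' => true :: pos_bits p'
  end.

Definition nat_bits (n : nat) : seq bool :=
  if bin_of_nat n is BinNums.Npos p then pos_bits p else [::].

Definition enc_nat (n : nat) : seq bool := enc_seq enc_bool (nat_bits n).

Definition enc_unary (n : nat) : seq bool := nseq n true ++ [:: false].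

Definition enc_set (n : nat) (Y : {set 'I_n}) : seq bool :=
  [seq i \in Y | i <- enum 'I_n].

Definition enc_cmp_op (c : cmp_op) : seq bool :=
  match c with
  | CLt => [:: false; false; false]
  | CLe => [:: false; false; true]
  | CEq => [:: false; true; false]
  | CGe => [:: false; true; true]
  | CGt => [:: true; false; false]
  end.

Definition enc_atom (m : nat) (a : atom 'I_m) : seq bool :=
  enc_nat (aclock a) ++ enc_cmp_op (acmp a) ++ enc_nat (aconst a).

Definition enc_constraint (m : nat) : constraint 'I_m -> seq bool :=
  enc_seq (@enc_atom m).

Definition enc_label (k : nat) (a : option 'I_k) : seq bool :=
  if a is Some b then true :: enc_nat b else [:: false].

Definition enc_edge (n m k : nat) (e : edge 'I_n 'I_m 'I_k) : seq bool :=
  enc_nat (esrc e) ++ enc_constraint (eguard e) ++ enc_label (elabel e) ++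
  enc_set (ereset e) ++ enc_nat (etgt e).

(* The numbers of locations, clocks and actions are written in unary, as these
   sets are part of the input; constants and indices are written in binary. *)
Definition encode (i : instance) : seq bool :=
  enc_unary (nloc i) ++ enc_unary (nclock i) ++ enc_unary (nact i) ++
  enc_nat (ta_init (inst_ta i)) ++
  enc_seq (@enc_edge _ _ _) (ta_edges (inst_ta i)) ++
  enc_seq (@enc_constraint _)
    [seq ta_inv (inst_ta i) q | q <- enum 'I_(nloc i)] ++
  enc_set (inst_high i).

Definition uniquely_decodable (T : Type) (enc : T -> seq bool) : Prop :=
  forall x y s t, enc x ++ s = enc y ++ t -> x = y /\ s = t.

Lemma ud_cat (T : Type) (enc : T -> seq bool) :
  uniquely_decodable enc -> forall x y r r' s t,
  (enc x ++ r) ++ s = (enc y ++ r') ++ t -> x = y /\ r ++ s = r' ++ t.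
Proof. by move=> encP x y r r' s t; rewrite -!catA => /encP. Qed.

Lemma enc_seq_ud (T : Type) (enc : T -> seq bool) :
  uniquely_decodable enc -> uniquely_decodable (enc_seq enc).
Proof.
move=> encP; rewrite /enc_seq.
elim=> [|x u IHu] [|y v] s t //=; first by case.
rewrite -!catA => -[] /encP[-> eq_uv].
by have [|-> ->] := IHu v s t; rewrite -?catA.
Qed.

Lemma enc_bool_ud : uniquely_decodable enc_bool.
Proof. by move=> x y s t []. Qed.

Lemma pos_bits_inj : injective pos_bits.
Proof.
have nnil p : pos_bits p <> [::] by case: p.
elim=> [p IHp|p IHp|] [q|q|] //= [].
- by move/IHp->.
- by move/nnil.
- by move/IHp->.
- by move/esym/nnil.
Qed.

Lemma nat_bits_inj : injective nat_bits.
Proof.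
move=> m n; rewrite /nat_bits => eq_mn; apply: (can_inj bin_of_natK).
have nnil p : pos_bits p <> [::] by case: p.
case: (bin_of_nat m) (bin_of_nat n) eq_mn => [|p] [|q] //.
- by move/esym/nnil.
- by move/nnil.
- by move/pos_bits_inj->.
Qed.

Lemma enc_nat_ud : uniquely_decodable enc_nat.
Proof.
by move=> m n s t /(enc_seq_ud enc_bool_ud)[/nat_bits_inj-> ->].
Qed.

Lemma enc_unary_ud : uniquely_decodable enc_unary.
Proof.
rewrite /enc_unary; elim=> [|m IHm] [|n] s t //=; first by case.
by case=> /IHm[-> ->].
Qed.

Lemma enc_set_ud n : uniquely_decodable (@enc_set n).
Proof.
move=> Y Z s t /eqP; rewrite eqseq_cat ?size_map // => /andP[/eqP eqYZ /eqP->].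
split=> //; apply/setP=> i; have /eq_in_map := eqYZ.
by apply; rewrite mem_enum.
Qed.

Lemma enc_cmp_op_ud : uniquely_decodable enc_cmp_op.
Proof. by case; case=> s t //= [->]. Qed.

Lemma enc_ord_ud n : uniquely_decodable (fun i : 'I_n => enc_nat i).
Proof. by move=> i j s t /enc_nat_ud[/val_inj-> ->]. Qed.

Lemma enc_atom_ud m : uniquely_decodable (@enc_atom m).
Proof.
move=> [x c n] [y d k] s t /(ud_cat (@enc_ord_ud m))[/= ->].
by case/(ud_cat enc_cmp_op_ud)=> -> /enc_nat_ud[-> ->].
Qed.

Lemma enc_constraint_ud m : uniquely_decodable (@enc_constraint m).
Proof. exact/enc_seq_ud/enc_atom_ud. Qed.

Lemma enc_label_ud k : uniquely_decodable (@enc_label k).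
Proof. by case=> [a|] [b|] s t //= [] => [/enc_ord_ud[->]|] ->. Qed.

Lemma enc_edge_ud n m k : uniquely_decodable (@enc_edge n m k).
Proof.
move=> [q g a Y q'] [r h b Z r'] s t /(ud_cat (@enc_ord_ud n))[/= ->].
case/(ud_cat (@enc_constraint_ud m))=> -> /(ud_cat (@enc_label_ud k))[->].
by case/(ud_cat (@enc_set_ud m))=> -> /enc_ord_ud[-> ->].
Qed.

Lemma encode_inj : injective encode.
Proof.
move=> [n m k [q E I IP] H] [n' m' k' [q' E' I' IP'] H'].
rewrite /encode /= => /enc_unary_ud[eq_n /enc_unary_ud[eq_m /enc_unary_ud[eq_k]]].
case: n' / eq_n q' E' I' IP'; case: m' / eq_m; case: k' / eq_k H' => H' q' E' I' IP'.
case/enc_ord_ud=> <- /(enc_seq_ud (@enc_edge_ud _ _ _))[<-].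
case/(enc_seq_ud (@enc_constraint_ud _)) => eqI.
rewrite -[enc_set H]cats0 -[enc_set H']cats0 => /enc_set_ud[<- _].
have eqII : I = I'.
  by apply/ffunP=> i; have /eq_in_map := eqI; apply; rewrite mem_enum.
by case: I' / eqII IP' {eqI} => IP'; rewrite (bool_irrelevance IP IP').
Qed.

Variant head_move := MoveL | Stay | MoveR.

(* Tape symbols: [None] is the blank, [Some (inl b)] an input symbol and
   [Some (inr g)] an auxiliary symbol of the machine. *)
Definition cell (G : finType) : Type := option (bool + G).

Record TM := MkTM {
  tm_tapes : nat;      (* one less than the number of tapes *)
  tm_aux : finType;
  tm_state : finType;
  tm_start : tm_state;
  tm_halt : pred tm_state;
  tm_accept : pred tm_state;
  tm_delta : tm_state -> {ffun 'I_tm_tapes.+1 -> cell tm_aux} ->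
             tm_state * {ffun 'I_tm_tapes.+1 -> cell tm_aux * head_move} }.

(* A two-way infinite tape: the cells to the left of the head, nearest first,
   then the cells from the head on; cells not listed are blank. *)
Record tape (G : finType) := Tape { tleft : seq (cell G); tright : seq (cell G) }.

Definition tape_read (G : finType) (t : tape G) : cell G := head None (tright t).

Definition tape_act (G : finType) (t : tape G) (am : cell G * head_move) : tape G :=
  let l := tleft t in
  let r := am.1 :: behead (tright t) in
  match am.2 with
  | MoveL => Tape (behead l) (head None l :: r)
  | Stay => Tape l r
  | MoveR => Tape (am.1 :: l) (behead r)
  end.

Section Machines.
Variable M : TM.

Record config := Config {
  cstate : tm_state M;
  ctapes : {ffun 'I_(tm_tapes M).+1 -> tape (tm_aux M)} }.

Definition tm_init (w : seq bool) : config :=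
  Config (tm_start M)
    [ffun i => if i == ord0 then Tape [::] [seq Some (inl b) | b <- w]
               else Tape [::] [::]].

Definition tm_step (c : config) : config :=
  if tm_halt (cstate c) then c else
  let: (q, acts) := tm_delta (cstate c) [ffun i => tape_read (ctapes c i)] in
  Config q [ffun i => tape_act (ctapes c i) (acts i)].

Definition tm_run (w : seq bool) (t : nat) : config :=
  iter t tm_step (tm_init w).

(* The maximal block of bits on the first tape, from the head rightwards. *)
Fixpoint leading_bits (G : finType) (s : seq (cell G)) : seq bool :=
  if s is Some (inl b) :: s' then b :: leading_bits s' else [::].

Definition tm_output (c : config) : seq bool :=
  leading_bits (tright (ctapes c ord0)).

Definition decides_in_time (L : seq bool -> Prop) (T : nat -> nat) : Prop :=
  forall w : seq bool, exists t : nat,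
    let c := tm_run w t in
    [/\ t <= T (size w), tm_halt (cstate c) & tm_accept (cstate c) <-> L w].

Definition computes_in_time (f : seq bool -> seq bool) (T : nat -> nat) : Prop :=
  forall w : seq bool, exists t : nat,
    let c := tm_run w t in
    [/\ t <= T (size w), tm_halt (cstate c) & tm_output c = f w].

End Machines.

(* The bound [n ^ c + c] stands for an arbitrary polynomial in [n]: each one is
   below some [n ^ c + c] for all [n]. *)
Definition EXPTIME (L : seq bool -> Prop) : Prop :=
  exists (M : TM) (c : nat), decides_in_time M L (fun n => 2 ^ (n ^ c + c)).

Definition polytime (f : seq bool -> seq bool) : Prop :=
  exists (M : TM) (c : nat), computes_in_time M f (fun n => n ^ c + c).

Definition polytime_reducible (L L' : seq bool -> Prop) : Prop :=
  exists f : seq bool -> seq bool, polytime f /\ forall w, L w <-> L' (f w).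

Definition EXPTIME_hard (L : seq bool -> Prop) : Prop :=
  forall L' : seq bool -> Prop, EXPTIME L' -> polytime_reducible L' L.

Definition EXPTIME_complete (L : seq bool -> Prop) : Prop :=
  EXPTIME L /\ EXPTIME_hard L.

Definition CSNNI_problem (R : realType) (w : seq bool) : Prop :=
  exists i : instance, w = encode i /\ is_CSNNI R (inst_ta i) (inst_high i).

Definition BSNNI_problem (R : realType) (w : seq bool) : Prop :=
  exists i : instance, w = encode i /\ is_BSNNI R (inst_ta i) (inst_high i).

(* Main.v *)
(* Membership.  Up to the largest constant, two families of clock values that
   satisfy the same difference constraints have the same future, and every class
   is realised on a grid of exponentially small step; hence the simulation and
   bisimulation games between the two automata can be played on a finite board of
   exponential size, where the greatest fixpoint is reached after exponentially
   many rounds.  The iteration is expressed in a small language of bounded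
   recursions, compiled to a stack machine and from there to a Turing machine.

   Hardness.  An exponential-time machine is simulated backwards by a game on
   claims on the state, or on the content of the cell at position k, at time t.  Three
   clocks suffice: one measures rounds of exponential length P, the phase of the
   second inside the round is the position k, and the third counts the rounds.
   In each round the defender announces the view of the machine (its state and
   scanned cells) one step earlier, and the attacker either challenges part of it
   or follows the consequence of the current claim.  If the machine accepts, the
   two automata are bisimilar; if it rejects, the attacker keeps to false claims
   down to the initial configuration and no simulation exists. *)

Require Import Defs.
From mathcomp Require Import all_boot all_order all_algebra.
From mathcomp Require Import reals.
From mathcomp Require Import interval_inference zify lra.
From Stdlib Require Import FunctionalExtensionality Relation_Operators Operators_Properties.

Set Implicit Arguments.
Unset Strict Implicit.
Unset Printing Implicit Defensive.

(** * Stack machines *)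

(** Two obstacles shape membership. A delay may have to land strictly between two neighbouring
    thresholds, which costs a factor 2 of the grid step, while plays have no bounded length. So each
    round restarts from an even representative of the current class, and only one halving is ever
    pending. And time has to be accounted for: values are kept in unary, so that a program runs in
    time polynomial in its values, and one exponential number handed to it as a bound accounts for
    the whole running time.

    For hardness one automaton serves both problems. Its two sides differ only in an obligation:
    after the single high edge the hidden side may withhold the announcement of a view, which the
    restricted side owes. Naming the announced view keeps the sides apart, naming any other merges
    them. The run is followed backwards because the view at one time decides whether a claim at the
    next time is refuted, confirmed or inherited. Positions are relative to the head, so that no
    head position has to be stored. *)

Definition stacks := nat -> seq bool.

Definition upd (s : stacks) i v : stacks := fun j => if j == i then v else s j.

(** [Case] and [Loop] inspect the top of a stack without popping it; a loop runs until its stack is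
    empty, so its body has to consume that stack. *)
Inductive cmd :=
| Skip
| Push of nat & bool
| Pop of nat
| Seq of cmd & cmd
| Case of nat & cmd & cmd & cmd
| Loop of nat & cmd.

Infix ";;" := Seq (at level 60, right associativity).

Definition branch (T : Type) (l : seq bool) (x1 x0 xe : T) : T :=
  match l with true :: _ => x1 | false :: _ => x0 | [::] => xe end.

(* The natural number is an upper bound on the number of machine steps. *)
Inductive exec : cmd -> stacks -> nat -> stacks -> Prop :=
| ExSkip s T : exec Skip s T s
| ExPush i b s T : 1 < T -> exec (Push i b) s T (upd s i (b :: s i))
| ExPop i s T : 0 < T -> exec (Pop i) s T (upd s i (behead (s i)))
| ExSeq c1 c2 s s1 s2 T1 T2 T :
    exec c1 s T1 s1 -> exec c2 s1 T2 s2 -> T1 + T2 <= T ->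
    exec (c1 ;; c2) s T s2
| ExCase i c1 c0 ce s s' T' T :
    exec (branch (s i) c1 c0 ce) s T' s' -> T' + 2 <= T ->
    exec (Case i c1 c0 ce) s T s'
| ExLoop0 i c s T : s i = [::] -> 0 < T -> exec (Loop i c) s T s
| ExLoopS i c s s1 s2 T1 T2 T :
    s i <> [::] -> exec c s T1 s1 -> exec (Loop i c) s1 T2 s2 ->
    T1 + T2 + 2 <= T -> exec (Loop i c) s T s2.

Lemma exec_weaken c s T T' s' : T <= T' -> exec c s T s' -> exec c s T' s'.
Proof.
move=> leT H; case: H T' leT => {c s T s'}.
- by move=> s T T' _; apply: ExSkip.
- by move=> i b s T hT T' ?; apply: ExPush; lia.
- by move=> i s T hT T' ?; apply: ExPop; lia.
- by move=> c1 c2 s s1 s2 T1 T2 T h1 h2 hT T' ?; apply: ExSeq h1 h2 _; lia.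
- by move=> i c1 c0 ce s s' T1 T h hT T' ?; apply: ExCase h _; lia.
- by move=> i c s T h ? T' ?; apply: ExLoop0 => //; lia.
- move=> i c s s1 s2 T1 T2 T h h1 h2 hT T' ?.
  by apply: ExLoopS h h1 h2 _; lia.
Qed.

Variant instr := IPush of nat & bool | IPop of nat | IBr of nat & nat & nat & nat.

Definition goto l := IBr 0 l l l.

Fixpoint asm (c : cmd) (p : nat) : seq instr :=
  match c with
  | Skip => [::]
  | Push i b => [:: IPush i b]
  | Pop i => [:: IPop i]
  | c1 ;; c2 => let a1 := asm c1 p in a1 ++ asm c2 (p + size a1)
  | Case i c1 c0 ce =>
      let a1 := asm c1 p.+1 in let p0 := p.+1 + size a1 + 1 in
      let a0 := asm c0 p0 in let pe := p0 + size a0 + 1 in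
      let ae := asm ce pe in let pend := pe + size ae in
      IBr i p.+1 p0 pe :: a1 ++ goto pend :: a0 ++ goto pend :: ae
  | Loop i c =>
      let a := asm c p.+1 in let pend := p + size a + 2 in
      IBr i p.+1 p.+1 pend :: a ++ [:: goto p]
  end.

Definition istep (i : instr) (ps : nat * stacks) : nat * stacks :=
  let: (p, s) := ps in
  match i with
  | IPush i b => (p.+1, upd s i (b :: s i))
  | IPop i => (p.+1, upd s i (behead (s i)))
  | IBr i l1 l0 le => (branch (s i) l1 l0 le, s)
  end.

(** A push takes two steps of the tape machine: the head first moves to the cell left of the top,
    then writes there. *)
Definition icost (i : instr) := if i is IPush _ _ then 2 else 1.

Inductive runs (code : seq instr) : nat * stacks -> nat -> nat * stacks -> Prop :=
| runs0 x : runs code x 0 x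
| runsS x t y : x.1 < size code ->
    runs code (istep (nth (IPop 0) code x.1) x) t y ->
    runs code x (icost (nth (IPop 0) code x.1) + t) y.

Lemma runs_trans code x t y t' z :
  runs code x t y -> runs code y t' z -> runs code x (t + t') z.
Proof.
by move=> H H'; elim: H H' => // x1 t1 y1 lt_x _ IH /IH; rewrite -addnA; apply: runsS.
Qed.

Lemma runs1 pre i post s :
  let code := pre ++ i :: post in
  runs code (size pre, s) (icost i) (istep i (size pre, s)).
Proof.
move=> code; have def_i : nth (IPop 0) code (size pre) = i.
  by rewrite nth_cat ltnn subnn.
have := @runsS code (size pre, s) 0 (istep i (size pre, s)).
rewrite /= def_i addn0; apply; last exact: runs0.
by rewrite size_cat /= addnS ltnS leq_addr.
Qed.

(** Jump targets are absolute addresses, so the induction is on code placed between an arbitrary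
    [pre], whose length is the start address, and an arbitrary [post]. *)
Lemma asm_runs c s T s' : exec c s T s' -> forall pre post,
  exists2 t, t <= T & runs (pre ++ asm c (size pre) ++ post)
    (size pre, s) t (size pre + size (asm c (size pre)), s').
Proof.
elim=> {c s T s'}.
- by move=> s T pre post; exists 0; rewrite // addn0; apply: runs0.
- move=> i b s T hT pre post; exists 2 => //=.
  by rewrite addn1; apply: (runs1 pre (IPush i b)).
- move=> i s T hT pre post; exists 1 => //=.
  by rewrite addn1; apply: (runs1 pre (IPop i)).
- move=> c1 c2 s s1 s2 T1 T2 T _ IH1 _ IH2 hT pre post /=.
  have [t1 lt1 r1] := IH1 pre (asm c2 (size pre + size (asm c1 (size pre))) ++ post).
  have [t2 lt2] := IH2 (pre ++ asm c1 (size pre)) post.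
  rewrite !size_cat -!catA => r2.
  exists (t1 + t2); first by lia.
  by rewrite addnA; apply: runs_trans r2.
- move=> i c1 c0 ce s s' T' T _ IH hT pre post /=.
  set a1 := asm c1 _; set p0 := _ + _ + 1; set a0 := asm c0 _.
  set pe := p0 + _ + 1; set ae := asm ce _; set pend := pe + _.
  set code := pre ++ _.
  have defend : size pre + size (IBr i (size pre).+1 p0 pe :: a1 ++ goto pend :: a0 ++ goto pend :: ae) = pend.
    by rewrite /= !size_cat /= size_cat /= /pend /pe /p0; lia.
  rewrite defend.
  have rb := runs1 pre (IBr i (size pre).+1 p0 pe) (a1 ++ goto pend :: a0 ++ goto pend :: ae ++ post) s.
  have ecode : pre ++ IBr i (size pre).+1 p0 pe :: a1 ++ goto pend :: a0 ++ goto pend :: ae ++ post = code.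
    by rewrite /code /= -!catA /= -!catA.
  rewrite /= ecode in rb.
  case def_si : (s i) IH rb => [|[] l] IH rb; rewrite /= in IH rb.
  + have [t lt r] := IH (pre ++ IBr i (size pre).+1 p0 pe :: a1 ++ goto pend :: a0 ++ [:: goto pend]) post.
    have spre : size (pre ++ IBr i (size pre).+1 p0 pe :: a1 ++ goto pend :: a0 ++ [:: goto pend]) = pe.
      by rewrite !size_cat /= !size_cat /= size_cat /= /pe /p0; lia.
    rewrite spre -!catA /= -!catA /= -!catA /= ecode in r.
    by exists (1 + t); [lia|apply: runs_trans r].
  + have [t lt r] := IH (pre ++ [:: IBr i (size pre).+1 p0 pe]) (goto pend :: a0 ++ goto pend :: ae ++ post).
    have spre : size (pre ++ [:: IBr i (size pre).+1 p0 pe]) = (size pre).+1.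
      by rewrite size_cat addn1.
    rewrite spre -!catA /= ecode in r.
    have rg := runs1 (pre ++ IBr i (size pre).+1 p0 pe :: a1) (goto pend) (a0 ++ goto pend :: ae ++ post) s'.
    have spre' : size (pre ++ IBr i (size pre).+1 p0 pe :: a1) = (size pre).+1 + size a1.
      by rewrite size_cat /=; lia.
    rewrite spre' -!catA /= ecode in rg.
    exists (1 + (t + 1)); first by lia.
    apply: runs_trans rb _; apply: runs_trans r _.
    (* [goto] is a branch with three equal targets; it reduces once the top of stack 0 is known. *)
    by case: (s' 0) rg => [|[] ?].
  + have [t lt r] := IH (pre ++ IBr i (size pre).+1 p0 pe :: a1 ++ [:: goto pend]) (goto pend :: ae ++ post).
    have spre : size (pre ++ IBr i (size pre).+1 p0 pe :: a1 ++ [:: goto pend]) = p0.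
      by rewrite !size_cat /= !size_cat /= /p0; lia.
    rewrite spre -!catA /= -!catA /= ecode in r.
    have rg := runs1 (pre ++ IBr i (size pre).+1 p0 pe :: a1 ++ goto pend :: a0) (goto pend) (ae ++ post) s'.
    have spre' : size (pre ++ IBr i (size pre).+1 p0 pe :: a1 ++ goto pend :: a0) = p0 + size a0.
      by rewrite !size_cat /= !size_cat /= /p0; lia.
    rewrite spre' -!catA /= -!catA /= ecode in rg.
    exists (1 + (t + 1)); first by lia.
    apply: runs_trans rb _; apply: runs_trans r _.
    by case: (s' 0) rg => [|[] ?].
- move=> i c s T s0 hT pre post; exists 1 => //.
  have := runs1 pre (IBr i (size pre).+1 (size pre).+1 (size pre + size (asm c (size pre).+1) + 2))
     ((asm c (size pre).+1 ++ [:: goto (size pre)]) ++ post) s.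
  rewrite /= s0 /= size_cat /=.
  by congr (runs _ _ _ (_, _)); lia.
- move=> i c s s1 s2 T1 T2 T si _ IH1 _ IH2 hT pre post.
  have [t2 lt2 r2] := IH2 pre post.
  set a := asm c (size pre).+1.
  set pend := size pre + size a + 2.
  have ecode : pre ++ asm (Loop i c) (size pre) ++ post =
     pre ++ IBr i (size pre).+1 (size pre).+1 pend :: a ++ goto (size pre) :: post.
    by rewrite /= -/a -catA.
  rewrite ecode in r2 *.
  have rb := runs1 pre (IBr i (size pre).+1 (size pre).+1 pend) (a ++ goto (size pre) :: post) s.
  have [t1 lt1 r1] := IH1 (pre ++ [:: IBr i (size pre).+1 (size pre).+1 pend]) (goto (size pre) :: post).
  rewrite size_cat addn1 -!catA /= -/a in r1.
  have rg := runs1 (pre ++ IBr i (size pre).+1 (size pre).+1 pend :: a) (goto (size pre)) post s1.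
  rewrite size_cat -!catA /= in rg.
  exists (1 + (t1 + (1 + t2))); first by lia.
  apply: runs_trans (_ : runs _ _ _ ((size pre).+1, s)) _.
    by rewrite /= in rb; case: (s i) si rb => [|[] ?].
  apply: runs_trans r1 _; rewrite -/a addSnnS.
  apply: runs_trans r2.
  by case: (s1 0) rg => [|[] ?].
Qed.

(** * Stack machines as multitape Turing machines *)

Section StackMachine.
Variables (K : nat) (code : seq instr) (accept : nat).

Definition instr_ok (i : instr) : bool :=
  match i with
  | IPush i _ | IPop i => i <= K
  | IBr i l1 l0 le => [&& i <= K, l1 <= accept, l0 <= accept & le <= accept]
  end.

Hypothesis code_ok : all instr_ok code.
Hypothesis accept_ge : size code <= accept.

Notation cellv := (cell void).

(** The Boolean in the state separates the two halves of a push: the move to the left at [false],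
    the writing at [true]. A pop blanks the top cell and moves right. *)
Definition sm_delta (q : 'I_accept.+1 * bool) (rd : {ffun 'I_K.+1 -> cellv}) :
  ('I_accept.+1 * bool) * {ffun 'I_K.+1 -> cellv * head_move} :=
  let stay := [ffun i => (rd i, Stay)] in
  match nth (IPop 0) code q.1 with
  | IPush i b =>
      if q.2 then ((inord q.1.+1, false),
        [ffun j : 'I_K.+1 => if j == i :> nat then (Some (inl b), Stay) else (rd j, Stay)])
      else ((q.1, true),
        [ffun j : 'I_K.+1 => if j == i :> nat then (rd j, MoveL) else (rd j, Stay)])
  | IPop i => ((inord q.1.+1, false),
        [ffun j : 'I_K.+1 => if j == i :> nat then (None, MoveR) else (rd j, Stay)])
  | IBr i l1 l0 le =>
      ((inord (match rd (inord i) with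
               | Some (inl true) => l1 | Some (inl false) => l0 | _ => le end), false),
       stay)
  end.

Definition stack_tm : TM :=
  @MkTM K void ('I_accept.+1 * bool)%type (ord0, false)
    (fun q => size code <= q.1) (fun q => q.1 == accept :> nat) sm_delta.

(** The top is under the head. The cells on the left are left free, because a push overwrites the
    cell it enters; trailing blanks are allowed, because acting on an empty stack makes blank cells
    explicit. *)
Definition holds_stack (t : tape void) (l : seq bool) : Prop :=
  exists k, tright t = [seq Some (inl b) | b <- l] ++ nseq k None.

Definition represents (c : config stack_tm) (p : nat) (s : stacks) : Prop :=
  cstate c = (inord p, false) /\ forall j : 'I_K.+1, holds_stack (ctapes c j) (s j).

Lemma holds_read t l : holds_stack t l ->
  tape_read t = if l is b :: _ then Some (inl b) else None.
Proof. by case=> k; rewrite /tape_read => ->; case: l => //=; case: k. Qed.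

Lemma holds_stay t l : holds_stack t l -> holds_stack (tape_act t (tape_read t, Stay)) l.
Proof.
case=> k def_t; rewrite /tape_act /tape_read /=; case: l def_t => [|b l] def_t.
  by exists k.-1.+1; rewrite /= def_t; case: k {def_t}.
by exists k; rewrite /= def_t.
Qed.

Lemma holds_push t l b : holds_stack t l ->
  holds_stack (tape_act (tape_act t (tape_read t, MoveL)) (Some (inl b), Stay)) (b :: l).
Proof. by move/holds_stay=> [k]; rewrite /tape_act /= => ->; exists k. Qed.

Lemma holds_pop t l : holds_stack t l -> holds_stack (tape_act t (None, MoveR)) (behead l).
Proof.
case=> k; rewrite /tape_act /= => ->; case: l => [|b l] /=; last by exists k.
by exists k.-1; case: k.
Qed.

Lemma step_represents c p s : p < size code -> represents c p s ->
  let i := nth (IPop 0) code p in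
  represents (iter (icost i) (@tm_step stack_tm) c) (istep i (p, s)).1 (istep i (p, s)).2.
Proof.
move=> lt_p [qc tc] i.
have iok : instr_ok i by move/(all_nthP (IPop 0)): code_ok; apply.
have pK : (inord p : 'I_accept.+1) = p :> nat by rewrite inordK // ltnS; lia.
have nh : tm_halt (cstate c) = false.
  by apply/negbTE; rewrite -ltnNge /= qc /= pK.
case def_i: i iok => [j b|j|j l1 l0 le] /= iok.
- set c1 := tm_step c.
  have def_c1 : c1 = @Config stack_tm (inord p, true) [ffun k : 'I_K.+1 =>
      tape_act (ctapes c k) (if k == j :> nat then (tape_read (ctapes c k), MoveL)
        else (tape_read (ctapes c k), Stay))].
    rewrite /c1 /tm_step nh /= /sm_delta qc /= pK -/i def_i /=.
    by congr Config; apply/ffunP=> k; rewrite !ffunE; case: eqP.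
  rewrite def_c1 /tm_step /= pK leqNgt lt_p /=.
  rewrite /sm_delta /= pK -/i def_i /=; split=> //= k.
  rewrite !ffunE /upd; case: eqP => [<-|_]; first exact: holds_push.
  by rewrite -surjective_pairing; apply: holds_stay; apply: holds_stay.
- rewrite /tm_step nh /= /sm_delta qc /= pK -/i def_i /=; split=> //= k.
  rewrite !ffunE /upd; case: eqP => [<-|_]; first exact: holds_pop.
  exact: holds_stay.
- rewrite /tm_step nh /= /sm_delta qc /= pK -/i def_i /=; split=> /=.
    rewrite ffunE; have jK : j < K.+1 by case/and4P: iok.
    have := holds_read (tc (inord j)); rewrite inordK // => ->.
    by case: (s j) => [|[]].
  by move=> k; rewrite !ffunE; apply: holds_stay.
Qed.

Lemma runs_represents x t y : runs code x t y -> forall c, represents c x.1 x.2 ->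
  represents (iter t (@tm_step stack_tm) c) y.1 y.2.
Proof.
elim=> // {x t y} [[p s]] t [q s'] /= lt_p _ IH c rc.
rewrite addnC iterD; apply: IH.
by have := step_represents lt_p rc.
Qed.

Lemma represents_init w : represents (tm_init stack_tm w) 0 (fun j => if j == 0 then w else [::]).
Proof.
split=> [|j] /=.
  by congr pair; apply: val_inj; rewrite /= inordK.
rewrite ffunE -val_eqE /=; case: eqP => _; exists 0; by rewrite ?cats0.
Qed.

End StackMachine.

Fixpoint cmd_bound (c : cmd) : nat :=
  match c with
  | Skip => 0
  | Push i _ | Pop i => i
  | c1 ;; c2 => maxn (cmd_bound c1) (cmd_bound c2)
  | Case i c1 c0 ce => maxn i (maxn (cmd_bound c1) (maxn (cmd_bound c0) (cmd_bound ce)))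
  | Loop i c => maxn i (cmd_bound c)
  end.

Lemma asm_ok c K a p : cmd_bound c <= K -> p + size (asm c p) <= a ->
  all (instr_ok K a) (asm c p).
Proof.
elim: c p => //= [i b p|i p|c1 IH1 c2 IH2 p|i c1 IH1 c0 IH0 ce IHe p|i c IH p].
- by rewrite andbT.
- by rewrite andbT.
- rewrite geq_max size_cat all_cat => /andP[h1 h2] hp.
  by rewrite IH1 ?IH2 //; lia.
- rewrite !geq_max => /and4P[hi h1 h0 he]; rewrite !size_cat /= size_cat /= => hp.
  rewrite !all_cat /= all_cat /= IH1 //; last by lia.
  rewrite IH0 //; last by lia.
  rewrite IHe //; last by lia.
  by rewrite hi /=; lia.
- rewrite geq_max size_cat /= => /andP[hi hc] hp.
  by rewrite all_cat /= IH //; lia.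
Qed.

Definition init_stacks (w : seq bool) : stacks := fun j => if j == 0 then w else [::].

Lemma computes_of_exec (c : cmd) (f : seq bool -> seq bool) (T : nat -> nat) :
  (forall w, exists2 s, exec c (init_stacks w) (T (size w)) s & s 0 = f w) ->
  exists M, computes_in_time M f T.
Proof.
move=> ex; set code := asm c 0.
exists (stack_tm (cmd_bound c) code (size code)) => w.
have [s ec s0] := ex w.
have [t lt_t] := asm_runs ec [::] [::]; rewrite /= cats0 add0n -/code => rc.
have cok : all (instr_ok (cmd_bound c) (size code)) code by apply: asm_ok; rewrite ?add0n.
exists t => /=.
have [qf tf] := runs_represents cok (leqnn _) rc (represents_init _ _ _ w).
rewrite /tm_run; set cf := iter _ _ _ in qf tf *.
split=> //; first by rewrite qf /= inordK.
have [k] := tf ord0; rewrite /tm_output /= s0 => ->.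
by elim: (f w) => [|b l /= ->] //=; case: k.
Qed.

(** A final branch on stack [r] has two exits past the end of the code, both halting:
    [(size code0).+2] accepts and [(size code0).+1] rejects. This branch is the extra step in the
    bound. *)
Lemma decides_of_exec (c : cmd) (r : nat) (L : seq bool -> Prop) (T : nat -> nat) :
  (forall w, exists2 s, exec c (init_stacks w) (T (size w)) s & s r <> [::] <-> L w) ->
  exists M, decides_in_time M L (fun n => T n + 1).
Proof.
move=> ex; set code0 := asm c 0.
set a := (size code0).+2.
set code := code0 ++ [:: IBr r a a (size code0).+1].
set K := maxn r (cmd_bound c).
have cok : all (instr_ok K a) code.
  rewrite all_cat; apply/andP; split.
    by apply: asm_ok; rewrite ?leq_maxr // add0n /a -/code0; lia.
  by rewrite /= leq_maxl /a; lia.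
have ca : size code <= a by rewrite size_cat /a /=; lia.
exists (stack_tm K code a) => w.
have [s ec sr] := ex w.
have [t lt_t] := asm_runs ec [::] [:: IBr r a a (size code0).+1].
rewrite /= add0n -/code0 -/code => rc.
have rb := runs1 code0 (IBr r a a (size code0).+1) [::] s.
rewrite -/code /= in rb.
have [qf _] := runs_represents cok ca (runs_trans rc rb) (represents_init _ _ _ w).
exists (t + 1); rewrite /= /tm_run; set cf := iter _ _ _ in qf *.
rewrite /= in qf.
split; first by lia.
  rewrite /= qf /= inordK; last by case: (s r) => [|[] ?] /=; rewrite /a; lia.
  by rewrite size_cat /=; case: (s r) => [|[] ?] /=; rewrite /a; lia.
rewrite /= qf /= inordK; last by case: (s r) => [|[] ?] /=; rewrite /a; lia.
rewrite -sr; case: (s r) => [|b l] /=.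
  by rewrite /a; split=> // /eqP; lia.
by split=> // _; case: b; rewrite eqxx.
Qed.

(** * A language of bounded recursions *)

(** Variables and arrays are two separate families of de Bruijn indices. [Let], [Mu] and [Cov] bind
    a variable; [Cov] also binds the array of the bits computed so far. *)
Inductive ex :=
| Var of nat
| One
| Add of ex & ex
| Mul of ex & ex
| Lt of ex & ex
| Len
| Inp of ex
| Rd of nat & ex
| Let of ex & ex
| Mu of ex & ex
| Cov of ex & ex.

Record ctx := Ctx { cw : seq bool; cv : nat -> nat; ca : nat -> seq bool }.

Definition vcons (x : nat) (c : ctx) : ctx :=
  Ctx (cw c) (fun i => if i is j.+1 then cv c j else x) (ca c).
Definition acons (l : seq bool) (c : ctx) : ctx :=
  Ctx (cw c) (cv c) (fun i => if i is j.+1 then ca c j else l).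

(** A failed search returns the bound [b] itself, so that a bounded quantifier is the test
    [mu b p < b]. *)
Definition mu (b : nat) (p : nat -> bool) : nat := find p (iota 0 b).

(* Course-of-values recursion: the value at [t] may use those at [0 .. t-1]. *)
Definition covseq (F : nat -> seq bool -> bool) (t : nat) : seq bool :=
  iteri t (fun x l => rcons l (F x l)) [::].
Definition cov F t : bool := last false (covseq F t.+1).

Fixpoint eval (x : ex) (c : ctx) : nat :=
  match x with
  | Var i => cv c i
  | One => 1
  | Add a b => eval a c + eval b c
  | Mul a b => eval a c * eval b c
  | Lt a b => eval a c < eval b c
  | Len => size (cw c)
  | Inp a => nth false (cw c) (eval a c)
  | Rd r a => nth false (ca c r) (eval a c)
  | Let a b => eval b (vcons (eval a c) c)
  | Mu a p => mu (eval a c) (fun x => 0 < eval p (vcons x c))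
  | Cov p a => cov (fun x l => 0 < eval p (vcons x (acons l c))) (eval a c)
  end.

Lemma size_covseq F t : size (covseq F t) = t.
Proof. by elim: t => //= t IH; rewrite size_rcons IH. Qed.

Lemma mu_le b p : mu b p <= b.
Proof. by rewrite -[X in _ <= X](size_iota 0); apply: find_size. Qed.

Definition un (n : nat) : seq bool := nseq n true.

Definition move a b : cmd :=
  Loop a (Case a (Pop a ;; Push b true) (Pop a ;; Push b false) Skip).
Definition clear a : cmd := Loop a (Pop a).
(** Reading a stack destroys it: the bits pass through the scratch stack [t] and return to [a] and
    [f] together, which also undoes the reversal. *)
Definition copy a f t : cmd :=
  move a t ;;
  Loop t (Case t (Pop t ;; Push a true ;; Push f true)
                 (Pop t ;; Push a false ;; Push f false) Skip).
Definition drop_by f g : cmd := Loop f (Pop f ;; Pop g).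
Definition flag g f : cmd := Case g (clear g ;; Push f true) (clear g) Skip.

(** The stacks from [f] on are free, and the value is left on stack [f] in unary; [V] and [A] locate
    the bound variables and arrays. A comparison drops from [b] as many items as [a] has and tests
    whether something remains. *)
Fixpoint compile (x : ex) (V A : seq nat) (f : nat) : cmd :=
  match x with
  | Var i => if i < size V then copy (nth 0 V i) f f.+1 else Skip
  | One => Push f true
  | Add a b => compile a V A f ;; compile b V A f.+1 ;; move f.+1 f
  | Mul a b =>
      compile a V A f ;; compile b V A f.+1 ;;
      Loop f (Pop f ;; copy f.+1 f.+2 f.+3) ;; clear f.+1 ;; move f.+2 f
  | Lt a b => compile a V A f ;; compile b V A f.+1 ;; drop_by f f.+1 ;; flag f.+1 f
  | Len => copy 0 f.+1 f.+2 ;; Loop f.+1 (Pop f.+1 ;; Push f true)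
  | Inp a => compile a V A f ;; copy 0 f.+1 f.+2 ;; drop_by f f.+1 ;; flag f.+1 f
  | Rd r a =>
      if r < size A then
        compile a V A f ;; copy (nth 0 A r) f.+1 f.+2 ;; move f.+1 f.+2 ;;
        drop_by f f.+2 ;; flag f.+2 f
      else Skip
  | Let a b => compile a V A f ;; compile b (f :: V) A f.+1 ;; clear f ;; move f.+1 f
  | Mu a p =>
      compile a V A f ;;
      Loop f (Pop f ;; compile p (f.+1 :: V) A f.+2 ;;
              Case f.+2 (clear f.+2 ;; clear f) Skip (Push f.+1 true)) ;;
      move f.+1 f
  | Cov p a =>
      compile a V A f ;; Push f true ;;
      Loop f (Pop f ;; compile p (f.+1 :: V) (f.+2 :: A) f.+3 ;;
              Case f.+3 (clear f.+3 ;; Push f.+2 true) Skip (Push f.+2 false) ;;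
              Push f.+1 true) ;;
      clear f.+1 ;; flag f.+2 f
  end.

Lemma exec_seq c1 c2 s s1 s2 T1 T2 :
  exec c1 s T1 s1 -> exec c2 s1 T2 s2 -> exec (c1 ;; c2) s (T1 + T2) s2.
Proof. by move=> h1 h2; apply: ExSeq h1 h2 _. Qed.

Lemma exec_seqA c1 c2 c3 s T s' :
  exec ((c1 ;; c2) ;; c3) s T s' -> exec (c1 ;; c2 ;; c3) s T s'.
Proof.
move=> H; inversion_clear H as [| | |? ? ? ? ? ? ? ? H1 H2 H3| | |].
inversion_clear H1 as [| | |? ? ? ? ? ? ? ? H4 H5 H6| | |].
by apply: (ExSeq H4 (ExSeq H5 H2 (leqnn _))); lia.
Qed.

Lemma exec_loop (inv : nat -> stacks) n c i t :
  (forall k, k < n -> inv k i <> [::] /\ exec c (inv k) t (inv k.+1)) ->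
  inv n i = [::] -> exec (Loop i c) (inv 0) (n * (t + 2) + 1) (inv n).
Proof.
elim: n inv => [|n IH] inv Hk Hn; first by apply: ExLoop0.
have [h0 e0] := Hk 0 isT.
apply: ExLoopS h0 e0 (IH (fun k => inv k.+1) _ Hn) _; last by lia.
by move=> k lt_k; apply: (Hk k.+1).
Qed.

Lemma upd_same s i v : upd s i v i = v. Proof. by rewrite /upd eqxx. Qed.

Lemma upd_diff s i v j : j != i -> upd s i v j = s j.
Proof. by rewrite /upd => /negbTE->. Qed.

Ltac steq := apply: functional_extensionality => ?; rewrite /upd;
  repeat (case: eqP => [?|?]; subst; rewrite ?eqxx //); try lia; try done.

Ltac look := rewrite /upd; repeat (case: eqP => ?; try lia).

Lemma exec_eq c s T s' s'' : exec c s T s' -> s' = s'' -> exec c s T s''.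
Proof. by move=> h <-. Qed.

Lemma exec_to c s T s' s'' : s' = s'' -> exec c s T s'' -> exec c s T s'.
Proof. by move=> ->. Qed.

Lemma exec_move a b s : a != b ->
  exec (move a b) s (7 * size (s a) + 1) (upd (upd s b (catrev (s a) (s b))) a [::]).
Proof.
move=> ab; have ba : b != a by rewrite eq_sym.
move def_l : (s a) => l; elim: l s def_l => [|x l IH] s def_l.
  by apply: (@exec_to _ _ _ _ s); [steq|apply: ExLoop0].
apply: (@ExLoopS _ _ _ (upd (upd s a l) b (x :: s b)) _ 5 (7 * size l + 1)).
- by rewrite def_l.
- apply: (@ExCase _ _ _ _ _ _ 3) => //; rewrite def_l.
  have e1 : exec (Pop a) s 1 (upd s a l) by apply: exec_eq; [apply: ExPop|rewrite def_l].
  case: x def_l => def_l; apply: (exec_seq (T1 := 1) (T2 := 2) e1);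
    by apply: exec_eq; [apply: ExPush|rewrite upd_diff].
- apply: exec_eq; first by apply: IH; rewrite upd_diff ?upd_same.
  by rewrite !upd_same; steq.
- by rewrite /=; lia.
Qed.

Lemma exec_clear a s : exec (clear a) s (3 * size (s a) + 1) (upd s a [::]).
Proof.
move def_l : (s a) => l; elim: l s def_l => [|x l IH] s def_l.
  by apply: (@exec_to _ _ _ _ s); [steq|apply: ExLoop0].
apply: (@ExLoopS _ _ _ (upd s a l) _ 1 (3 * size l + 1)).
- by rewrite def_l.
- by apply: exec_eq; [apply: ExPop|rewrite def_l].
- by apply: exec_eq; [apply: IH; rewrite upd_same|steq].
- by rewrite /=; lia.
Qed.

Lemma exec_copy a f t s : [&& a != f, a != t & f != t] -> s t = [::] ->
  exec (copy a f t) s (16 * size (s a) + 2) (upd s f (s a ++ s f)).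
Proof.
case/and3P=> af at_ ft st.
have [fa ta tf] : [/\ f != a, t != a & t != f] by split; rewrite eq_sym.
have E := (eqxx, negbTE af, negbTE at_, negbTE ft, negbTE fa, negbTE ta, negbTE tf).
set s1 := upd (upd s t (rev (s a))) a [::].
have e1 : exec (move a t) s (7 * size (s a) + 1) s1.
  by apply: exec_eq; [apply: exec_move|rewrite st -/(rev _)].
have e2 l u : exec (Loop t (Case t (Pop t ;; Push a true ;; Push f true)
   (Pop t ;; Push a false ;; Push f false) Skip)) (upd (upd (upd s t l) a u) f (u ++ s f))
   (9 * size l + 1) (upd (upd (upd s t [::]) a (catrev l u)) f (catrev l u ++ s f)).
  elim: l u => [|x l IH] u.
    by apply: exec_eq; [apply: ExLoop0 => //; rewrite /upd !E|].
  apply: (@ExLoopS _ _ _ (upd (upd (upd s t l) a (x :: u)) f (x :: u ++ s f)) _ 7 (9 * size l + 1)).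
  - by rewrite /upd !E.
  - apply: (@ExCase _ _ _ _ _ _ 5) => //; rewrite /upd !E.
    have ep : exec (Pop t) (upd (upd (upd s t (x :: l)) a u) f (u ++ s f)) 1
       (upd (upd (upd s t l) a u) f (u ++ s f)).
      apply: exec_eq; first exact: ExPop.
      by rewrite /upd !E; steq.
    have eb b : exec (Push a b ;; Push f b) (upd (upd (upd s t l) a u) f (u ++ s f)) 4
       (upd (upd (upd s t l) a (b :: u)) f (b :: u ++ s f)).
      apply: (exec_seq (T1 := 2) (T2 := 2)); [exact: ExPush|apply: exec_eq; [exact: ExPush|]].
      by rewrite /upd !E; steq; rewrite ?E.
    by case: x ep => ep; apply: (exec_seq (T1 := 1) (T2 := 4) ep); apply: eb.
  - by have := IH (x :: u).
  - by rewrite /=; lia.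
apply: exec_weaken (exec_seq e1 _); last first.
  apply: exec_eq.
    have := e2 (rev (s a)) [::].
    rewrite (_ : upd _ _ _ = s1); first by apply.
    by rewrite /s1; steq.
  by rewrite catrevE revK cats0; steq.
by rewrite size_rev; lia.
Qed.

Lemma exec_drop_by f g s n : f != g -> s f = un n ->
  exec (drop_by f g) s (n * 4 + 1) (upd (upd s f [::]) g (drop n (s g))).
Proof.
move=> fg sf; have gf : g != f by rewrite eq_sym.
have E := (eqxx, negbTE fg, negbTE gf).
have := @exec_loop (fun k => upd (upd s f (un (n - k))) g (drop k (s g))) n (Pop f ;; Pop g) f 2.
rewrite subn0 subnn drop0 => H; rewrite {1}(_ : s = upd (upd s f (un n)) g (s g)).
  apply: H; last by rewrite /upd !E.
  move=> k lt_k; split; first by rewrite /upd !E; move: lt_k; rewrite -subn_gt0; case: (n - k).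
  apply: (exec_seq (T1 := 1) (T2 := 1)); first exact: ExPop.
  apply: exec_eq; first exact: ExPop.
  rewrite /upd !E -add1n -drop_drop drop1.
  have -> : behead (un (n - k)) = un (n - (1 + k)) by rewrite addnC subnDA subn1; case: (n - k).
  by steq.
by steq; rewrite sf.
Qed.

Lemma exec_flag f g s : f != g -> s f = [::] ->
  exec (flag g f) s (3 * size (s g) + 5) (upd (upd s g [::]) f (un (head false (s g)))).
Proof.
move=> fg sf; apply: (@ExCase _ _ _ _ _ _ (3 * size (s g) + 3)); last by lia.
case def_g : (s g) => [|[] l] /=.
- by apply: (@exec_to _ _ _ _ s); [steq|apply: ExSkip].
- apply: (@exec_weaken _ _ (3 * size (s g) + 1 + 2)); first by rewrite def_g /=; lia.
  apply: exec_seq (exec_clear g s) _; apply: exec_eq; first exact: ExPush.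
  by rewrite upd_diff // sf.
- apply: (@exec_weaken _ _ (3 * size (s g) + 1)); first by rewrite def_g /=; lia.
  by apply: exec_eq (exec_clear g s) _; steq.
Qed.

(* [vb x S] and [tb x S] bound the value of [x] and the running time of its code
   when the input, the variables and the arrays have size at most [S]. *)
Fixpoint vb (x : ex) (S : nat) : nat :=
  match x with
  | Var _ | Len => S
  | Add a b => vb a S + vb b S
  | Mul a b => vb a S * vb b S
  | Let a b => vb b (S + vb a S)
  | Mu a _ => vb a S
  | _ => 1
  end.

Fixpoint tb (x : ex) (S : nat) : nat :=
  match x with
  | Var _ => 16 * S + 2
  | One => 2
  | Add a b => tb a S + tb b S + 7 * vb b S + 1
  | Mul a b =>
      tb a S + tb b S + vb a S * (16 * vb b S + 5) + 1 + 3 * vb b S + 1 +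
      7 * (vb a S * vb b S) + 1
  | Lt a b => tb a S + tb b S + (vb a S * 4 + 1) + (3 * vb b S + 5)
  | Len => 21 * S + 3
  | Inp a => tb a S + (16 * S + 2) + (vb a S * 4 + 1) + (3 * S + 5)
  | Rd _ a => tb a S + (16 * S + 2) + (7 * S + 1) + (vb a S * 4 + 1) + (3 * S + 5)
  | Let a b =>
      let B := S + vb a S in
      tb a S + tb b B + (3 * vb a S + 1) + (7 * vb b B + 1)
  | Mu a p =>
      let B := S + vb a S in
      tb a S + (vb a S * (tb p B + 3 * vb p B + 3 * B + 9) + 1) + (7 * vb a S + 1)
  | Cov p a =>
      let B := S + vb a S in
      tb a S + 2 + (((vb a S).+1 * (tb p B + 3 * vb p B + 11) + 1)) +
      (3 * (vb a S).+1 + 1) + (3 * (vb a S).+1 + 5)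
  end.

Definition bounded (S : nat) (c : ctx) : Prop :=
  [/\ size (cw c) <= S, forall i, cv c i <= S & forall i, size (ca c i) <= S].

Lemma bounded_vcons S x c : bounded S c -> x <= S -> bounded S (vcons x c).
Proof. by case=> h1 h2 h3 hx; split=> //= -[]. Qed.

Lemma bounded_acons S l c : bounded S c -> size l <= S -> bounded S (acons l c).
Proof. by case=> h1 h2 h3 hx; split=> //= -[]. Qed.

Lemma bounded_leq S S' c : S <= S' -> bounded S c -> bounded S' c.
Proof.
move=> le [h1 h2 h3]; split=> [|i|i]; exact: (leq_trans _ le).
Qed.

Lemma eval_vb x S c : bounded S c -> eval x c <= vb x S.
Proof.
elim: x S c => [i||a IHa b IHb|a IHa b IHb|a _ b _||a _|r a _|a IHa b IHb|a IHa p _|p _ a _] S c Hc /=;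
  try exact: leq_b1; try by [].
- by case: Hc.
- by apply: leq_add; auto.
- by apply: leq_mul; auto.
- by case: Hc.
- apply: IHb; apply: bounded_vcons; first by apply: bounded_leq Hc; apply: leq_addr.
  by apply: leq_trans (IHa _ _ Hc) _; apply: leq_addl.
- by apply: leq_trans (IHa _ _ Hc); apply: mu_le.
Qed.

(* [s] is a memory in which the variables are the stacks [V], the arrays the
   stacks [A] with their last entry on top, and everything from [f] on is free. *)
Record stores (c : ctx) (V A : seq nat) (f : nat) (s : stacks) : Prop := Stores {
  st_w : s 0 = cw c;
  st_f : 0 < f;
  st_V : all (fun i => i < f) V;
  st_A : all (fun i => i < f) A;
  st_v : forall i, if i < size V then s (nth 0 V i) = un (cv c i) else cv c i = 0;
  st_a : forall i, if i < size A then s (nth 0 A i) = rev (ca c i) else ca c i = [::];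
  st_free : forall j, f <= j -> s j = [::] }.

Lemma stores_nth V f i : all (fun i => i < f) V -> i < size V -> nth 0 V i < f.
Proof. by move=> /(all_nthP 0) h; apply: h. Qed.

Lemma stores_upd c V A f s v : stores c V A f s -> stores c V A f.+1 (upd s f v).
Proof.
case=> h1 h2 h3 h4 h5 h6 h7.
have hle (B : seq nat) : all (fun i => i < f) B -> all (fun i => i < f.+1) B.
  by apply: sub_all => i; lia.
split; auto.
- by rewrite /upd; case: eqP => //; lia.
- move=> i; have := h5 i; case: ifP => // hi <-.
  by rewrite upd_diff //; have := stores_nth h3 hi; lia.
- move=> i; have := h6 i; case: ifP => // hi <-.
  by rewrite upd_diff //; have := stores_nth h4 hi; lia.
- by move=> j hj; rewrite upd_diff ?h7 //; lia.
Qed.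

Lemma stores_vcons c V A f s x : stores c V A f s ->
  stores (vcons x c) (f :: V) A f.+1 (upd s f (un x)).
Proof.
move=> h; case: (stores_upd (un x) h) => h1 h2 h3 h4 h5 h6 h7.
by split=> //=; [rewrite ltnS leqnn|case=> [|i] /=; rewrite ?upd_same //; have := h5 i].
Qed.

Lemma stores_acons c V A f s l : stores c V A f s ->
  stores (acons l c) V (f :: A) f.+1 (upd s f (rev l)).
Proof.
move=> h; case: (stores_upd (rev l) h) => h1 h2 h3 h4 h5 h6 h7.
by split=> //=; [rewrite ltnS leqnn|case=> [|i] /=; rewrite ?upd_same //; have := h6 i].
Qed.

Lemma catrev_un m l : catrev (un m) l = un m ++ l.
Proof. by elim: m l => //= m IH l; rewrite IH; elim: m {IH} => //= m ->. Qed.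

Lemma un_add m n : un m ++ un n = un (m + n).
Proof. by rewrite /un nseqD. Qed.

Lemma drop_un m n : drop m (un n) = un (n - m).
Proof. by rewrite /un drop_nseq. Qed.

Lemma head_drop l n : head false (drop n l) = nth false l n.
Proof. by rewrite -nth0 nth_drop addn0. Qed.

Lemma upd_upd s i v v' : upd (upd s i v) i v' = upd s i v'.
Proof. by steq. Qed.

Lemma upd_swap s i j v v' : i != j -> upd (upd s i v) j v' = upd (upd s j v') i v.
Proof. by move=> /eqP ij; steq. Qed.

Lemma upd_free s i : s i = [::] -> upd s i [::] = s.
Proof. by move=> h; steq. Qed.

Lemma covseqS F t : covseq F t.+1 = rcons (covseq F t) (F t (covseq F t)).
Proof. by []. Qed.

Lemma mu_spec b p : (forall k, k < mu b p -> ~~ p k) /\ (mu b p < b -> p (mu b p)).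
Proof.
rewrite /mu; split=> [k lt_k|lt_b].
  have := before_find 0 lt_k; rewrite nth_iota ?add0n; first by move->.
  by apply: leq_trans lt_k _; rewrite -[X in _ <= X](size_iota 0) find_size.
have h : has p (iota 0 b) by rewrite has_find size_iota.
by have := nth_find 0 h; rewrite nth_iota ?add0n // -[X in _ < X](size_iota 0) -has_find.
Qed.

Lemma exec_compile x V A f s c S : stores c V A f s -> bounded S c ->
  exec (compile x V A f) s (tb x S) (upd s f (un (eval x c))).
Proof.
elim: x V A f s c S => [i||a IHa b IHb|a IHa b IHb|a IHa b IHb||a IHa|r a IHa|a IHa b IHb|a IHa p IHp|p IHp a IHa]
  V A f s c S st Hc /=; have [hw hf hV hA hv ha hfree] := st; have [bw bv ba] := Hc;
  have [f0 f1 f2 f3] : [/\ s f = [::], s f.+1 = [::], s f.+2 = [::] & s f.+3 = [::]] by split; apply: hfree; lia.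
- have := hv i; case: ifP => [hi svi|_ ->]; last first.
    by apply: (@exec_to _ _ _ _ s); [apply/upd_free/hfree|apply: ExSkip].
  have lt := stores_nth hV hi.
  apply: (@exec_weaken _ _ (16 * size (s (nth 0 V i)) + 2)).
    by rewrite svi size_nseq; have := bv i; lia.
  apply: exec_eq; first by apply: exec_copy; [lia|rewrite ?(f0, f1, f2, f3)].
  by rewrite svi (hfree f) // cats0.
- apply: exec_eq; first exact: ExPush.
  by rewrite ?(f0, f1, f2, f3).
- have stb := stores_upd (un (eval a c)) st.
  have va := eval_vb a Hc; have vb_ := eval_vb b Hc.
  apply: (@exec_weaken _ _ (tb a S + (tb b S + (7 * eval b c + 1)))); first by lia.
  apply: exec_seq (IHa _ _ _ _ _ _ st Hc) _.
  apply: exec_seq (IHb _ _ _ _ _ _ stb Hc) _.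
  have hs : upd (upd s f (un (eval a c))) f.+1 (un (eval b c)) f.+1 = un (eval b c) by rewrite upd_same.
  apply: exec_eq.
    apply: (@exec_weaken _ _ (7 * size (upd (upd s f (un (eval a c))) f.+1 (un (eval b c)) f.+1) + 1)).
      by rewrite hs size_nseq.
    by apply: exec_move; lia.
  rewrite hs catrev_un upd_diff ?upd_same; last by lia.
  rewrite un_add addnC; steq; by rewrite ?(f0, f1, f2, f3).
- have stb := stores_upd (un (eval a c)) st.
  have va := eval_vb a Hc; have vb_ := eval_vb b Hc.
  set A0 := eval a c in va stb *; set B0 := eval b c in vb_ *.
  apply: (@exec_weaken _ _ (tb a S + (tb b S + ((A0 * (1 + (16 * B0 + 2) + 2) + 1) +
    ((3 * B0 + 1) + (7 * (A0 * B0) + 1)))))).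
    have := leq_mul va vb_; have : A0 * (16 * B0 + 5) <= vb a S * (16 * vb b S + 5) by apply: leq_mul; lia.
    by rewrite (_ : 1 + (16 * B0 + 2) + 2 = 16 * B0 + 5); lia.
  apply: exec_seq (IHa _ _ _ _ _ _ st Hc) _.
  apply: exec_seq (IHb _ _ _ _ _ _ stb Hc) _.
  set s1 := upd (upd s f _) f.+1 _.
  (* After [k] rounds, [k] units have left stack [f] and [k] copies of [B0] lie on [f.+2]. *)
  set inv := fun k => upd (upd (upd s f (un (A0 - k))) f.+1 (un B0)) f.+2 (un (k * B0)).
  apply: (@exec_seq _ _ _ (inv A0)).
    have -> : s1 = inv 0 by rewrite /s1 /inv subn0 mul0n; steq; rewrite ?(f0, f1, f2, f3).
    apply: exec_loop; last by rewrite /inv subnn; look.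
    move=> k lt_k; split.
      rewrite (_ : inv k f = un (A0 - k)); last by rewrite /inv; look.
      by move: lt_k; rewrite -subn_gt0; case: (A0 - k).
    apply: (@exec_seq _ _ _ (upd (upd (upd s f (un (A0 - k.+1))) f.+1 (un B0)) f.+2 (un (k * B0)))).
      apply: exec_eq; first exact: ExPop.
      rewrite (_ : inv k f = un (A0 - k)); last by rewrite /inv; look.
      have -> : behead (un (A0 - k)) = un (A0 - k.+1) by rewrite subnS; case: (A0 - k).
      by rewrite /inv; steq.
    apply: exec_eq.
      apply: (@exec_weaken _ _ (16 * size (un B0) + 2)); first by rewrite size_nseq.
      have := @exec_copy f.+1 f.+2 f.+3 (upd (upd (upd s f (un (A0 - k.+1))) f.+1 (un B0)) f.+2 (un (k * B0))).
      rewrite [X in 16 * size X](_ : _ = un B0); first by apply; [lia|look].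
      by look.
    rewrite upd_same upd_diff ?upd_same; last by lia.
    by rewrite un_add -mulSn /inv; steq.
  apply: (@exec_seq _ _ _ (upd (inv A0) f.+1 [::])).
    have := exec_clear f.+1 (inv A0); rewrite [X in size X](_ : _ = un B0) ?size_nseq //.
    by rewrite /inv; look.
  apply: exec_eq.
    have := @exec_move f.+2 f (upd (inv A0) f.+1 [::]).
    rewrite [X in 7 * size X](_ : _ = un (A0 * B0)); first by rewrite size_nseq; apply; lia.
    by rewrite /inv; look.
  rewrite /inv [X in catrev X](_ : _ = un (A0 * B0)); last by look.
  rewrite [X in catrev _ X](_ : _ = [::]); last by rewrite subnn; look.
  by rewrite catrev_un cats0; steq; rewrite ?(f0, f1, f2, f3).
- have stb := stores_upd (un (eval a c)) st.
  have va := eval_vb a Hc; have vb_ := eval_vb b Hc.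
  set A0 := eval a c in va stb *; set B0 := eval b c in vb_ *.
  apply: (@exec_weaken _ _ (tb a S + (tb b S + ((A0 * 4 + 1) + (3 * (B0 - A0) + 5))))); first by lia.
  apply: exec_seq (IHa _ _ _ _ _ _ st Hc) _.
  apply: exec_seq (IHb _ _ _ _ _ _ stb Hc) _.
  set s1 := upd (upd s f _) f.+1 _.
  have s1f : s1 f = un A0 by rewrite /s1; look.
  have s1g : s1 f.+1 = un B0 by rewrite /s1 upd_same.
  apply: (exec_seq (@exec_drop_by f f.+1 s1 A0 _ s1f)); first by lia.
  rewrite s1g drop_un; set s2 := upd _ _ _.
  have s2g : s2 f.+1 = un (B0 - A0) by rewrite /s2 upd_same.
  apply: exec_eq.
    have := @exec_flag f f.+1 s2; rewrite s2g size_nseq; apply; first by lia.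
    by rewrite /s2; look.
  have -> : head false (un (B0 - A0)) = (A0 < B0) by rewrite -subn_gt0; case: (B0 - A0).
  by rewrite /s2 /s1; steq; rewrite ?(f0, f1, f2, f3).
- apply: (@exec_weaken _ _ ((16 * size (cw c) + 2) + (size (cw c) * (3 + 2) + 1))); first by lia.
  apply: (@exec_seq _ _ _ (upd s f.+1 (cw c))).
    rewrite -hw; apply: exec_eq; first by apply: exec_copy; [lia|rewrite ?(f0, f1, f2, f3)].
    by rewrite (hfree f.+1) // cats0.
  set n := size (cw c).
  have := @exec_loop (fun k => upd (upd s f.+1 (drop k (cw c))) f (un k)) n (Pop f.+1 ;; Push f true) f.+1 3.
  rewrite drop0 drop_oversize // => H; apply: exec_eq.
    rewrite (_ : upd s _ _ = upd (upd s f.+1 (cw c)) f (un 0)).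
      apply: H; last by look.
      move=> k lt_k; split.
        by rewrite upd_diff ?upd_same; [move=> /(congr1 size); rewrite size_drop /=; lia|lia].
      apply: (@exec_seq _ _ _ (upd (upd s f.+1 (drop k.+1 (cw c))) f (un k)) _ 1 2).
        apply: exec_eq; first exact: ExPop.
        rewrite upd_diff ?upd_same; last by lia.
        by rewrite -drop1 drop_drop add1n; steq.
      apply: exec_eq; first exact: ExPush.
      by rewrite upd_same; steq.
    by steq; rewrite ?(f0, f1, f2, f3).
  by steq; rewrite ?(f0, f1, f2, f3).
- have stb := stores_upd (un (eval a c)) st.
  have va := eval_vb a Hc.
  set A0 := eval a c in va stb *.
  apply: (@exec_weaken _ _ (tb a S + ((16 * size (cw c) + 2) + ((A0 * 4 + 1) + (3 * size (cw c) + 5)))));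
    first by lia.
  apply: exec_seq (IHa _ _ _ _ _ _ st Hc) _.
  set s0 := upd s f _.
  have s0w : s0 0 = cw c by apply: (st_w stb).
  have s0f j : f < j -> s0 j = [::] by apply: (st_free stb).
  apply: (@exec_seq _ _ _ (upd s0 f.+1 (cw c))).
    rewrite -s0w; apply: exec_eq; first by apply: exec_copy; [lia|rewrite s0f].
    by rewrite (s0f f.+1) // cats0.
  set s1 := upd s0 _ _.
  have s1f : s1 f = un A0 by rewrite /s1 /s0; look.
  have s1g : s1 f.+1 = cw c by rewrite /s1 upd_same.
  apply: (exec_seq (@exec_drop_by f f.+1 s1 A0 _ s1f)); first by lia.
  rewrite s1g; set s2 := upd _ _ _.
  have s2g : s2 f.+1 = drop A0 (cw c) by rewrite /s2 upd_same.
  apply: exec_eq.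
    apply: (@exec_weaken _ _ (3 * size (s2 f.+1) + 5)); first by rewrite s2g size_drop; lia.
    by apply: exec_flag; [lia|rewrite /s2; look].
  by rewrite s2g head_drop /s2 /s1 /s0; steq; rewrite ?(f0, f1, f2, f3).
- have := ha r; case: ifP => [hr sr|_ ->]; last first.
    by rewrite nth_nil; apply: (@exec_to _ _ _ _ s); [apply/upd_free/hfree|apply: ExSkip].
  have lt := stores_nth hA hr; set l := ca c r in sr *.
  have stb := stores_upd (un (eval a c)) st.
  have va := eval_vb a Hc; have sl : size l <= S by apply: ba.
  set A0 := eval a c in va stb *.
  apply: (@exec_weaken _ _ (tb a S + ((16 * size l + 2) + ((7 * size l + 1) + ((A0 * 4 + 1) + (3 * size l + 5))))));
    first by lia.
  apply: exec_seq (IHa _ _ _ _ _ _ st Hc) _.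
  set s0 := upd s f _.
  have s0r : s0 (nth 0 A r) = rev l by rewrite /s0 upd_diff ?sr //; lia.
  have s0f j : f < j -> s0 j = [::] by apply: (st_free stb).
  apply: (@exec_seq _ _ _ (upd s0 f.+1 (rev l))).
    rewrite -(size_rev l) -s0r; apply: exec_eq; first by apply: exec_copy; [lia|rewrite s0f].
    by rewrite (s0f f.+1) // cats0.
  (* The array is stored with its last entry on top; moving the copy reverses it, so that dropping
     [A0] items exposes entry [A0]. *)
  apply: (@exec_seq _ _ _ (upd s0 f.+2 l)).
    have := @exec_move f.+1 f.+2 (upd s0 f.+1 (rev l)).
    rewrite upd_same size_rev => H; apply: exec_eq; first by apply: H; lia.
    rewrite catrevE revK upd_diff ?s0f ?cats0 //; last by lia.
    by steq; rewrite s0f.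
  set s1 := upd s0 _ _.
  have s1f : s1 f = un A0 by rewrite /s1 /s0; look.
  have s1g : s1 f.+2 = l by rewrite /s1 upd_same.
  apply: (exec_seq (@exec_drop_by f f.+2 s1 A0 _ s1f)); first by lia.
  rewrite s1g; set s2 := upd _ _ _.
  have s2g : s2 f.+2 = drop A0 l by rewrite /s2 upd_same.
  apply: exec_eq.
    apply: (@exec_weaken _ _ (3 * size (s2 f.+2) + 5)); first by rewrite s2g size_drop; lia.
    by apply: exec_flag; [lia|rewrite /s2; look].
  by rewrite s2g head_drop /s2 /s1 /s0; steq; rewrite ?(f0, f1, f2, f3).
- have va := eval_vb a Hc; set A0 := eval a c in va *.
  have stb : stores (vcons A0 c) (f :: V) A f.+1 (upd s f (un A0)) by apply: stores_vcons.
  have Hb : bounded (S + vb a S) (vcons A0 c).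
    by apply: bounded_vcons; [apply: bounded_leq Hc; lia|lia].
  have vb_ := eval_vb b Hb; set B0 := eval b _ in vb_ *.
  apply: (@exec_weaken _ _ (tb a S + (tb b (S + vb a S) + ((3 * A0 + 1) + (7 * B0 + 1))))); first by lia.
  apply: exec_seq (IHa _ _ _ _ _ _ st Hc) _.
  apply: exec_seq (IHb _ _ _ _ _ _ stb Hb) _.
  rewrite -/A0 -/B0; set s1 := upd _ _ _.
  apply: (@exec_seq _ _ _ (upd s1 f [::])).
    have := exec_clear f s1; rewrite [X in size X](_ : _ = un A0) ?size_nseq //.
    by rewrite /s1; look.
  have := @exec_move f.+1 f (upd s1 f [::]).
  rewrite [X in 7 * size X](_ : _ = un B0); last by rewrite /s1; look.
  rewrite size_nseq => H; apply: exec_eq; first by apply: H; lia.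
  rewrite upd_same [X in catrev X](_ : _ = un B0); last by rewrite /s1; look.
  by rewrite catrev_un cats0 /s1; steq; rewrite ?(f0, f1, f2, f3).
- have va := eval_vb a Hc; set A0 := eval a c in va *.
  set B := S + vb a S; set P := fun x => 0 < eval p (vcons x c).
  set m := mu A0 P; have lm : m <= A0 := mu_le _ _.
  have [mN mY] := mu_spec A0 P; rewrite -/m in mN mY.
  set it := tb p B + 3 * vb p B + 3 * B + 9.
  apply: (@exec_weaken _ _ (tb a S + ((A0 * it + 1) + (7 * m + 1)))).
    by have : A0 * it <= vb a S * it; [rewrite leq_mul2r va orbT|lia].
  apply: exec_seq (IHa _ _ _ _ _ _ st Hc) _.
  apply: (@exec_seq _ _ _ (upd s f.+1 (un m))); last first.
    have := @exec_move f.+1 f (upd s f.+1 (un m)).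
    rewrite upd_same size_nseq => H; apply: exec_eq; first by apply: H; lia.
    rewrite catrev_un upd_diff ?(f0, f1, f2, f3) ?cats0 //; last by lia.
    by steq; rewrite ?(f0, f1, f2, f3).
  set inv := fun k => upd (upd s f (un (A0 - k))) f.+1 (un k).
  have ev k : k < A0 -> exec (Pop f ;; compile p (f.+1 :: V) A f.+2) (inv k) (1 + tb p B)
     (upd (upd (upd s f (un (A0 - k.+1))) f.+1 (un k)) f.+2 (un (eval p (vcons k c)))).
    move=> lt_k; apply: (@exec_seq _ _ _ (upd (upd s f (un (A0 - k.+1))) f.+1 (un k))).
      apply: exec_eq; first exact: ExPop.
      rewrite (_ : inv k f = un (A0 - k)); last by rewrite /inv; look.
      have -> : behead (un (A0 - k)) = un (A0 - k.+1) by rewrite subnS; case: (A0 - k).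
      by rewrite /inv; steq.
    apply: IHp; last first.
      by apply: bounded_vcons; [apply: bounded_leq Hc; rewrite /B; lia|rewrite /B; lia].
    by apply: stores_vcons; apply: stores_upd.
  have bd k : k < A0 -> bounded B (vcons k c).
    by move=> ?; apply: bounded_vcons; [apply: bounded_leq Hc; rewrite /B; lia|rewrite /B; lia].
  have -> : upd s f (un A0) = inv 0 by rewrite /inv subn0; steq; rewrite ?(f0, f1, f2, f3).
  (* Induction on the number [j] of rounds before the least solution [m]; a success clears the
     counter [f], which ends the loop. *)
  have main j : forall k, k + j = m -> exec (Loop f (Pop f ;; compile p (f.+1 :: V) A f.+2 ;;
              Case f.+2 (clear f.+2 ;; clear f) Skip (Push f.+1 true))) (inv k)
              ((A0 - k) * it + 1) (upd s f.+1 (un m)).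
    elim: j => [|j IHj] k ekm; last first.
      have lt_k : k < A0 by lia.
      have Pk : eval p (vcons k c) = 0 by have := mN k; rewrite /P -eqn0Ngt => H; apply/eqP/H; lia.
      apply: (@ExLoopS _ _ _ (inv k.+1) _ (it - 2) ((A0 - k.+1) * it + 1)).
      - rewrite /inv upd_diff ?upd_same; last by lia.
        by move: lt_k; rewrite -subn_gt0; case: (A0 - k).
      - apply: (@exec_weaken _ _ (1 + tb p B + 4)); first by rewrite /it; lia.
        apply: exec_seqA; apply: exec_seq (ev k lt_k) _.
        apply: (@ExCase _ _ _ _ _ _ 2) => //; rewrite upd_same Pk /=.
        apply: exec_eq; first exact: ExPush.
        rewrite /inv upd_diff ?upd_same; last by lia.
        by steq; rewrite ?(f0, f1, f2, f3).
      - by apply: IHj; lia.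
      - have -> : A0 - k = (A0 - k.+1).+1 by lia.
        by rewrite mulSn /it; lia.
    have {ekm} -> : k = m by lia.
    case: (ltnP m A0) => [lt_m|ge_m]; last first.
      have -> : A0 - m = 0 by lia.
      apply: (@exec_to _ _ _ _ (inv m)); last by apply: ExLoop0; rewrite // /inv (_ : A0 - m = 0); [look|lia].
      by rewrite /inv (_ : A0 - m = 0); [steq; rewrite ?(f0, f1, f2, f3)|lia].
    have Pm := mY lt_m; have vp := eval_vb p (bd m lt_m).
    apply: (@ExLoopS _ _ _ (upd s f.+1 (un m)) _ (it - 3) 1).
    + rewrite /inv upd_diff ?upd_same; last by lia.
      by move: lt_m; rewrite -subn_gt0; case: (A0 - m).
    + apply: (@exec_weaken _ _ (1 + tb p B + (3 * vb p B + 1 + (3 * B + 1) + 2))); first by rewrite /it; lia.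
      apply: exec_seqA; apply: exec_seq (ev m lt_m) _.
      apply: (@ExCase _ _ _ _ _ _ (3 * vb p B + 1 + (3 * B + 1))) => //; rewrite upd_same.
      rewrite (_ : branch _ _ _ _ = (clear f.+2 ;; clear f)); last by move: Pm; rewrite /P; case: eval.
      set s1 := upd _ f.+2 _.
      apply: (@exec_seq _ _ _ (upd s1 f.+2 [::])).
        apply: exec_weaken (exec_clear _ _); rewrite /s1 upd_same size_nseq; lia.
      apply: exec_eq.
        apply: exec_weaken (exec_clear _ _); rewrite /s1 [upd _ _ _ f](_ : _ = un (A0 - m.+1)); last by look.
        by rewrite size_nseq /B; lia.
      by rewrite /s1; steq; rewrite ?(f0, f1, f2, f3).
    + by apply: ExLoop0 => //; look.
    + have : it <= (A0 - m) * it by rewrite -[X in X <= _]mul1n leq_mul2r; lia.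
      by rewrite /it; lia.
  by have := main m 0; rewrite add0n subn0; apply.
- have va := eval_vb a Hc; set A0 := eval a c in va *.
  set B := S + vb a S; set F := fun x l => 0 < eval p (vcons x (acons l c)).
  set it := tb p B + 3 * vb p B + 11.
  apply: (@exec_weaken _ _ (tb a S + (2 + ((A0.+1 * it + 1) + ((3 * A0.+1 + 1) + (3 * A0.+1 + 5)))))).
    by have : A0.+1 * it <= (vb a S).+1 * it; [rewrite leq_mul2r ltnS va orbT|lia].
  apply: exec_seq (IHa _ _ _ _ _ _ st Hc) _.
  (* One round more than [A0]: the value at [A0] is the last entry of [covseq F A0.+1]. *)
  apply: (@exec_seq _ _ _ (upd s f (un A0.+1))).
    by apply: exec_eq; [apply: ExPush|rewrite upd_same; steq].
  set inv := fun k => upd (upd (upd s f (un (A0.+1 - k))) f.+1 (un k)) f.+2 (rev (covseq F k)).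
  apply: (@exec_seq _ _ _ (inv A0.+1)); last first.
    apply: (@exec_seq _ _ _ (upd (inv A0.+1) f.+1 [::])).
      apply: exec_weaken (exec_clear _ _); rewrite /inv upd_diff ?upd_same ?size_nseq; lia.
    set s1 := upd _ f.+1 _.
    have s1g : s1 f.+2 = rev (covseq F A0.+1) by rewrite /s1 /inv; look.
    apply: exec_eq.
      apply: (@exec_weaken _ _ (3 * size (s1 f.+2) + 5)); first by rewrite s1g size_rev size_covseq.
      apply: exec_flag; first by lia.
      by rewrite /s1 /inv subnn; look.
    rewrite s1g /cov covseqS rev_rcons last_rcons /= /s1 /inv.
    by steq; rewrite ?(f0, f1, f2, f3).
  have -> : upd s f (un A0.+1) = inv 0 by rewrite /inv subn0; steq; rewrite ?(f0, f1, f2, f3).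
  have -> : it = (it - 2) + 2 by rewrite /it; lia.
  apply: exec_loop; last by rewrite /inv subnn; look.
  move=> k lt_k; split.
    rewrite (_ : inv k f = un (A0.+1 - k)); last by rewrite /inv; look.
    by move: lt_k; rewrite -subn_gt0; case: (A0.+1 - k).
  set ck := vcons k (acons (covseq F k) c).
  have Hb : bounded B ck.
    apply: bounded_vcons; last by rewrite /B; lia.
    by apply: bounded_acons; [apply: bounded_leq Hc|rewrite size_covseq]; rewrite /B; lia.
  have vp := eval_vb p Hb.
  set s1 := upd (upd (upd s f (un (A0.+1 - k.+1))) f.+1 (un k)) f.+2 (rev (covseq F k)).
  apply: (@exec_weaken _ _ (1 + (tb p B + ((3 * vb p B + 1 + 2 + 2) + 2)))); first by rewrite /it; lia.
  apply: (@exec_seq _ _ _ s1).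
    apply: exec_eq; first exact: ExPop.
    rewrite (_ : inv k f = un (A0.+1 - k)); last by rewrite /inv; look.
    have -> : behead (un (A0.+1 - k)) = un (A0.+1 - k.+1) by rewrite subnS; case: (A0.+1 - k).
    by rewrite /s1 /inv; steq.
  apply: (@exec_seq _ _ _ (upd s1 f.+3 (un (eval p ck)))).
    apply: IHp Hb; rewrite /s1 upd_swap; last by lia.
    have /(stores_acons (covseq F k)) : stores c V A f.+2 (upd (upd s f (un (A0.+1 - k.+1))) f.+1 (un k)).
      by do 2!apply: stores_upd.
    rewrite upd_swap; last by lia.
    case=> h1 h2 h3 h4 h5 h6 h7; split=> //=.
    + by rewrite h3 andbT; lia.
    + case=> [|i] /=; last by have := h5 i.
      by rewrite upd_same.
  apply: (@exec_seq _ _ _ (upd s1 f.+2 (F k (covseq F k) :: rev (covseq F k)))).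
    apply: ExCase (leqnn _); rewrite upd_same.
    case: (posnP (eval p ck)) => [e0|gt0].
      rewrite e0 /=; have -> : F k (covseq F k) = false by rewrite /F -/ck e0.
      apply: exec_eq; first by apply: ExPush; lia.
      rewrite upd_diff; last by lia.
      by rewrite /s1 upd_same; steq; rewrite ?(f0, f1, f2, f3).
    rewrite (_ : branch _ _ _ _ = (clear f.+3 ;; Push f.+2 true)); last by move: gt0; case: eval.
    have -> : F k (covseq F k) = true by rewrite /F -/ck gt0.
    apply: (@exec_seq _ _ _ s1); last by apply: exec_eq; [apply: ExPush|rewrite /s1 upd_same; steq].
    apply: exec_eq.
      by apply: exec_weaken (exec_clear _ _); rewrite upd_same size_nseq; lia.
    by rewrite upd_upd upd_free // /s1; look.
  apply: exec_eq; first exact: ExPush.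
  rewrite /s1 /inv covseqS rev_rcons upd_diff; last by lia.
  rewrite upd_diff; last by lia.
  by rewrite upd_same; steq.
Qed.

(** * Polynomial bounds and generators *)

(** For [S > 1] the bounds by powers of [S] are closed under sums, as [2 * S ^ c <= S ^ c.+1]; the
    two small arguments return as an additive constant in [polybounded_le]. *)
Definition polybounded (f : nat -> nat) : Prop :=
  exists c, forall S, 1 < S -> f S <= S ^ c.

Lemma polybounded_cst k : polybounded (fun=> k).
Proof.
exists k => S hS; apply: leq_trans (ltnW (ltn_expl k (leqnn 2))) _.
by case: k => // k; rewrite leq_exp2r.
Qed.

Lemma polybounded_id : polybounded id.
Proof. by exists 1 => S; rewrite expn1. Qed.

Lemma polybounded_mul f g :
  polybounded f -> polybounded g -> polybounded (fun S => f S * g S).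
Proof.
move=> [a ha] [b hb]; exists (a + b) => S hS.
by rewrite expnD leq_mul ?ha ?hb.
Qed.

Lemma polybounded_add f g :
  polybounded f -> polybounded g -> polybounded (fun S => f S + g S).
Proof.
move=> [a ha] [b hb]; exists (maxn a b).+1 => S hS.
rewrite expnS; apply: leq_trans (_ : 2 * S ^ maxn a b <= _); last by rewrite leq_mul2r hS orbT.
rewrite mul2n -addnn leq_add //.
  by apply: leq_trans (ha S hS) _; rewrite leq_exp2l // leq_maxl.
by apply: leq_trans (hb S hS) _; rewrite leq_exp2l // leq_maxr.
Qed.

Lemma polybounded_comp f g :
  polybounded f -> polybounded g -> (forall S, 1 < S -> 1 < g S) ->
  polybounded (fun S => f (g S)).
Proof.
move=> [a ha] [b hb] g1; exists (b * a) => S hS.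
apply: leq_trans (ha _ (g1 S hS)) _; rewrite expnM; case: a {ha} => // a.
by rewrite leq_exp2r // hb.
Qed.

Lemma polybounded_eq f g : f =1 g -> polybounded f -> polybounded g.
Proof. by move=> e [a ha]; exists a => S hS; rewrite -e ha. Qed.

Lemma polybounded_le f : polybounded f -> exists c, forall n, f n <= n ^ c + c.
Proof.
move=> [a ha]; exists (a + f 0 + f 1) => -[|[|n]].
- by apply: leq_trans (leq_addl _ _); lia.
- by apply: leq_trans (leq_addl _ _); lia.
apply: leq_trans (ha n.+2 isT) _; apply: leq_trans (leq_addr _ _).
by rewrite leq_exp2l //; lia.
Qed.

Ltac polyb := repeat first
  [ assumption | exact: polybounded_cst | exact: polybounded_id
  | apply: polybounded_add | apply: polybounded_mul ].

Lemma polybounded_vb x : polybounded (vb x).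
Proof.
elim: x => /= [i||a ? b ?|a ? b ?|a ? b ?||a ?|r a ?|a IHa b IHb|a ? p ?|p ? a ?]; polyb.
apply: (polybounded_comp (g := fun S => S + vb a S)); polyb.
by move=> S; lia.
Qed.

Lemma polybounded_tb x : polybounded (tb x).
Proof.
have vbP := polybounded_vb.
have cp f a : polybounded f -> polybounded (fun S => f (S + vb a S)).
  move=> hf; apply: (polybounded_comp (g := fun S => S + vb a S)) => //; last by move=> S; lia.
  by apply: polybounded_add; [exact: polybounded_id|exact: vbP].
have sP a : polybounded (fun S => (vb a S).+1).
  apply: (polybounded_eq (f := fun S => 1 + vb a S)); first by move=> S; rewrite add1n.
  by apply: polybounded_add; [exact: polybounded_cst|exact: vbP].
elim: x => /= [i||a ? b ?|a ? b ?|a ? b ?||a ?|r a ?|a IHa b IHb|a ? p ?|p ? a ?];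
  repeat first [apply: vbP | apply: sP | apply: cp | assumption | exact: polybounded_cst
  | exact: polybounded_id | apply: polybounded_add | apply: polybounded_mul ].
Qed.

(** An expression yields one number, the reduction a whole word: a generator emits bits inside loops
    whose bounds are expressions, hence polynomial in the length of the input. *)
Inductive gen := GEmit of ex | GCat of gen & gen | GFor of ex & gen.

Fixpoint gsem (g : gen) (c : ctx) : seq bool :=
  match g with
  | GEmit x => [:: 0 < eval x c]
  | GCat g1 g2 => gsem g1 c ++ gsem g2 c
  | GFor x g => flatten [seq gsem g (vcons i c) | i <- iota 0 (eval x c)]
  end.

(** Stack 1 is reserved for the output, which is pushed bit by bit and so comes out reversed;
    [polytime_gen] ends with a [move] onto stack 0 that restores the order. *)
Fixpoint compg (g : gen) (V : seq nat) (f : nat) : cmd :=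
  match g with
  | GEmit x => compile x V [::] f ;; Case f (clear f ;; Push 1 true) Skip (Push 1 false)
  | GCat g1 g2 => compg g1 V f ;; compg g2 V f
  | GFor x g =>
      compile x V [::] f ;; Loop f (Pop f ;; compg g (f.+1 :: V) f.+2 ;; Push f.+1 true) ;;
      clear f.+1
  end.

Fixpoint tg (g : gen) (S : nat) : nat :=
  match g with
  | GEmit x => tb x S + (3 * vb x S + 5)
  | GCat g1 g2 => tg g1 S + tg g2 S
  | GFor x g => tb x S + ((vb x S * (tg g (S + vb x S) + 5) + 1) + (3 * vb x S + 1))
  end.

Fixpoint gb (g : gen) (S : nat) : nat :=
  match g with
  | GEmit _ => 1
  | GCat g1 g2 => gb g1 S + gb g2 S
  | GFor x g => vb x S * gb g (S + vb x S)
  end.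

Lemma size_gsem g S c : bounded S c -> size (gsem g c) <= gb g S.
Proof.
elim: g S c => [x|g1 IH1 g2 IH2|x g IH] S c Hc //=.
  by rewrite size_cat leq_add ?IH1 ?IH2.
rewrite size_flatten /shape -map_comp sumnE big_map.
have vx := eval_vb x Hc.
apply: leq_trans (_ : \sum_(i <- iota 0 (eval x c)) gb g (S + vb x S) <= _).
  rewrite big_seq [X in _ <= X]big_seq leq_sum // => i; rewrite mem_iota add0n => /= hi.
  by apply: IH; apply: bounded_vcons; [apply: bounded_leq Hc; lia|lia].
by rewrite big_const_seq count_predT size_iota iter_addn_0 mulnC leq_mul2r vx orbT.
Qed.

Lemma polybounded_tg g : polybounded (tg g) /\ polybounded (gb g).
Proof.
have vbP := polybounded_vb; have tbP := polybounded_tb.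
have cp f a : polybounded f -> polybounded (fun S => f (S + vb a S)).
  move=> hf; apply: (polybounded_comp (g := fun S => S + vb a S)) => //; last by move=> S; lia.
  by apply: polybounded_add; [exact: polybounded_id|exact: vbP].
elim: g => [x|g1 [? ?] g2 [? ?]|x g [? ?]] /=; split;
  repeat first [apply: vbP | apply: tbP | apply: cp | assumption | exact: polybounded_cst
  | apply: polybounded_add | apply: polybounded_mul ].
Qed.

Lemma stores_out c V f s l : stores c V [::] f s -> all (fun i => i != 1) V -> 1 < f ->
  stores c V [::] f (upd s 1 l).
Proof.
case=> h1 h2 h3 h4 h5 h6 h7 hV hf; split=> //.
- move=> i; have := h5 i; case: ifP => // hi <-.
  by rewrite upd_diff //; move/(all_nthP 0): hV; apply.
- by move=> j hj; rewrite upd_diff ?h7 //; lia.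
Qed.

Lemma exec_compg g V f s c S : stores c V [::] f s -> all (fun i => i != 1) V -> 1 < f ->
  bounded S c -> exec (compg g V f) s (tg g S) (upd s 1 (rev (gsem g c) ++ s 1)).
Proof.
elim: g V f s c S => [x|g1 IH1 g2 IH2|x g IH] V f s c S st hV hf Hc /=; have hfree := st_free st.
- have vx := eval_vb x Hc.
  apply: exec_seq (exec_compile x st Hc) _.
  apply: (@ExCase _ _ _ _ _ _ (3 * vb x S + 1 + 2)); last by lia.
  rewrite upd_same; case: (posnP (eval x c)) => [e0|gt0].
    rewrite e0 /=; apply: exec_eq; first by apply: ExPush; lia.
    by rewrite upd_diff; [steq; rewrite hfree|lia].
  rewrite (_ : branch _ _ _ _ = (clear f ;; Push 1 true)); last by move: gt0; case: eval.
  apply: (@exec_seq _ _ _ s); last by apply: ExPush.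
  apply: exec_eq; first by apply: exec_weaken (exec_clear _ _); rewrite upd_same size_nseq; lia.
  by rewrite upd_upd upd_free ?hfree.
- apply: exec_seq (IH1 _ _ _ _ _ st hV hf Hc) _; apply: exec_eq.
    by apply: (IH2 _ _ _ c) => //; apply: stores_out.
  by rewrite upd_same upd_upd rev_cat catA.
- have vx := eval_vb x Hc; set B := eval x c in vx *.
  set G := fun k => flatten [seq gsem g (vcons i c) | i <- iota 0 k].
  set inv := fun k => upd (upd (upd s f (un (B - k))) f.+1 (un k)) 1 (rev (G k) ++ s 1).
  apply: exec_seq (exec_compile x st Hc) _; rewrite -/B.
  have -> : upd s f (un B) = inv 0.
    by rewrite /inv subn0; steq; rewrite hfree.
  apply: (@exec_weaken _ _ ((B * (tg g (S + vb x S) + 3 + 2) + 1) + (3 * B + 1))).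
    have -> : tg g (S + vb x S) + 3 + 2 = tg g (S + vb x S) + 5 by lia.
    by have : B * (tg g (S + vb x S) + 5) <= vb x S * (tg g (S + vb x S) + 5); [rewrite leq_mul2r vx orbT|lia].
  apply: (@exec_seq _ _ _ (inv B)); last first.
    apply: exec_eq.
      apply: exec_weaken (exec_clear _ _); rewrite [inv B _](_ : _ = un B) ?size_nseq //.
      by rewrite /inv; look.
    by rewrite /inv subnn; steq; rewrite hfree.
  apply: exec_loop; last by rewrite /inv subnn; look.
  move=> k lt_k; have invf : inv k f = un (B - k) by rewrite /inv; look.
  split; first by rewrite invf; move: lt_k; rewrite -subn_gt0; case: (B - k).
  set s1 := upd (upd (upd s f (un (B - k.+1))) f.+1 (un k)) 1 (rev (G k) ++ s 1).
  apply: (@exec_weaken _ _ (1 + (tg g (S + vb x S) + 2))); first by lia.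
  apply: (@exec_seq _ _ _ s1).
    apply: exec_eq; first exact: ExPop.
    rewrite invf; have -> : behead (un (B - k)) = un (B - k.+1) by rewrite subnS; case: (B - k).
    by rewrite /inv /s1; steq.
  apply: (@exec_seq _ _ _ (upd s1 1 (rev (gsem g (vcons k c)) ++ s1 1))).
    apply: (IH _ _ _ (vcons k c)).
    - apply: stores_out; rewrite /= ?hV ?andbT; try lia.
      by apply: stores_vcons; apply: stores_upd.
    - by rewrite /= hV andbT; lia.
    - by lia.
    - by apply: bounded_vcons; [apply: bounded_leq Hc; lia|lia].
  apply: exec_eq; first exact: ExPush.
  have Gk : G k.+1 = G k ++ gsem g (vcons k c).
    by rewrite /G -[k.+1]addn1 iotaD map_cat flatten_cat /= cats0.
  rewrite [upd s1 1 _ f.+1](_ : _ = un k); last by rewrite /s1; look.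
  by rewrite /inv Gk rev_cat /s1 upd_same catA; steq.
Qed.

Definition base_ctx (w : seq bool) : ctx := Ctx w (fun=> 0) (fun=> [::]).

Lemma stores_base w : stores (base_ctx w) [::] [::] 1 (init_stacks w).
Proof. by split=> // -[]. Qed.

Lemma polytime_gen (f : seq bool -> seq bool) (g : gen) :
  (forall w, f w = gsem g (base_ctx w)) -> polytime f.
Proof.
move=> fE; have [pt pg] := polybounded_tg g.
have [c hc] : exists c, forall n, tg g n + (3 * n + 1 + (7 * gb g n + 1)) <= n ^ c + c.
  apply: (polybounded_le (f := fun n => tg g n + (3 * n + 1 + (7 * gb g n + 1)))).
  by polyb.
have [M hM] : exists M, computes_in_time M f (fun n => tg g n + (3 * n + 1 + (7 * gb g n + 1))).
  apply: (@computes_of_exec (compg g [::] 2 ;; (clear 0 ;; move 1 0))) => w.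
  have bd : bounded (size w) (base_ctx w) by [].
  have st : stores (base_ctx w) [::] [::] 2 (init_stacks w) by split=> // -[].
  have := size_gsem g bd; set out := gsem _ _ => so.
  have ec := exec_compg g st isT isT bd; rewrite -/out cats0 in ec.
  exists (upd (upd (init_stacks w) 0 out) 1 [::]); last by rewrite fE.
  apply: exec_seq ec _.
  apply: exec_seq (exec_clear 0 _) _; apply: exec_eq.
    apply: (@exec_weaken _ _ (7 * size (rev out) + 1)); first by rewrite size_rev; lia.
    by apply: (@exec_move 1 0 (upd (upd (init_stacks w) 1 (rev out)) 0 [::])).
  by rewrite /= catrevE revK cats0; steq.
exists M, c => w; have [t [ht h1 h2]] := hM w; exists t; split=> //.
exact: leq_trans ht (hc _).
Qed.

Fixpoint pow_ex (c : nat) : ex := if c is c'.+1 then Mul Len (pow_ex c') else One.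
Fixpoint cst_ex (c : nat) : ex := if c is c'.+1 then Add One (cst_ex c') else Lt One One.

Lemma eval_pow c x : eval (pow_ex c) x = size (cw x) ^ c.
Proof. by elim: c => //= c ->; rewrite expnS. Qed.

Lemma eval_cst c x : eval (cst_ex c) x = c.
Proof. by elim: c => //= c ->. Qed.

(** From the input alone an expression reaches only polynomial values. It is therefore given
    [2 ^ (n ^ c + c)] as a variable, built on stack 2 by repeated doubling; time polynomial in this
    number is exponential in [n]. *)
Lemma EXPTIME_of_ex (L : seq bool -> Prop) (x : ex) (c : nat) :
  (forall w, 0 < eval x (vcons (2 ^ (size w ^ c + c)) (base_ctx w)) <-> L w) -> EXPTIME L.
Proof.
move=> xP; pose p n := n ^ c + c; pose px := Add (pow_ex c) (cst_ex c).
pose Sz n := 2 ^ p n + n + 2.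
pose T S := tb px S + (2 + ((S * (23 * S + 11) + 1) + tb x S)).
have [M hM] : exists M, decides_in_time M L (fun n => T (Sz n) + 1).
  apply: (@decides_of_exec (compile px [::] [::] 1 ;; Push 2 true ;;
    Loop 1 (Pop 1 ;; copy 2 3 4 ;; move 3 2) ;; compile x [:: 2] [::] 3) 3) => w.
  set n := size w; set cx := vcons (2 ^ p n) (base_ctx w).
  have bd0 : bounded (Sz n) (base_ctx w) by split=> //=; rewrite /Sz; lia.
  have bd : bounded (Sz n) cx by apply: bounded_vcons; rewrite // /Sz; lia.
  exists (upd (upd (init_stacks w) 2 (un (2 ^ p n))) 3 (un (eval x cx))); last first.
    by rewrite upd_same -xP -/n -/(p n) -/cx; case: (eval x cx).
  have e1 := exec_compile px (stores_base w) bd0.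
  rewrite /= eval_pow eval_cst /= -/n -/(p n) in e1.
  apply: exec_seq e1 _.
  apply: (@exec_seq _ _ _ (upd (upd (init_stacks w) 1 (un (p n))) 2 (un 1))); first exact: ExPush.
  apply: (@exec_seq _ _ _ (upd (init_stacks w) 2 (un (2 ^ p n)))); last first.
    apply: exec_compile bd; split=> //.
    - by case.
    - by move=> j hj; rewrite upd_diff; case: j hj => // -[|[]].
  have lt_p : p n < 2 ^ p n by apply: ltn_expl.
  apply: (@exec_weaken _ _ (p n * ((23 * 2 ^ p n + 9) + 2) + 1)).
    rewrite leq_add2r; apply: leq_mul; rewrite /Sz; lia.
  set inv := fun k => upd (upd (init_stacks w) 1 (un (p n - k))) 2 (un (2 ^ k)).
  have -> : upd (upd (init_stacks w) 1 (un (p n))) 2 (un 1) = inv 0 by rewrite /inv subn0.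
  have -> : upd (init_stacks w) 2 (un (2 ^ p n)) = inv (p n) by rewrite /inv subnn; steq.
  apply: exec_loop; last by rewrite /inv subnn.
  move=> k lt_k; have le2 : 2 ^ k <= 2 ^ p n by rewrite leq_exp2l // ltnW.
  have inv1 : inv k 1 = un (p n - k) by [].
  split; first by rewrite inv1; move: lt_k; rewrite -subn_gt0; case: (p n - k).
  set s1 := upd (upd (init_stacks w) 1 (un (p n - k.+1))) 2 (un (2 ^ k)).
  apply: (@exec_weaken _ _ (1 + ((16 * 2 ^ k + 2) + (7 * 2 ^ k + 1)))); first by lia.
  apply: (@exec_seq _ _ _ s1).
    apply: exec_eq; first exact: ExPop.
    rewrite inv1; have -> : behead (un (p n - k)) = un (p n - k.+1) by rewrite subnS; case: (p n - k).
    by rewrite /inv /s1; steq.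
  apply: (@exec_seq _ _ _ (upd s1 3 (un (2 ^ k)))).
    have := @exec_copy 2 3 4 s1 isT erefl; rewrite [s1 2](_ : _ = un (2 ^ k)) // size_nseq.
    by rewrite [s1 3](_ : _ = [::]) // cats0.
  have := @exec_move 3 2 (upd s1 3 (un (2 ^ k))) isT.
  rewrite upd_same size_nseq => H; apply: exec_eq H _.
  rewrite catrev_un [upd _ _ _ 2](_ : _ = un (2 ^ k)) // un_add addnn -mul2n -expnS.
  by rewrite /s1 /inv; steq.
have [d hd] : polybounded (fun S => T S + 1).
  have tbP := polybounded_tb.
  rewrite /T; repeat first [apply: tbP | exact: polybounded_cst | exact: polybounded_id
    | apply: polybounded_add | apply: polybounded_mul].
have [e he] : exists e, forall n, (p n + n + 2) * d <= n ^ e + e.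
  apply: (polybounded_le (f := fun n => (p n + n + 2) * d)); rewrite /p.
  apply: polybounded_mul; last exact: polybounded_cst.
  apply: polybounded_add; last exact: polybounded_cst.
  apply: polybounded_add; last exact: polybounded_id.
  by apply: polybounded_add; [exists c|exact: polybounded_cst].
exists M, e => w; have [t [ht h1 h2]] := hM w; exists t; split=> //.
apply: leq_trans ht _; apply: leq_trans (hd _ _) _; first by rewrite /Sz; lia.
apply: leq_trans (_ : 2 ^ ((p (size w) + size w + 2) * d) <= _); last by rewrite leq_exp2l.
rewrite expnM; case: d {hd he} => // d; rewrite leq_exp2r //.
rewrite /Sz [2 ^ (_ + 2)]expnD [2 ^ (_ + size w)]expnD; set a := 2 ^ p _; set b := 2 ^ size w.
have a1 : 0 < a by rewrite expn_gt0.
have b1 : size w < b by apply: ltn_expl.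
have : a + b + 2 <= a * b * 4 by nia.
by lia.
Qed.

(** * Definable functions and their closure properties *)

Definition up (v : nat -> nat) : nat -> nat := fun i => if i is j.+1 then (v j).+1 else 0.

Fixpoint ren (v a : nat -> nat) (x : ex) : ex :=
  match x with
  | Var i => Var (v i)
  | One => One
  | Add x y => Add (ren v a x) (ren v a y)
  | Mul x y => Mul (ren v a x) (ren v a y)
  | Lt x y => Lt (ren v a x) (ren v a y)
  | Len => Len
  | Inp x => Inp (ren v a x)
  | Rd r x => Rd (a r) (ren v a x)
  | Let x y => Let (ren v a x) (ren (up v) a y)
  | Mu x y => Mu (ren v a x) (ren (up v) a y)
  | Cov y x => Cov (ren (up v) (up a) y) (ren v a x)
  end.

Definition cren (v a : nat -> nat) (c : ctx) : ctx :=
  Ctx (cw c) (fun i => cv c (v i)) (fun i => ca c (a i)).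

Lemma cren_vcons v a x c : cren (up v) a (vcons x c) = vcons x (cren v a c).
Proof.
by rewrite /cren /vcons /=; congr Ctx; apply: functional_extensionality; case.
Qed.

Lemma cren_acons v a l c : cren v (up a) (acons l c) = acons l (cren v a c).
Proof.
by rewrite /cren /acons /=; congr Ctx; apply: functional_extensionality; case.
Qed.

Lemma eq_cov F G t : (forall x l, F x l = G x l) -> cov F t = cov G t.
Proof.
move=> e; rewrite /cov; congr last; elim: t.+1 => //= k IH.
by rewrite /covseq /= -/(covseq F k) IH e.
Qed.

Lemma eval_ren v a x c : eval (ren v a x) c = eval x (cren v a c).
Proof.
elim: x v a c => //= [x IHx y IHy|x IHx y IHy|x IHx y IHy|x IHx|r x IHx|x IHx y IHy|x IHx y IHy|y IHy x IHx] v a c;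
  rewrite ?IHx ?IHy //.
- by rewrite cren_vcons.
- by rewrite /mu; apply: eq_find => z; rewrite IHy cren_vcons.
- by congr nat_of_bool; apply: eq_cov => z l; rewrite IHy cren_vcons cren_acons.
Qed.

Definition vtl (c : ctx) : ctx := Ctx (cw c) (fun i => cv c i.+1) (ca c).
Definition atl (c : ctx) : ctx := Ctx (cw c) (cv c) (fun i => ca c i.+1).

Lemma vtl_vcons x c : vtl (vcons x c) = c. Proof. by case: c. Qed.
Lemma atl_vtl_cons x l c : atl (vtl (vcons x (acons l c))) = c. Proof. by case: c. Qed.

(** Definability is stated for functions on contexts, not for expressions: closure lemmas then apply
    directly to the formulas of the game, whose expressions are never written out. *)
Definition Tm (f : ctx -> nat) : Prop := exists x, forall c, eval x c = f c.
Notation Tb p := (Tm (fun c => nat_of_bool (p c))).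

Lemma T_eq f g : f =1 g -> Tm f -> Tm g.
Proof. by move=> e [x hx]; exists x => c; rewrite hx e. Qed.

Lemma T_ren v a f : Tm f -> Tm (fun c => f (cren v a c)).
Proof. by move=> [x hx]; exists (ren v a x) => c; rewrite eval_ren hx. Qed.

Lemma T_vtl f : Tm f -> Tm (fun c => f (vtl c)).
Proof. exact: (@T_ren S id). Qed.

Lemma T_atl f : Tm f -> Tm (fun c => f (atl c)).
Proof. exact: (@T_ren id S). Qed.

Lemma T_var i : Tm (fun c => cv c i). Proof. by exists (Var i). Qed.

Lemma T_cst k : Tm (fun=> k). Proof. by exists (cst_ex k) => c; rewrite eval_cst. Qed.

Lemma T_add f g : Tm f -> Tm g -> Tm (fun c => f c + g c).
Proof. by move=> [x hx] [y hy]; exists (Add x y) => c /=; rewrite hx hy. Qed.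

Lemma T_succ f : Tm f -> Tm (fun c => (f c).+1).
Proof. by move=> [x hx]; exists (Add One x) => c /=; rewrite hx. Qed.

Lemma T_mul f g : Tm f -> Tm g -> Tm (fun c => f c * g c).
Proof. by move=> [x hx] [y hy]; exists (Mul x y) => c /=; rewrite hx hy. Qed.

Lemma T_lt f g : Tm f -> Tm g -> Tb (fun c => f c < g c).
Proof. by move=> [x hx] [y hy]; exists (Lt x y) => c /=; rewrite hx hy. Qed.

Lemma T_le f g : Tm f -> Tm g -> Tb (fun c => f c <= g c).
Proof. by move=> hf hg; apply: (T_lt hf (T_succ hg)). Qed.

Lemma T_len : Tm (fun c => size (cw c)). Proof. by exists Len. Qed.

Lemma T_inp f : Tm f -> Tb (fun c => nth false (cw c) (f c)).
Proof. by move=> [x hx]; exists (Inp x) => c /=; rewrite hx. Qed.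

Lemma T_rd r f : Tm f -> Tb (fun c => nth false (ca c r) (f c)).
Proof. by move=> [x hx]; exists (Rd r x) => c /=; rewrite hx. Qed.

Lemma T_and p q : Tb p -> Tb q -> Tb (fun c => p c && q c).
Proof.
by move=> [x hx] [y hy]; exists (Mul x y) => c /=; rewrite hx hy; case: (p c); case: (q c).
Qed.

Lemma T_not p : Tb p -> Tb (fun c => ~~ p c).
Proof. by move=> [x hx]; exists (Lt x One) => c /=; rewrite hx; case: (p c). Qed.

Lemma T_or p q : Tb p -> Tb q -> Tb (fun c => p c || q c).
Proof.
move=> hp hq; apply: (T_eq _ (T_not (T_and (T_not hp) (T_not hq)))) => c /=.
by case: (p c); case: (q c).
Qed.

Lemma T_imp p q : Tb p -> Tb q -> Tb (fun c => p c ==> q c).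
Proof.
move=> hp hq; apply: (T_eq _ (T_or (T_not hp) hq)) => c /=.
by case: (p c); case: (q c).
Qed.

Lemma T_eqn f g : Tm f -> Tm g -> Tb (fun c => f c == g c).
Proof.
move=> hf hg; apply: (T_eq _ (T_and (T_le hf hg) (T_le hg hf))) => c /=.
by rewrite eqn_leq.
Qed.

Lemma T_true : Tb (fun=> true). Proof. exact: (T_cst 1). Qed.
Lemma T_false : Tb (fun=> false). Proof. exact: (T_cst 0). Qed.

(** The format for all binders: the body is a function of the extended context, from which [vtl]
    recovers the outer context and [cv c 0] the bound value. *)
Lemma T_let a (f : ctx -> nat -> nat) :
  Tm a -> Tm (fun c => f (vtl c) (cv c 0)) -> Tm (fun c => f c (a c)).
Proof.
by move=> [x hx] [y hy]; exists (Let x y) => c /=; rewrite hy hx vtl_vcons.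
Qed.

Lemma T_mu b (p : ctx -> nat -> bool) :
  Tm b -> Tb (fun c => p (vtl c) (cv c 0)) -> Tm (fun c => mu (b c) (p c)).
Proof.
move=> [x hx] [y hy]; exists (Mu x y) => c /=; rewrite hx /mu; apply: eq_find => z.
by rewrite hy vtl_vcons /=; case: (p c z).
Qed.

Lemma T_cov t (F : ctx -> nat -> seq bool -> bool) :
  Tm t -> Tb (fun c => F (atl (vtl c)) (cv c 0) (ca c 0)) ->
  Tb (fun c => cov (F c) (t c)).
Proof.
move=> [x hx] [y hy]; exists (Cov y x) => c /=; rewrite hx; congr nat_of_bool; apply: eq_cov => z l.
by rewrite hy atl_vtl_cons /=; case: (F c z l).
Qed.

Definition exn (b : nat) (p : nat -> bool) : bool := has p (iota 0 b).
Definition alln (b : nat) (p : nat -> bool) : bool := all p (iota 0 b).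

Lemma exnP b (p : nat -> bool) : reflect (exists2 x, x < b & p x) (exn b p).
Proof.
apply: (iffP hasP) => [[x]|[x hx px]]; first by rewrite mem_iota add0n => /=; exists x.
by exists x => //; rewrite mem_iota.
Qed.

Lemma allnP b (p : nat -> bool) : reflect (forall x, x < b -> p x) (alln b p).
Proof.
apply: (iffP allP) => [h x hx|h x]; first by apply: h; rewrite mem_iota.
by rewrite mem_iota => /h.
Qed.

Lemma T_ex b (p : ctx -> nat -> bool) :
  Tm b -> Tb (fun c => p (vtl c) (cv c 0)) -> Tb (fun c => exn (b c) (p c)).
Proof.
move=> hb hp; apply: (T_eq _ (T_lt (T_mu hb hp) hb)) => c.
by rewrite /exn /mu has_find size_iota.
Qed.

Lemma T_all b (p : ctx -> nat -> bool) :
  Tm b -> Tb (fun c => p (vtl c) (cv c 0)) -> Tb (fun c => alln (b c) (p c)).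
Proof.
move=> hb hp; apply: (T_eq _ (T_not (@T_ex b (fun c x => ~~ p c x) hb (T_not hp)))) => c /=.
congr nat_of_bool; apply/idP/allnP => [/exnP h x hx|h].
  by apply/negPn/negP => np; apply: h; exists x.
by apply/exnP => -[x hx]; rewrite h.
Qed.

Lemma T_if p f g : Tb p -> Tm f -> Tm g -> Tm (fun c => if p c then f c else g c).
Proof.
move=> hp hf hg; apply: (T_eq _ (T_add (T_mul hp hf) (T_mul (T_not hp) hg))) => c /=.
by case: (p c); rewrite ?mul1n ?mul0n ?addn0.
Qed.

Lemma T_ifb p f g : Tb p -> Tb f -> Tb g -> Tb (fun c => if p c then f c else g c).
Proof.
by move=> hp hf hg; apply: (T_eq _ (T_if hp hf hg)) => c; case: (p c).
Qed.

Lemma muE b (p : nat -> bool) k : k < b -> p k -> (forall j, j < k -> ~~ p j) -> mu b p = k.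
Proof.
move=> kb pk hk; have [h1 h2] := mu_spec b p.
case: (ltngtP (mu b p) k) => // lt.
  by have := hk _ lt; rewrite h2 //; apply: ltn_trans lt kb.
by have := h1 _ lt; rewrite pk.
Qed.

Lemma T_sub f g : Tm f -> Tm g -> Tm (fun c => f c - g c).
Proof.
move=> hf hg; have h : Tm (fun c => mu (f c).+1 (fun z => f c <= g c + z)).
  apply: T_mu; first exact: T_succ.
  by apply: T_le; [apply: T_vtl|apply: T_add; [apply: T_vtl|apply: T_var]].
by apply: (T_eq _ h) => c; apply: muE => [||j]; lia.
Qed.

Lemma T_min f g : Tm f -> Tm g -> Tm (fun c => minn (f c) (g c)).
Proof. by move=> hf hg; apply: T_if => //; apply: T_lt. Qed.

Lemma T_div f g : Tm f -> Tm g -> Tm (fun c => f c %/ g c).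
Proof.
move=> hf hg; have h : Tm (fun c => (0 < g c) * mu (f c).+1 (fun z => f c < z.+1 * g c)).
  apply: T_mul; first by apply: T_lt => //; apply: T_cst.
  apply: T_mu; first exact: T_succ.
  apply: T_lt; first exact: T_vtl.
  by apply: T_mul; [apply: T_succ; apply: T_var|apply: T_vtl].
apply: (T_eq _ h) => c; case: (posnP (g c)) => [->|gt0]; first by rewrite divn0.
rewrite mul1n; apply: muE => [||j hj].
- by rewrite ltnS leq_div.
- exact: ltn_ceil.
- by rewrite -leqNgt -leq_divRL.
Qed.

Lemma T_mod f g : Tm f -> Tm g -> Tm (fun c => f c %% g c).
Proof.
move=> hf hg; apply: (T_eq _ (T_sub hf (T_mul (T_div hf hg) hg))) => c.
by rewrite {1}(divn_eq (f c) (g c)) addKn.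
Qed.

Definition Tm1 (f : ctx -> nat -> nat) : Prop := Tm (fun c => f (vtl c) (cv c 0)).

Lemma T1_vtl f : Tm1 f -> Tm1 (fun c => f (vtl c)).
Proof. exact: (@T_ren (up S) id). Qed.

Lemma T1_atl f : Tm1 f -> Tm1 (fun c => f (atl c)).
Proof. exact: (@T_ren id S). Qed.

Lemma T_app1 f a : Tm1 f -> Tm a -> Tm (fun c => f c (a c)).
Proof. by move=> hf ha; apply: T_let. Qed.

Lemma covE F t : cov F t = F t (mkseq (cov F) t).
Proof.
have h k : covseq F k = mkseq (cov F) k.
  by elim: k => // k IH; rewrite mkseqS -IH /cov covseqS last_rcons.
by rewrite /cov covseqS last_rcons h.
Qed.

(* Replaces [fun c => f (g c)] by [f], where [g] is made of [vtl] and [atl]. *)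
Ltac shift_with H g :=
  lazymatch g with
  | fun c => c => exact H
  | fun c => vtl (@?h c) => shift_with constr:(T_vtl H) h
  | fun c => atl (@?h c) => shift_with constr:(T_atl H) h
  end.

Ltac shift1_with H g :=
  lazymatch g with
  | fun c => c => apply: (T_app1 H)
  | fun c => vtl (@?h c) => shift1_with constr:(T1_vtl H) h
  | fun c => atl (@?h c) => shift1_with constr:(T1_atl H) h
  end.

Ltac tm_var := first [exact: (T_var 0) | exact: (T_var 1) | exact: (T_var 2) | exact: (T_var 3)
  | exact: (T_var 4) | exact: (T_var 5) | exact: (T_var 6) | exact: (T_var 7) | exact: (T_var 8)].

(* Extended below with the lemmas on newly defined functions. *)
Ltac tm_user := fail.

Ltac tm_step :=
  lazymatch goal with
  | |- Tm1 _ => unfold Tm1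
  | |- Tm (fun c => cv _ _) => tm_var
  | |- Tm (fun c => S _) => apply: T_succ
  | |- Tm (fun c => addn _ _) => apply: T_add
  | |- Tm (fun c => muln _ _) => apply: T_mul
  | |- Tm (fun c => subn _ _) => apply: T_sub
  | |- Tm (fun c => minn _ _) => apply: T_min
  | |- Tm (fun c => divn _ _) => apply: T_div
  | |- Tm (fun c => modn _ _) => apply: T_mod
  | |- Tm (fun c => size (cw _)) => exact: T_len
  | |- Tm (fun c => nat_of_bool (leq (S _) _)) => apply: T_lt
  | |- Tm (fun c => nat_of_bool (leq _ _)) => apply: T_le
  | |- Tm (fun c => nat_of_bool (@eq_op _ _ _)) => apply: T_eqn
  | |- Tm (fun c => nat_of_bool (andb _ _)) => apply: T_and
  | |- Tm (fun c => nat_of_bool (orb _ _)) => apply: T_or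
  | |- Tm (fun c => nat_of_bool (negb _)) => apply: T_not
  | |- Tm (fun c => nat_of_bool (implb _ _)) => apply: T_imp
  | |- Tm (fun c => nat_of_bool true) => exact: T_true
  | |- Tm (fun c => nat_of_bool false) => exact: T_false
  | |- Tm (fun c => nat_of_bool (exn _ _)) => apply: T_ex
  | |- Tm (fun c => nat_of_bool (alln _ _)) => apply: T_all
  | |- Tm (fun c => nat_of_bool (nth false (cw _) _)) => apply: T_inp
  | |- Tm (fun c => nat_of_bool (nth false (ca _ _) _)) =>
      first [apply: (T_rd 0) | apply: (T_rd 1) | apply: (T_rd 2) | apply: (T_rd 3)]
  | |- Tm (fun c => nat_of_bool (if _ then _ else _)) => apply: T_ifb
  | |- Tm (fun c => if _ then _ else _) => apply: T_if
  | |- Tm (fun c => mu _ _) => apply: T_mu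
  | H : Tm ?f |- Tm ?f => exact H
  | H : Tm ?f |- Tm (fun c => ?f (@?g c)) => shift_with H g
  | H : Tm (fun c => nat_of_bool (?f c)) |- Tm (fun c => nat_of_bool (?f (@?g c))) => shift_with H g
  | H : Tm1 ?f |- Tm (fun c => ?f (@?g c) _) => shift1_with H g
  | H : Tm1 (fun c x => nat_of_bool (?f c x)) |- Tm (fun c => nat_of_bool (?f (@?g c) _)) => shift1_with H g
  | |- _ => first [exact: (T_cst _) | tm_user]
  end.
Ltac tm := repeat tm_step.

(* Iteration of [g] with all intermediate values truncated at [B]. *)
Definition biter (B n : nat) (g : nat -> nat -> nat) (a : nat) : nat :=
  iteri n (fun x y => minn B (g x y)) (minn B a).

Lemma biter_le B n g a : biter B n g a <= B.
Proof. by case: n => [|n]; apply: geq_minl. Qed.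

(** Course-of-values recursion produces bits only, so a numerical iteration is encoded by its graph:
    entry [x * B.+1 + y] tells whether the value after [x] rounds is [y]. A bounded search then
    reads the value off. *)
Definition biter_graph B g a (i : nat) (l : seq bool) : bool :=
  let x := i %/ B.+1 in let y := i %% B.+1 in
  if x == 0 then y == minn B a
  else exn B.+1 (fun y' => nth false l ((x - 1) * B.+1 + y') && (y == minn B (g (x - 1) y'))).

Lemma biter_graphP B g a x y : y <= B ->
  cov (biter_graph B g a) (x * B.+1 + y) = (y == biter B x g a).
Proof.
elim: x y => [|x IH] y hy; rewrite covE /biter_graph divnMDl // divn_small // addn0 modnMDl modn_small //.
apply/exnP/eqP => [[y' hy' /andP[]]|->].
  rewrite nth_mkseq subn1 /=; last by lia.
  by rewrite IH // => /eqP -> /eqP.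
exists (biter B x g a); first by rewrite ltnS biter_le.
rewrite subn1 nth_mkseq /=; last by have := biter_le B x g a; lia.
by rewrite IH ?biter_le // !eqxx.
Qed.

Lemma T_biter B n (g : ctx -> nat -> nat -> nat) a :
  Tm B -> Tm n -> Tm a -> Tm (fun c => g (vtl (vtl c)) (cv c 1) (cv c 0)) ->
  Tm (fun c => biter (B c) (n c) (g c) (a c)).
Proof.
move=> hB hn ha hg.
have h : Tm (fun c => mu (B c).+1 (fun y => cov (biter_graph (B c) (g c) (a c)) (n c * (B c).+1 + y))).
  apply: T_mu; first by tm.
  apply: (@T_cov _ (fun c => biter_graph (B (vtl c)) (g (vtl c)) (a (vtl c)))); first by tm.
  rewrite /biter_graph; apply: T_ifb; tm.
  have hg3 : Tm (fun c => g (vtl (atl (vtl (vtl c)))) (cv c 1 %/ (B (vtl (atl (vtl (vtl c))))).+1 - 1) (cv c 0)).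
    have := @T_let (fun c => cv c 1 %/ (B (vtl (atl (vtl (vtl c))))).+1 - 1)
      (fun c x => g (vtl (atl (vtl (vtl c)))) x (cv c 0)).
    apply; first by tm.
    apply: (T_eq _ (@T_ren (fun i => if i is 0 then 1 else if i is 1 then 0 else i.+2) S _ hg)) => c.
    by rewrite /cren /=.
  exact: hg3.
apply: (T_eq _ h) => c; apply: muE => [||j hj].
- by rewrite ltnS biter_le.
- by rewrite biter_graphP ?biter_le ?eqxx.
- rewrite biter_graphP; last by have := biter_le (B c) (n c) (g c) (a c); lia.
  by lia.
Qed.

Fixpoint piter (M : nat) (Phi : (nat -> bool) -> nat -> bool) (p0 : nat -> bool)
    (k : nat) : nat -> bool :=
  if k is k'.+1 then fun z => (z < M) && Phi (piter M Phi p0 k') z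
  else fun z => (z < M) && p0 z.

Definition piter_graph M Phi (p0 : nat -> bool) (i : nat) (l : seq bool) : bool :=
  if i %/ M == 0 then p0 (i %% M)
  else Phi (fun y => (y < M) && nth false l ((i %/ M - 1) * M + y)) (i %% M).

Lemma piter_graphP M Phi p0 k x : x < M ->
  cov (piter_graph M Phi p0) (k * M + x) = piter M Phi p0 k x.
Proof.
elim: k x => [|k IH] x hx; have M0 : 0 < M by lia.
  by rewrite covE /piter_graph mul0n add0n divn_small // modn_small //= hx.
rewrite covE /piter_graph divnMDl // divn_small // addn0 modnMDl modn_small //= hx /=.
congr Phi; apply: functional_extensionality => y; case: ltnP => hy /=.
  by rewrite subn1 nth_mkseq ?IH //=; lia.
by case: k {IH} => [|k] /=; rewrite ltnNge hy.
Qed.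

(** The iterates are rows of length [M] of one recursion. [Phi] sees the previous row only as a
    slice of the recursion array, whose offset is variable 1. *)
Lemma T_piter M k x (Phi : ctx -> (nat -> bool) -> nat -> bool) (p0 : ctx -> nat -> bool) :
  Tm M -> Tm k -> Tm x -> Tb (fun c => p0 (vtl c) (cv c 0)) ->
  Tb (fun c => let d := atl (vtl (vtl (vtl c))) in
     Phi d (fun y => (y < M d) && nth false (ca c 0) (cv c 1 + y)) (cv c 0)) ->
  Tb (fun c => piter (M c) (Phi c) (p0 c) (k c) (x c)).
Proof.
move=> hM hk hx hp hPhi.
have h : Tb (fun c => (x c < M c) && cov (piter_graph (M c) (Phi c) (p0 c)) (k c * M c + x c)).
  apply: T_and; first by tm.
  apply: (@T_cov _ (fun c => piter_graph (M c) (Phi c) (p0 c))); first by tm.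
  rewrite /piter_graph; apply: T_ifb; first by tm.
    have hp1 : Tm1 (fun c x => nat_of_bool (p0 c x)) by exact: hp.
    by tm.
  apply: (@T_let (fun c => (cv c 0 %/ M (atl (vtl c)) - 1) * M (atl (vtl c)))
    (fun c b => Phi (atl (vtl c)) (fun y => (y < M (atl (vtl c))) && nth false (ca c 0) (b + y))
       (cv c 0 %% M (atl (vtl c))))); first by tm.
  apply: (@T_let (fun c => cv c 1 %% M (atl (vtl (vtl c))))
    (fun c z => Phi (atl (vtl (vtl c))) (fun y => (y < M (atl (vtl (vtl c)))) && nth false (ca c 0) (cv c 0 + y)) z));
    first by tm.
  exact: hPhi.
apply: (T_eq _ h) => c; congr nat_of_bool.
case: ltnP => hx' /=; first by rewrite piter_graphP.
by case: (k c) => [|k'] /=; rewrite ltnNge hx'.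
Qed.

(** Iterations need a bound known in advance, so powers are cut off at [K]; as long as [b ^ i] is at
    most [K] the result is exact. *)
Definition powc (K b i : nat) : nat := biter K i (fun _ y => b * y) 1.

Lemma powcE K b i : 0 < b -> b ^ i <= K -> powc K b i = b ^ i.
Proof.
rewrite /powc; move=> b0; elim: i => [|i IH] hK; first by rewrite /biter /=; apply/minn_idPr.
rewrite /biter /= -/(biter K i (fun _ y => b * y) 1) IH -?expnS; first exact/minn_idPr.
by apply: leq_trans hK; rewrite expnS leq_pmull.
Qed.

Lemma T_powc K b i : Tm K -> Tm b -> Tm i -> Tm (fun c => powc (K c) (b c) (i c)).
Proof. by move=> hK hb hi; apply: (@T_biter _ _ (fun c _ y => b c * y)); tm. Qed.

(** * Parsing instances *)

Section Parser.
Variable w : seq bool.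

(* A position past the end of the input, used as the failure value. *)
Definition fl : nat := (size w).+1.

(** In the code of a list every entry is preceded by [true]. The position stays put once the marker
    is [false], so any number of rounds that is large enough reaches the end of the list. *)
Definition skips (nx : nat -> nat) (k p : nat) : nat :=
  biter fl k (fun _ q => if nth false w q then nx q.+1 else q) p.
Definition nx_seq (nx : nat -> nat) (p : nat) : nat := minn fl (skips nx fl p).+1.

(** [rg_enc] gives correctness on genuine codes; [rg_dec] turns a scan that does not fail into a
    code, and so rejects words that encode nothing. By [rg_ge] scanners never move back, hence a
    failure of one component persists through the following ones. *)
Record recog (T : Type) (P : T -> Prop) (enc : T -> seq bool) (nx : nat -> nat) : Prop :=
  Recog {
    rg_enc : forall p x r, p <= size w -> P x -> drop p w = enc x ++ r ->
      nx p = p + size (enc x);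
    rg_dec : forall p, p <= size w -> nx p <= size w ->
      exists2 x, P x & drop p w = enc x ++ drop (nx p) w;
    rg_ge : forall p, p <= fl -> p <= nx p <= fl }.

Lemma drop_cat_size p (s r : seq bool) : p <= size w -> drop p w = s ++ r ->
  p + size s <= size w /\ drop (p + size s) w = r.
Proof.
move=> hp e; split.
  by have := congr1 size e; rewrite size_drop size_cat; lia.
by rewrite addnC -drop_drop e drop_size_cat.
Qed.

Lemma recog_cat (T1 T2 : Type) P1 P2 (e1 : T1 -> seq bool) (e2 : T2 -> seq bool) n1 n2 :
  recog P1 e1 n1 -> recog P2 e2 n2 ->
  recog (fun x => P1 x.1 /\ P2 x.2) (fun x => e1 x.1 ++ e2 x.2) (fun p => n2 (n1 p)).
Proof.
move=> [a1 b1 c1] [a2 b2 c2]; split=> [p x r hp [h1 h2]|p hp hn|p hp].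
- rewrite -catA => e; have [h e'] := drop_cat_size hp e.
  by rewrite (a1 p x.1 _ hp h1 e) (a2 _ _ _ h h2 e') size_cat addnA.
- have /andP[g1 g2] : p <= n1 p <= fl by apply: c1; rewrite /fl; lia.
  have /andP[g3 g4] := c2 _ g2.
  have h1 : n1 p <= size w by lia.
  have [x px ex] := b1 p hp h1; have [y py ey] := b2 _ h1 hn.
  by exists (x, y) => //=; rewrite ex ey catA.
- have /andP[g1 g2] := c1 _ hp; have /andP[g3 g4] := c2 _ g2.
  by rewrite g4 (leq_trans g1).
Qed.

Lemma recog_iso (T1 T2 : Type) P1 P2 (e1 : T1 -> seq bool) (e2 : T2 -> seq bool) nx :
  recog P1 e1 nx ->
  (forall x1, P1 x1 -> exists2 x2, P2 x2 & e2 x2 = e1 x1) ->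
  (forall x2, P2 x2 -> exists2 x1, P1 x1 & e1 x1 = e2 x2) -> recog P2 e2 nx.
Proof.
move=> [a b c] h12 h21; split=> // [p x r hp px|p hp hn].
  by have [y py <-] := h21 _ px; apply: a.
by have [x px ->] := b p hp hn; have [y py <-] := h12 _ px; exists y.
Qed.

Lemma recog_if (T : Type) P (Q : pred T) (t : nat -> bool) (enc : T -> seq bool) nx :
  recog P enc nx ->
  (forall p x r, p <= size w -> P x -> drop p w = enc x ++ r -> t p = Q x) ->
  recog (fun x => P x /\ Q x) enc (fun p => if t p then nx p else fl).
Proof.
move=> [a b c] ht; split=> [p x r hp [px qx] e|p hp|p hp].
- by rewrite (ht _ _ _ hp px e) qx; apply: a e.
- case: ifP => [tp hn|_]; last by rewrite /fl ltnn.
  have [x px e] := b p hp hn; exists x => //; split=> //.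
  by rewrite -(ht _ _ _ hp px e).
- by case: ifP => _; [apply: c|rewrite hp /=].
Qed.

Lemma recog_unit : recog (fun=> True) (fun _ : unit => [::]) id.
Proof.
split=> [p x r _ _ _|p _ _|p hp]; first by rewrite addn0.
  by exists tt.
by rewrite hp andbT.
Qed.

Lemma recog_bits m : recog (fun s => size s = m) id (fun p => minn fl (p + m)).
Proof.
split=> [p x r hp <- e|p hp hn|p hp].
- have [h _] := drop_cat_size hp e.
  by apply/minn_idPr; rewrite /fl; lia.
- have e : minn fl (p + m) = p + m by move: hn; rewrite /fl; lia.
  rewrite e in hn *; exists (take m (drop p w)).
    by rewrite size_takel // size_drop; lia.
  by rewrite addnC -drop_drop cat_take_drop.
- by rewrite /fl in hp *; lia.
Qed.

Lemma skipsS nx k p : skips nx k.+1 p =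
  minn fl (if nth false w (skips nx k p) then nx (skips nx k p).+1 else skips nx k p).
Proof. by []. Qed.

Lemma skips0 nx p : p <= size w -> skips nx 0 p = p.
Proof. by move=> hp; apply/minn_idPr; rewrite /fl; lia. Qed.

Lemma nth_drop_head p b r : drop p w = b :: r -> nth false w p = b.
Proof. by move=> e; rewrite -[p]addn0 -nth_drop e. Qed.

Section RecogSeq.
Variables (T : Type) (P : T -> Prop) (enc : T -> seq bool) (nx : nat -> nat).
Hypothesis rg : recog P enc nx.

Lemma enc_seq_cons x l : enc_seq enc (x :: l) = true :: enc x ++ enc_seq enc l.
Proof. by rewrite /enc_seq /= -!catA. Qed.

Lemma skips_enc l p r k : p <= size w -> (forall x, List.In x l -> P x) ->
  drop p w = enc_seq enc l ++ r -> k <= size l ->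
  [/\ skips nx k p <= size w, drop (skips nx k p) w = enc_seq enc (drop k l) ++ r
    & skips nx k p + size (enc_seq enc (drop k l)) = p + size (enc_seq enc l)].
Proof.
move=> hp Pl e; elim: k => [|k IH] hk; first by rewrite skips0 // drop0.
have {IH} [h1 h2 h3] := IH (ltnW hk).
have [x dk Px] : exists2 x, drop k l = x :: drop k.+1 l & P x.
  rewrite -[k.+1]add1n -drop_drop; case dk: (drop k l) => [|x l'].
    by have := congr1 size dk; rewrite size_drop /=; lia.
  exists x; rewrite //= ?drop0 //; apply: Pl; rewrite -(cat_take_drop k l) dk.
  by apply: List.in_or_app; right; left.
rewrite dk enc_seq_cons in h2 h3; rewrite skipsS (nth_drop_head h2).
have [h4 h5] : (skips nx k p).+1 <= size w /\
    drop (skips nx k p).+1 w = enc x ++ (enc_seq enc (drop k.+1 l) ++ r).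
  have := @drop_cat_size (skips nx k p) [:: true] (enc x ++ (enc_seq enc (drop k.+1 l) ++ r)) h1.
  by rewrite addn1; apply; rewrite h2 /= catA.
have e1 := rg_enc rg h4 Px h5.
have [h6 h7] := drop_cat_size h4 h5.
rewrite e1 (minn_idPr _); last by rewrite /fl; lia.
split=> //; rewrite -h3 /= size_cat; lia.
Qed.

Lemma skips_end l p r k : p <= size w -> (forall x, List.In x l -> P x) ->
  drop p w = enc_seq enc l ++ r -> size l <= k -> skips nx k p = skips nx (size l) p.
Proof.
move=> hp Pl e; elim: k => [|k IH] hk; first by have -> : size l = 0 by lia.
case: (ltngtP (size l) k.+1) hk => // [hk _|-> //].
rewrite skipsS IH //.
have [h1 h2 _] := skips_enc hp Pl e (leqnn _); rewrite drop_size in h2.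
by rewrite (nth_drop_head h2); apply/minn_idPr; rewrite /fl; lia.
Qed.

Lemma skips_mark l p r k : p <= size w -> (forall x, List.In x l -> P x) ->
  drop p w = enc_seq enc l ++ r -> nth false w (skips nx k p) = (k < size l).
Proof.
move=> hp Pl e; case: ltnP => hk.
  have [_ h2 _] := skips_enc hp Pl e (ltnW hk).
  case dk: (drop k l) h2 => [|x l'] h2.
    by have := congr1 size dk; rewrite size_drop /=; lia.
  by rewrite enc_seq_cons in h2; rewrite (nth_drop_head h2).
rewrite (skips_end hp Pl e hk).
have [h1 h2 _] := skips_enc hp Pl e (leqnn _); rewrite drop_size in h2.
exact: (nth_drop_head h2).
Qed.

Lemma skips_ge k p : p <= fl -> p <= skips nx k p <= fl.
Proof.
move=> hp; elim: k => [|k /andP[h1 h2]]; first by rewrite /skips /biter /=; lia.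
rewrite skipsS geq_minl andbT leq_min hp /=.
case: ifP => // hn; have : skips nx k p < size w by rewrite ltnNge; apply/negP => ?; rewrite nth_default in hn.
move=> h3; have /andP[h4 _] := rg_ge rg (p := (skips nx k p).+1) (leqW h3).
lia.
Qed.

(** Either the scan rests on an end marker or each of the [k] rounds advanced it. For [k = fl w] the
    second case would leave the input, so the list ends where the scan stops. *)
Lemma skips_dec k p : p <= size w -> skips nx k p <= size w ->
  (nth false w (skips nx k p) = false \/ p + k <= skips nx k p) /\
  exists2 l, forall x, List.In x l -> P x &
    drop p w = flatten [seq true :: enc x | x <- l] ++ drop (skips nx k p) w.
Proof.
move=> hp; elim: k => [|k IH].
  rewrite skips0 // => _; split; first by right; rewrite addn0.
  by exists [::].
have hp' : p <= fl by rewrite /fl; lia.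
have /andP[g1 g2] := skips_ge k hp'.
rewrite skipsS; case: ifP => hn; last first.
  rewrite (minn_idPr g2) => h; have [_ [l Pl e]] := IH h.
  by split; [left|exists l].
have lt : skips nx k p < size w by rewrite ltnNge; apply/negP => ?; rewrite nth_default in hn.
have /andP[g3 g4] := rg_ge rg (p := (skips nx k p).+1) (leqW lt).
rewrite (minn_idPr g4) => h.
have [[hf|hk] [l Pl e]] := IH (ltnW lt); first by rewrite hf in hn.
split; first by right; lia.
have [x Px ex] := rg_dec rg lt h.
exists (l ++ [:: x]); first by move=> y hy; case: (List.in_app_or _ _ _ hy) => [/Pl|[<-|[]]].
rewrite e map_cat flatten_cat /= cats0 -catA; congr cat.
by rewrite (drop_nth false lt) hn ex.
Qed.

Lemma recog_seq : recog (fun l => forall x, List.In x l -> P x) (enc_seq enc) (nx_seq nx).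
Proof.
split=> [p l r hp Pl e|p hp|p hp].
- have [h _] := drop_cat_size hp e.
  have sl : size l <= size (enc_seq enc l).
    rewrite /enc_seq size_cat /=; elim: (l) => //= x l' IH; rewrite size_cat; lia.
  rewrite /nx_seq (@skips_end l p r) //; last by rewrite /fl; lia.
  have [_ _] := skips_enc hp Pl e (leqnn _); rewrite drop_size /= addn1 => ->.
  by apply/minn_idPr; rewrite /fl; lia.
- rewrite /nx_seq => hn.
  have lt : skips nx fl p < size w by move: hn; rewrite /fl; lia.
  have [[hm|h] [l Pl e]] := skips_dec hp (ltnW lt); last first.
    by have := leq_ltn_trans h lt; rewrite {1}/fl; lia.
  have -> : minn fl (skips nx fl p).+1 = (skips nx fl p).+1 by apply/minn_idPr; apply: leqW.
  exists l => //; rewrite e /enc_seq -catA; congr cat.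
  by rewrite (drop_nth false lt) hm.
- have /andP[h1 h2] := skips_ge fl hp; rewrite /nx_seq; move: h1 h2 hp; rewrite /fl; lia.
Qed.

End RecogSeq.

Definition nx_un (p : nat) : nat := nx_seq id p.

Lemma recog_un : recog (fun=> True) enc_unary nx_un.
Proof.
apply: (recog_iso (recog_seq recog_unit)) => [l _|n _].
  exists (size l) => //; rewrite /enc_unary /enc_seq; congr cat.
  by elim: l => //= x l ->.
exists (nseq n tt) => //; rewrite /enc_unary /enc_seq; congr cat.
by elim: n => //= n ->.
Qed.

Definition bits_val (l : seq bool) : nat := foldr (fun (b : bool) y => b + y.*2) 0 l.

Lemma bits_val_nat n : bits_val (nat_bits n) = n.
Proof.
rewrite /nat_bits -{2}[n]bin_of_natK; case: (bin_of_nat n) => // p /=.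
by elim: p => //= p ->; rewrite NatTrec.doubleE.
Qed.

Lemma nat_bits_val l : (l == [::]) || last false l -> nat_bits (bits_val l) = l.
Proof.
have main l' : last false l' -> exists2 p, bits_val l' = nat_of_bin (BinNums.Npos p) & pos_bits p = l'.
  elim: l' => // b [|c l'] IH hl; first by case: b hl => // _; exists BinNums.xH.
  have [p ep bp] := IH hl; exists (if b then BinNums.xI p else BinNums.xO p).
    rewrite -[LHS]/(b + (bits_val (c :: l')).*2) ep.
    by case: b {hl}; rewrite /= NatTrec.doubleE.
  by case: b {hl} => /=; rewrite bp.
case/orP=> [/eqP->//|/main[p ep bp]].
by rewrite /nat_bits ep nat_of_binK.
Qed.

Lemma bits_val_lt l : bits_val l < 2 ^ size l.
Proof.
elim: l => //= b l IH; rewrite expnS mul2n -addnn; case: b; rewrite -?addnn; lia.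
Qed.

Definition nx_bits (p : nat) : nat := nx_seq (fun q => minn fl (q + 1)) p.

Lemma recog_bool : recog (fun=> True) enc_bool (fun q => minn fl (q + 1)).
Proof.
apply: (recog_iso (recog_bits 1)) => [[|b [|? ?]] // _|b _]; first by exists b.
by exists [:: b].
Qed.

Lemma recog_bitseq : recog (fun=> True) (enc_seq enc_bool) nx_bits.
Proof.
by apply: (recog_iso (recog_seq recog_bool)) => l hl; exists l.
Qed.

(** Binary codes have no leading zero: the word of bits is empty or its last bit is [true]. A bit
    takes two positions and the end marker one, so that the last bit lies at [nx_bits p - 2]. *)
Definition canon (p : nat) : bool :=
  (nx_bits p == p.+1) || nth false w (nx_bits p - 2).

Lemma enc_bits_size l : size (enc_seq enc_bool l) = (size l).*2.+1.
Proof. by elim: l => // b l IH; rewrite enc_seq_cons /= IH. Qed.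

Lemma canonP p l r : p <= size w -> drop p w = enc_seq enc_bool l ++ r ->
  canon p = ((l == [::]) || last false l).
Proof.
move=> hp e; rewrite /canon (rg_enc recog_bitseq hp I e) enc_bits_size.
case/lastP: l e => [|l b] e; first by rewrite /= addn1 eqxx.
rewrite size_rcons last_rcons doubleS.
have -> : (p + (size l).*2.+3 == p.+1) = false by lia.
have -> : (rcons l b == [::]) = false by case: l {e}.
rewrite /=; suff e2 : drop (p + (size l).*2.+1) w = b :: false :: r.
  by rewrite -(nth_drop_head e2); congr nth; lia.
have e3 : enc_seq enc_bool (rcons l b) ++ r = (flatten [seq true :: enc_bool x | x <- l] ++ [:: true]) ++ b :: false :: r.
  by rewrite /enc_seq -cats1 map_cat flatten_cat -!catA.
rewrite e3 in e; have [_] := drop_cat_size hp e.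
have -> // : size (flatten [seq true :: enc_bool x | x <- l] ++ [:: true]) = (size l).*2.+1.
by rewrite size_cat /= addn1; congr S; elim: (l) => //= x l' ->.
Qed.

Definition nx_nat (p : nat) : nat := if canon p then nx_bits p else fl.

Lemma recog_nat : recog (fun=> True) enc_nat nx_nat.
Proof.
have H := @recog_if _ _ (fun l => (l == [::]) || last false l) canon _ _ recog_bitseq
  (fun p x r hp _ e => canonP hp e).
apply: (recog_iso H) => [l [_ hl]|n _].
  by exists (bits_val l) => //; rewrite /enc_nat nat_bits_val.
exists (nat_bits n) => //; split=> //.
rewrite /nat_bits; case: (bin_of_nat n) => //= p; case: p => [p|p|] //=;
  (have : last false (pos_bits p) by elim: p => //= -[]); by case: (pos_bits p).
Qed.

Variable K : nat.

(** Horner's rule from the most significant bit, which is written last; bit [i] sits at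
    [p + i.*2 + 1]. *)
Definition nval (p : nat) : nat :=
  let k := (nx_bits p - p) %/ 2 in
  biter K k (fun j y => y + y + nth false w (p + (k - j.+1).*2 + 1)) 0.

Hypothesis hK : 2 ^ size w <= K.

Lemma nth_enc_bits p l r j : p <= size w -> drop p w = enc_seq enc_bool l ++ r ->
  j < size l -> nth false w (p + j.*2 + 1) = nth false l j.
Proof.
move=> hp; elim: l p j hp => // b l IH p j hp; rewrite enc_seq_cons /= => e hj.
have e1 : drop p w = [:: true; b] ++ (enc_seq enc_bool l ++ r) by rewrite e.
have [h2 e2] := drop_cat_size hp e1.
case: j hj => [|j] hj.
  by rewrite addn0 -nth_drop e1.
have := IH _ j h2 e2 hj; rewrite /= => <-; congr nth; rewrite /=; lia.
Qed.

Lemma nval_bits p l r : p <= size w -> drop p w = enc_seq enc_bool l ++ r -> nval p = bits_val l.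
Proof.
move=> hp e; rewrite /nval (rg_enc recog_bitseq hp I e) addKn enc_bits_size.
have -> : (size l).*2.+1 %/ 2 = size l by lia.
have [hl _] := drop_cat_size hp e; rewrite enc_bits_size in hl.
have lK k : 2 ^ k <= K \/ size l < k.
  case: (leqP k (size l)) => h; last by right.
  by left; apply: leq_trans hK; rewrite leq_exp2l //; lia.
suff main k : k <= size l -> biter K k (fun j y => y + y + nth false w (p + (size l - j.+1).*2 + 1)) 0 =
    bits_val (drop (size l - k) l) by rewrite main // subnn drop0.
elim: k => [|k IH] hk; first by rewrite subn0 drop_size /biter /= minn0.
rewrite /biter /= -/(biter _ _ _ _) IH; last by lia.
rewrite (nth_enc_bits hp e); last by lia.
have e2 : drop (size l - k.+1) l = nth false l (size l - k.+1) :: drop (size l - k) l.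
  by rewrite (drop_nth false); [congr cons; congr drop; lia|lia].
rewrite e2 /= addnn addnC; apply/minn_idPr.
have := bits_val_lt (nth false l (size l - k.+1) :: drop (size l - k) l).
rewrite /= size_drop; have -> : (size l - (size l - k)).+1 = k.+1 by lia.
by case: (lK k.+1) => h h'; lia.
Qed.

Lemma nvalP p n r : p <= size w -> drop p w = enc_nat n ++ r -> nval p = n.
Proof. by move=> hp /(nval_bits hp)->; apply: bits_val_nat. Qed.

Definition nx_ord (b p : nat) : nat := if nval p < b then nx_nat p else fl.

Lemma recog_ord b : recog (fun=> True) (fun i : 'I_b => enc_nat i) (nx_ord b).
Proof.
have ht p x r : p <= size w -> True -> drop p w = enc_nat x ++ r -> (nval p < b) = (x < b).
  by move=> hp _ e; rewrite (nvalP hp e).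
have H := @recog_if _ _ (fun n => n < b) (fun p => nval p < b) _ _ recog_nat ht.
apply: (recog_iso H) => [n [_ hn]|i _]; first by exists (Ordinal hn).
by exists (nat_of_ord i) => //; split=> //; apply: ltn_ord.
Qed.

(** With [up] only the codes 000 and 001 of [<] and [<=] pass; otherwise the five codes from 000 to
    100. *)
Definition cmp_ok (up : bool) (p : nat) : bool :=
  if up then ~~ nth false w p && ~~ nth false w (p + 1)
  else ~~ nth false w p || (~~ nth false w (p + 1) && ~~ nth false w (p + 2)).
Definition nx_cmp (up : bool) (p : nat) : nat := if cmp_ok up p then minn fl (p + 3) else fl.

Lemma recog_cmp up : recog (fun o => up ==> is_upper o) enc_cmp_op (nx_cmp up).
Proof.
pose Q l := if up then ~~ nth false l 0 && ~~ nth false l 1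
  else ~~ nth false l 0 || (~~ nth false l 1 && ~~ nth false l 2).
have ht p l r : p <= size w -> size l = 3 -> drop p w = l ++ r -> cmp_ok up p = Q l.
  move=> hp sl e; have nl j : j < 3 -> nth false w (p + j) = nth false l j.
    by move=> hj; rewrite -nth_drop e nth_cat sl hj.
  by rewrite /cmp_ok /Q -[in nth false w p](addn0 p) !nl.
have H := @recog_if _ _ Q (cmp_ok up) _ _ (recog_bits 3) ht.
apply: (recog_iso H) => [l [sl]|o ho].
  case: l sl => [|b0 [|b1 [|b2 [|? ?]]]] // _; rewrite /Q; case: up {ht H Q}; case: b0; case: b1; case: b2 => //= _;
  by [exists CLt|exists CLe|exists CEq|exists CGe|exists CGt].
by exists (enc_cmp_op o) => //; split; rewrite ?/Q; case: o ho; case: up {ht H Q}.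
Qed.

Definition nx_atom (m : nat) (up : bool) (p : nat) : nat := nx_nat (nx_cmp up (nx_ord m p)).
Definition nx_cons (m : nat) (up : bool) (p : nat) : nat := nx_seq (nx_atom m up) p.

Lemma recog_atom m up : recog (fun a => up ==> is_upper (acmp a)) (@enc_atom m) (nx_atom m up).
Proof.
have H := recog_cat (recog_cat (recog_ord m) (recog_cmp up)) recog_nat.
apply: (recog_iso H) => [[[x o] c] /= [[_ ho] _]|[x o c] /= ho].
  by exists (Atom x o c) => //; rewrite /enc_atom catA.
by exists ((x, o), c) => //=; rewrite /enc_atom catA.
Qed.

Lemma recog_cons m up : recog (fun g => all (fun a => up ==> is_upper (acmp a)) g)
  (@enc_constraint m) (nx_cons m up).
Proof.
apply: (recog_iso (recog_seq (recog_atom m up))) => g hg; exists g => //.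
  by elim: g hg => //= a g IH hg; rewrite hg ?IH //=; [move=> x hx; apply: hg; right|left].
by elim: g hg => //= a g IH /andP[h1 /IH h2] x [<-|/h2].
Qed.

Definition nx_label (k p : nat) : nat :=
  if nth false w p then nx_ord k p.+1 else minn fl (p + 1).

Lemma recog_label k : recog (fun=> True) (@enc_label k) (nx_label k).
Proof.
have [a b c] := recog_ord k.
split=> [p [x|] r hp _ e|p hp|p hp].
- rewrite /nx_label (nth_drop_head e).
  have [h1 h2] := @drop_cat_size _ [:: true] _ hp e; rewrite addn1 in h1 h2.
  by rewrite (a _ _ _ h1 I h2) /= addSnnS.
- rewrite /nx_label (nth_drop_head e).
  have [h1 h2] := @drop_cat_size _ [:: false] _ hp e.
  by apply/minn_idPr; rewrite /fl /=; lia.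
- rewrite /nx_label; case: ifP => hn.
    have lt : p < size w by rewrite ltnNge; apply/negP => ?; rewrite nth_default in hn.
    move=> h; have [x _ e] := b _ lt h; exists (Some x) => //.
    by rewrite (drop_nth false lt) hn e.
  move=> h; have lt : p < size w by move: h; rewrite /fl; lia.
  exists None => //; rewrite (minn_idPr _) ?addn1 ?/fl; last by lia.
  by rewrite (drop_nth false lt) hn.
- rewrite /nx_label; case: ifP => hn.
    have lt : p < size w by rewrite ltnNge; apply/negP => ?; rewrite nth_default in hn.
    by have := c p.+1 (leqW lt); lia.
  by move: hp; rewrite /fl; lia.
Qed.

Definition nx_set (m p : nat) : nat := minn fl (p + m).

Lemma recog_set m : recog (fun=> True) (@enc_set m) (nx_set m).
Proof.
apply: (recog_iso (recog_bits m)) => [l sl|Y _]; last first.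
  by exists (enc_set Y) => //; rewrite size_map size_enum_ord.
exists [set i : 'I_m | nth false l i] => //; rewrite /enc_set.
apply: (@eq_from_nth _ false); first by rewrite size_map size_enum_ord.
move=> i; rewrite size_map size_enum_ord => hi.
by rewrite (nth_map (Ordinal hi)) ?size_enum_ord // inE nth_enum_ord.
Qed.

Definition nx_edge (n m k p : nat) : nat :=
  nx_ord n (nx_set m (nx_label k (nx_cons m false (nx_ord n p)))).

Lemma recog_edge n m k : recog (fun=> True) (@enc_edge n m k) (nx_edge n m k).
Proof.
have H := recog_cat (recog_cat (recog_cat (recog_cat (recog_ord n) (recog_cons m false))
  (recog_label k)) (recog_set m)) (recog_ord n).
apply: (recog_iso H) => [[[[[q g] a] Y] q'] _|[q g a Y q'] _].
  by exists (Edge q g a Y q') => //; rewrite /enc_edge /= !catA.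
exists ((((q, g), a), Y), q') => /=; last by rewrite /enc_edge /= !catA.
by do ![split] => //; elim: g.
Qed.

End Parser.

Import Order.TTheory GRing.Theory Num.Theory.

(** * Regions *)

Section Regions.
Local Open Scope ring_scope.
Variable R : realType.
Implicit Types (d e : R).

(* Two families of reals are equivalent when they satisfy the same difference
   constraints with constants up to [C]; one of the indices stands for [0]. *)
Definition req (I : Type) (C : nat) (u v : I -> R) : Prop :=
  forall i j (k l : nat), (k <= C)%N -> (l <= C)%N ->
    (u i + k%:R <= u j + l%:R) = (v i + k%:R <= v j + l%:R).

Lemma req_sym (I : Type) C (u v : I -> R) : req C u v -> req C v u.
Proof. by move=> h i j k l hk hl; rewrite h. Qed.

Lemma req_trans (I : Type) C (u v z : I -> R) : req C u v -> req C v z -> req C u z.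
Proof. by move=> h h' i j k l hk hl; rewrite h ?h'. Qed.

Lemma req_reindex (I I' : Type) C (u v : I -> R) (u' v' : I' -> R) (f : I' -> I) :
  req C u v -> (forall i, u' i = u (f i)) -> (forall i, v' i = v (f i)) -> req C u' v'.
Proof. by move=> h eu ev i j k l hk hl; rewrite !eu !ev h. Qed.

(** Let [a i0] be the greatest threshold below [d], which exists thanks to [t0]. If it equals [d],
    take [d' = b i0]; otherwise take [b i0 + e], which the gap keeps strictly before the next
    threshold. *)
Lemma order_transfer (T : finType) (t0 : T) (a b : T -> R) d e :
  (forall i j, (a i <= a j) = (b i <= b j)) -> a t0 <= d -> 0 < e ->
  (forall i j, b i < b j -> b i + e < b j) ->
  exists2 d', exists i, d' = b i \/ d' = b i + e &
    b t0 <= d' /\ forall i, (a i <= d) = (b i <= d') /\ (d <= a i) = (d' <= b i).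
Proof.
move=> hab h0 e0 gap.
have [i0 hi0 max0'] := @arg_maxP _ _ _ t0 (fun i => a i <= d) a h0.
have max0 i : a i <= d -> a i <= a i0 by exact: max0'.
have abl i j : (a i < a j) = (b i < b j) by rewrite !ltNge hab.
have [eq_d|ne_d] := eqVneq (a i0) d.
  exists (b i0); first by exists i0; left.
  by split=> [|i]; [rewrite -hab max0|rewrite -!hab -eq_d].
have lt_d : a i0 < d by rewrite lt_neqAle ne_d.
exists (b i0 + e); first by exists i0; right.
have low i : a i <= d -> b i <= b i0 by move=> h; rewrite -hab max0.
have high i : d < a i -> b i0 + e < b i.
  by move=> h; apply: gap; rewrite -abl; apply: lt_trans h.
split=> [|i]; first by have := low _ h0; lra.
case: (leP (a i) d) => h.
  have h1 := low _ h; have h2 : a i < d by apply: le_lt_trans lt_d; rewrite hab.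
  by split; apply/esym; [lra|rewrite [RHS]leNgt h2; apply/negbTE; rewrite -ltNge; lra].
have h1 := high _ h; split; apply/esym; first by apply/negbTE; rewrite -ltNge; lra.
by rewrite (ltW h); lra.
Qed.

Lemma exists_gap (T : finType) (b : T -> R) :
  exists2 e, 0 < e & forall i j, b i < b j -> b i + e < b j.
Proof.
have [e e0 he] : exists2 e, 0 < e & forall x, x \in [seq b p.2 - b p.1 | p : T * T] -> 0 < x -> e < x.
  elim: [seq _ | _ : _] => [|x s [e e0 he]]; first by exists 1.
  exists (Num.min e (if 0 < x then x / 2 else 1)) => [|y].
    by rewrite lt_min e0; case: ifP => h; lra.
  rewrite inE => /orP[/eqP->|ys] h; last by rewrite gt_min he.
  by rewrite gt_min h; apply/orP; right; lra.
exists e => // i j h; have := he (b j - b i); rewrite subr_gt0 h => H.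
have /H := map_f (fun p : T * T => b p.2 - b p.1) (mem_enum predT (i, j)).
by move=> /(_ isT); lra.
Qed.

(** All entries advance by [d], including the one that stood for 0, which thereby records the delay
    itself; the index [None] is a fresh 0. *)
Definition ext (I : Type) (u : I -> R) d (o : option I) : R := if o is Some i then u i + d else 0.

(** Comparing [u i + d] with [k] amounts to comparing [d] with the threshold [k - u i], while
    differences of advancing entries do not change. Equivalence of [u] and [v] says that the
    thresholds are ordered alike, which is what [order_transfer] asks for. *)
Lemma delay_transfer (I : finType) (C : nat) (u v : I -> R) i0 d e :
  u i0 = 0 -> v i0 = 0 -> (forall i, 0 <= u i) -> (forall i, 0 <= v i) ->
  req C u v -> 0 <= d -> 0 < e ->
  (forall i j (k l : nat), (k <= C)%N -> (l <= C)%N -> k%:R - v i < l%:R - v j -> k%:R - v i + e < l%:R - v j) ->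
  exists2 d', 0 <= d' /\
    (exists i (k : nat), (k <= C)%N /\ (d' = k%:R - v i \/ d' = k%:R - v i + e)) &
    req C (ext u d) (ext v d').
Proof.
move=> u0 v0 up vp huv d0 e0 gap.
pose a (t : I * 'I_C.+1) := (t.2 : nat)%:R - u t.1.
pose b (t : I * 'I_C.+1) := (t.2 : nat)%:R - v t.1.
have hab s t : (a s <= a t) = (b s <= b t).
  have := huv t.1 s.1 s.2 t.2 (leq_ord _) (leq_ord _).
  rewrite /a /b => h; apply/idP/idP => h1.
    by have : v t.1 + (s.2 : nat)%:R <= v s.1 + (t.2 : nat)%:R; [rewrite -h; lra|lra].
  by have : u t.1 + (s.2 : nat)%:R <= u s.1 + (t.2 : nat)%:R; [rewrite h; lra|lra].
have [|||d' [[i k] hd'] [d'0 hd]] := @order_transfer _ (i0, ord0) a b d e hab; rewrite /a /b /= ?u0 ?subr0 //.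
  by move=> s t; apply: gap; apply: leq_ord.
rewrite /b /= v0 subr0 in d'0.
exists d'; first by split=> //; exists i, k; split; [apply: leq_ord|].
have up_le i' (c : nat) : (c <= C)%N -> (u i' + d <= c%:R) = (v i' + d' <= c%:R) /\
     (c%:R <= u i' + d) = (c%:R <= v i' + d').
  move=> hc; have [h1 h2] := hd (i', inord c); rewrite /a /b /= inordK // in h1 h2.
  have e1 x y z : (x + y <= z :> R) = (y <= z - x) by rewrite lerBrDl.
  have e2 x y z : (z <= x + y :> R) = (z - x <= y) by rewrite lerBlDl.
  by split; [rewrite !e1 h2|rewrite !e2 h1].
case=> [i1|] [j1|] k1 l1 hk hl /=.
- have ee x y z s t : (x + z + y <= s + z + t :> R) = (x + y <= s + t) by apply/idP/idP; lra.
  by rewrite !ee huv.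
- rewrite add0r; case: (leqP k1 l1) => hkl.
    have [h _] := up_le i1 (l1 - k1)%N (leq_trans (leq_subr _ _) hl).
    by rewrite -[LHS]lerBrDr -[RHS]lerBrDr -natrB // h.
  (* An entry that is nonnegative cannot lie below a negative constant, on either side. *)
  have : l1%:R < k1%:R :> R by rewrite ltr_nat.
  by move=> h; rewrite !leNgt; have -> : l1%:R < u i1 + d + k1%:R; [have := up i1; lra|have -> //: l1%:R < v i1 + d' + k1%:R; have := vp i1; lra].
- rewrite add0r; case: (leqP l1 k1) => hkl.
    have [_ h] := up_le j1 (k1 - l1)%N (leq_trans (leq_subr _ _) hk).
    by rewrite -[LHS]lerBlDr -[RHS]lerBlDr -natrB // h.
  have : k1%:R < l1%:R :> R by rewrite ltr_nat.
  by move=> h; have -> : k1%:R <= u j1 + d + l1%:R; [have := up j1; lra|apply/esym; have := vp j1; lra].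
- by [].
Qed.

Lemma delay_real (I : finType) (C : nat) (u v : I -> R) i0 d :
  u i0 = 0 -> v i0 = 0 -> (forall i, 0 <= u i) -> (forall i, 0 <= v i) ->
  req C u v -> 0 <= d -> exists2 d', 0 <= d' & req C (ext u d) (ext v d').
Proof.
move=> u0 v0 up vp huv d0.
have [e e0 gap] := exists_gap (fun t : I * 'I_C.+1 => (t.2 : nat)%:R - v t.1).
have [|d' [h1 _] h2] := delay_transfer u0 v0 up vp huv d0 e0; last by exists d'.
move=> i j k l hk hl; have := gap (i, inord k) (j, inord l).
by rewrite /= !inordK.
Qed.

Definition grid (I : Type) (D : nat) (n : I -> nat) (i : I) : R := (n i)%:R / D%:R.

(** All thresholds are multiples of [2 * g], so distinct ones differ by more than [g], which can
    serve as the gap. The delay is then a multiple of [g]: one delay costs one factor 2 of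
    divisibility. *)
Lemma delay_grid (I : finType) (C D g : nat) (u : I -> R) (n : I -> nat) i0 d :
  u i0 = 0 -> n i0 = 0%N -> (forall i, 0 <= u i) -> (0 < g)%N -> (0 < D)%N ->
  (2 * g %| D)%N -> (forall i, 2 * g %| n i)%N ->
  req C u (grid D n) -> 0 <= d ->
  exists2 m : nat, (m <= C * D + g)%N /\ (g %| m)%N & req C (ext u d) (ext (grid D n) (m%:R / D%:R)).
Proof.
move=> u0 n0 up g0 D0 gD gn huv d0.
have D0' : 0 < D%:R :> R by rewrite ltr0n.
have Dn : D%:R != 0 :> R by rewrite gt_eqF.
have gp i : 0 <= grid D n i by rewrite /grid divr_ge0 ?ler0n.
have subE (k : nat) i : k%:R - grid D n i = ((k * D)%:R - (n i)%:R) / D%:R.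
  by rewrite /grid mulrBl natrM mulfK.
have [|||d' [d'0 [i [k [hk hd']]]] hr] := @delay_transfer I C u (grid D n) i0 d (g%:R / D%:R) u0 _ up gp huv d0.
- by rewrite /grid n0 mul0r.
- by rewrite divr_gt0 ?ltr0n.
- move=> i j k l hk hl; rewrite !subE -mulrDl !ltr_pM2r ?invr_gt0 //.
  rewrite ltrBlDr -addrAC ltrBrDr -!natrD ltr_nat => h.
  rewrite addrAC ltrBlDr -addrAC ltrBrDr -!natrD ltr_nat.
  have /dvdnP[a ha] : (2 * g %| k * D + n j)%N by rewrite dvdn_add ?dvdn_mull.
  have /dvdnP[b hb] : (2 * g %| l * D + n i)%N by rewrite dvdn_add ?dvdn_mull.
  have {}h : (k * D + n j < l * D + n i)%N by move: h; lia.
  have : (a < b)%N by rewrite ha hb ltn_pmul2r in h => //; lia.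
  nia.
have [m hm em] : exists2 m : nat, (m <= C * D + g)%N /\ (g %| m)%N & d' = m%:R / D%:R.
  have gn' : (g %| n i)%N by apply: dvdn_trans (gn i); apply: dvdn_mull.
  have gD' : (g %| k * D)%N by apply: dvdn_mull; apply: dvdn_trans gD; apply: dvdn_mull.
  have kC : (k * D <= C * D)%N by rewrite leq_mul2r hk orbT.
  case: hd' => e.
    have le : (n i <= k * D)%N.
      move: d'0; rewrite e subE pmulr_lge0 ?invr_gt0 // subr_ge0 ler_nat //.
    exists (k * D - n i)%N; last by rewrite e subE natrB.
    by split; [lia|apply: dvdn_sub].
  have le : (n i <= k * D + g)%N.
    move: d'0; rewrite e subE -mulrDl pmulr_lge0 ?invr_gt0 // addrAC subr_ge0 -natrD ler_nat //.
  exists (k * D + g - n i)%N; last by rewrite e subE -mulrDl natrB // natrD addrAC.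
  by split; [lia|apply: dvdn_sub => //; apply: dvdn_add].
by exists m; rewrite -?em.
Qed.

(* The positive entries are produced one value at a time: subtract the least
   positive value, realize the rest, and delay back on a grid twice as fine. *)
Lemma realize (I : finType) (C J : nat) (i0 : I) j (u : I -> R) :
  (forall i, 0 <= u i) -> u i0 = 0 -> (#|[pred i | (0 < u i)%R]| <= j)%N -> (j <= J)%N ->
  exists n : I -> nat, [/\ req C u (grid (2 ^ J) n), forall i, (n i <= j * (C.+1 * 2 ^ J))%N,
    forall i, u i = 0 -> n i = 0%N & forall i, (2 ^ (J - j) %| n i)%N].
Proof.
elim: j u => [|j IH] u up u0 hj hJ.
  have uz i : u i = 0.
    apply/eqP; rewrite eq_le up andbT leNgt; apply/negP => h.
    by move: hj; rewrite leqn0 => /eqP/card0_eq/(_ i); rewrite inE h.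
  exists (fun=> 0%N); split=> [i i' k l _ _|i|i|i] //.
  by rewrite !uz /grid mul0r.
case: (pickP [pred i | 0 < u i]) => [i1 /= hi1|none]; last first.
  have [|n [h1 h2 h3 h4]] := IH u up u0 _ (ltnW hJ); first by rewrite eq_card0.
  exists n; split=> // i; first by apply: leq_trans (h2 i) _; rewrite leq_mul2r leqnSn orbT.
  by apply: dvdn_trans (h4 i); rewrite dvdn_exp2l // leq_sub2l.
have [m hm minm] := @arg_minP _ _ _ i1 (fun i => 0 < u i) u hi1.
pose z i := if 0 < u i then u i - u m else 0.
have zp i : 0 <= z i by rewrite /z; case: ifP => // h; rewrite subr_ge0; apply: minm.
have z0 : z i0 = 0 by rewrite /z u0 ltxx.
have [|n [h1 h2 h3 h4]] := IH z zp z0 _ (ltnW hJ).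
  rewrite -ltnS; apply: leq_trans hj; apply: proper_card; apply/properP; split.
    by apply/subsetP => i; rewrite !inE /z; case: ifP => //; rewrite ltxx.
  by exists m; rewrite !inE ?hm // /z hm subrr ltxx.
have e2 : (2 * 2 ^ (J - j.+1) = 2 ^ (J - j))%N by rewrite -expnS -subSn.
have [||||d [hd1 hd2] hr] := @delay_grid I C (2 ^ J) (2 ^ (J - j.+1)) z n i0 (u m) z0 (h3 _ z0) zp _ _ _ _ h1 (ltW hm).
- by rewrite expn_gt0.
- by rewrite expn_gt0.
- by rewrite e2 dvdn_exp2l // leq_subr.
- by rewrite e2.
exists (fun i => if 0 < u i then (n i + d)%N else 0%N); split.
(* Entries that vanish in [u] must not advance; they are read from the fresh 0 of [ext]. *)
- apply: (req_reindex (f := fun i => if 0 < u i then Some i else None) hr) => i.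
    by case: ifP => h /=; [rewrite /z h subrK|apply/eqP; rewrite eq_le up andbT leNgt h].
  by rewrite /grid; case: ifP => h /=; rewrite ?natrD ?mulrDl ?mul0r.
- move=> i; case: ifP => // h; rewrite mulSn addnC leq_add //.
  apply: leq_trans hd1 _; rewrite mulSn addnC leq_add2r leq_exp2l //; exact: leq_subr.
- by move=> i ->; rewrite ltxx.
- move=> i; case: ifP => // h; apply: dvdn_add => //.
  by apply: dvdn_trans (h4 i); rewrite -e2 dvdn_mull.
Qed.

End Regions.

(** * The finite game *)

Section Transport.
Local Open Scope ring_scope.
Variables (R : realType) (Q X S : finType) (C : nat).
Notation val := (valuation R X).
Implicit Types (v s p : val) (Y Z : {set X}) (B : timed_automaton Q X S).

Definition cons_bounded (g : constraint X) : bool := all (fun a => aconst a <= C)%N g.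

Definition ta_bounded B : Prop :=
  (forall e, List.In e (ta_edges B) -> cons_bounded (eguard e)) /\
  forall q, cons_bounded (ta_inv B q).

(** What guards and invariants of a single automaton can observe. Differences between clocks matter
    only for finding a matching delay and enter through [req]. *)
Definition ceq v v' : Prop := forall x (k : nat), (k <= C)%N ->
  ((v x)%:num <= k%:R) = ((v' x)%:num <= k%:R) /\
  (k%:R <= (v x)%:num) = (k%:R <= (v' x)%:num).

Lemma ceq_sat g v v' : cons_bounded g -> ceq v v' -> sat g v = sat g v'.
Proof.
move=> + h; elim: g => //= a g IH /andP[ha /IH->]; congr andb.
have [h1 h2] := h (aclock a) _ ha.
case: (acmp a) => /=; rewrite ?ltNge ?h1 ?h2 //.
by rewrite !eq_le h1 h2.
Qed.

Lemma ceq_reset v v' Y : ceq v v' -> ceq (val_reset v Y) (val_reset v' Y).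
Proof. by move=> h x k hk; rewrite !ffunE; case: ifP => // _; apply: h. Qed.

Lemma val_resetU v Y Z : val_reset (val_reset v Y) Z = val_reset v (Y :|: Z).
Proof. by apply/ffunP => x; rewrite !ffunE inE; case: (x \in Z); case: (x \in Y). Qed.

Lemma val_reset0 v : val_reset v set0 = v.
Proof. by apply/ffunP => x; rewrite !ffunE inE. Qed.

Lemma transport_discrete B a q v q1 v1 v' : ta_bounded B -> ceq v v' ->
  discrete_step B a (q, v) (q1, v1) ->
  exists2 Y, v1 = val_reset v Y & discrete_step B a (q, v') (q1, val_reset v' Y).
Proof.
move=> [hE hI] h [e [ein [/= e1 e2 e3] hg -> hi]]; exists (ereset e) => //.
exists e; split=> //=; first by rewrite -(ceq_sat (hE _ ein) h).
by rewrite -(ceq_sat (hI _) (ceq_reset _ h)).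
Qed.

(** Consecutive resets amount to one reset of the union, so a silent path is recorded by a single
    set and can be replayed from any valuation that satisfies the same guards. *)
Lemma transport_eps B q v q1 v1 v' : ta_bounded B -> ceq v v' ->
  eps_steps (T := ta_tts R B) (q, v) (q1, v1) ->
  exists2 Y, v1 = val_reset v Y & eps_steps (T := ta_tts R B) (q, v') (q1, val_reset v' Y).
Proof.
move=> hB; have main x y : eps_steps (T := ta_tts R B) x y -> forall v', ceq x.2 v' ->
    exists2 Y, y.2 = val_reset x.2 Y & eps_steps (T := ta_tts R B) (x.1, v') (y.1, val_reset v' Y).
  elim=> {x y} [[q0 u] [q2 u2]|[q0 u]|x y z _ IH1 _ IH2] /=.
  - by move=> st v0 h; have [Y -> h2] := transport_discrete hB h st; exists Y => //; apply: rt_step.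
  - by move=> v0 _; exists set0; rewrite val_reset0 //; apply: rt_refl.
  - move=> v0 h; have [Y eY hY] := IH1 _ h.
    have [|Z eZ hZ] := IH2 (val_reset v0 Y); first by rewrite eY; apply: ceq_reset.
    exists (Y :|: Z); first by rewrite eZ eY val_resetU.
    by apply: rt_trans hY _; rewrite -val_resetU.
by move=> h /main/(_ _ h).
Qed.

(** Invariants are downward closed, so along a delay only its end has to be checked. *)
Lemma upper_delay g v d d' : all (fun a => is_upper (acmp a)) g -> d'%:num <= d%:num ->
  sat g (val_delay v d) -> sat g (val_delay v d').
Proof.
move=> + le; elim: g => //= a g IH /andP[ha /IH{}IH] /andP[h /IH->]; rewrite andbT.
move: h; rewrite !ffunE; case: (acmp a) ha => //= _ h.
  by apply: le_lt_trans h; rewrite lerD2l.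
by apply: le_trans h; rewrite lerD2l.
Qed.

(* The valuation after a weak step that resets [Y] and, for a delay, then [Z]. *)
Definition wres (a : label R S) v Y Z : val :=
  if a is Delay d then val_reset (val_delay (val_reset v Y) d) Z else val_reset v Y.

Definition lab_match (a a' : label R S) v v' : Prop :=
  match a, a' with
  | Delay d, Delay d' => forall Y, ceq (val_delay (val_reset v Y) d) (val_delay (val_reset v' Y) d')
  | Delay _, _ | _, Delay _ => False
  | _, _ => a = a'
  end.

Lemma weak_transport B a a' q v q1 v1 v' : ta_bounded B -> ceq v v' -> lab_match a a' v v' ->
  weak_step (T := ta_tts R B) a (q, v) (q1, v1) ->
  exists Y Z, v1 = wres a v Y Z /\ weak_step (T := ta_tts R B) a' (q, v') (q1, wres a' v' Y Z).
Proof.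
move=> hB h; case: a => [|c|d] /=.
- by case: a' => // _ st; have [Y -> st'] := transport_eps hB h st; exists Y, set0.
- case: a' => // _ [<-] [[q2 u2] [[q3 u3] [s1 s2 s3]]].
  have [Y eY t1] := transport_eps hB h s1; subst u2.
  have h1 := ceq_reset Y h.
  have [Z eZ t2] := transport_discrete hB h1 s2; subst u3.
  have h2 := ceq_reset Z h1.
  have [U -> t3] := transport_eps hB h2 s3.
  exists (Y :|: (Z :|: U)), set0; rewrite !val_resetU; split=> //=.
  exists (q2, val_reset v' Y), (q3, val_reset (val_reset v' Y) Z); split=> //.
  by rewrite -!val_resetU.
- case: a' => // d' hm [[q2 u2] [[q3 u3] [s1 s2 s3]]].
  have [Y eY t1] := transport_eps hB h s1; subst u2.
  case: s2 => -[? ?] hinv; subst q3 u3.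
  have [U -> t3] := transport_eps hB (hm Y) s3.
  exists Y, U; split=> //=.
  exists (q2, val_reset v' Y), (q2, val_delay (val_reset v' Y) d'); split=> //.
  split=> //= d0 hd0; have hup : all (fun a => is_upper (acmp a)) (ta_inv B q2).
    by have /forallP := ta_inv_upper B; apply.
  apply: upper_delay hup hd0 _; rewrite -(ceq_sat (hB.2 q2) (hm Y)).
  by apply: hinv; rewrite lexx.
Qed.

(** The clocks of both players and 0 form one family, since a delay has to be matched simultaneously
    for the two configurations. *)
Definition jv s p (i : option (X + X)) : R :=
  match i with None => 0 | Some (inl x) => (s x)%:num | Some (inr x) => (p x)%:num end.

Lemma jv_ge0 s p i : 0 <= jv s p i. Proof. by case: i => [[x|x]|] /=. Qed.

Lemma req_ceq s p s' p' : req C (jv s p) (jv s' p') -> ceq s s' /\ ceq p p'.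
Proof.
move=> h; split=> x k hk.
  have := h (Some (inl x)) None 0%N k isT hk; have := h None (Some (inl x)) k 0%N hk isT.
  by rewrite /= !addr0 !add0r => -> ->.
have := h (Some (inr x)) None 0%N k isT hk; have := h None (Some (inr x)) k 0%N hk isT.
by rewrite /= !addr0 !add0r => -> ->.
Qed.

Lemma req_flip s p s' p' : req C (jv s p) (jv s' p') -> req C (jv p s) (jv p' s').
Proof.
move=> h; apply: (req_reindex (f := fun i => match i with None => None
   | Some (inl x) => Some (inr x) | Some (inr x) => Some (inl x) end) h) => -[[x|x]|] //.
Qed.

Definition pair_match (a a' : label R S) s p s' p' : Prop :=
  match a, a' with
  | Delay d, Delay d' => req C (ext (jv s p) d%:num) (ext (jv s' p') d'%:num)
  | Delay _, _ | _, Delay _ => False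
  | _, _ => a = a'
  end.

Lemma pair_lab_match a a' s p s' p' : pair_match a a' s p s' p' ->
  lab_match a a' s s' /\ lab_match a a' p p'.
Proof.
case: a => [|c|d]; case: a' => [|c'|d'] //= h.
(* A clock reset just before the delay shows the delay itself, which is the entry [Some None] of the
   extended family. *)
pose f Y (x : X) : option (option (X + X)) := if x \in Y then Some None else Some (Some (inl x)).
pose g Y (x : X) : option (option (X + X)) := if x \in Y then Some None else Some (Some (inr x)).
split=> Y x k hk; rewrite !ffunE.
  have := h (f Y x) None 0%N k isT hk; have := h None (f Y x) k 0%N hk isT.
  by rewrite /f; case: ifP => _ /=; rewrite !addr0 !add0r => -> ->.
have := h (g Y x) None 0%N k isT hk; have := h None (g Y x) k 0%N hk isT.
by rewrite /g; case: ifP => _ /=; rewrite !addr0 !add0r => -> ->.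
Qed.

Lemma pair_match_sym a a' s p s' p' : pair_match a a' s p s' p' -> pair_match a' a s' p' s p.
Proof. by case: a => [|c|d]; case: a' => [|c'|d'] //=; apply: req_sym. Qed.

Lemma wres_req a a' s p s' p' Y Z Y' Z' : req C (jv s p) (jv s' p') -> pair_match a a' s p s' p' ->
  req C (jv (wres a s Y Z) (wres a p Y' Z')) (jv (wres a' s' Y Z) (wres a' p' Y' Z')).
Proof.
move=> h hm.
have nodelay : req C (jv (val_reset s Y) (val_reset p Y')) (jv (val_reset s' Y) (val_reset p' Y')).
  apply: (req_reindex (f := fun i => match i with None => None
     | Some (inl x) => if x \in Y then None else i
     | Some (inr x) => if x \in Y' then None else i end) h) => -[[x|x]|] //=;
    by rewrite ffunE; case: ifP.
case: a hm => [|c|d]; case: a' => [|c'|d'] //= hm.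
apply: (req_reindex (f := fun i => match i with None => None
   | Some (inl x) => if x \in Z then None else if x \in Y then Some None else Some i
   | Some (inr x) => if x \in Z' then None else if x \in Y' then Some None else Some i end) hm)
  => -[[x|x]|] //=; rewrite !ffunE; case: ifP => //= _; case: ifP => _ //=;
  by rewrite ?add0r.
Qed.

End Transport.

(** * From real clock values to a finite grid *)

Section GameAbstraction.
Local Open Scope ring_scope.
Variables (R : realType) (Q X S : finType) (C J B0 dm Bs Ns : nat).
Variables (loc : nat -> Q) (dg : nat -> X -> nat).
Notation val := (valuation R X).
Notation D := (2 ^ J)%N.
Hypothesis hJ : (#|{: X + X}| < J)%N.
Hypothesis hB0 : (#|{: X + X}| * (C.+1 * D) <= B0)%N.
Hypothesis hdm : (C * D + 1 <= dm)%N.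
Hypothesis hBs : (B0 + dm < Bs)%N.
Hypothesis dg_onto : forall q (n : X -> nat), (forall x, n x < Bs)%N ->
  exists x, [/\ (x < Ns)%N, loc x = q & forall a, dg x a = n a].

Definition gval (x : nat) : val := [ffun a => ((dg x a)%:R / D%:R)%:nng].
Definition lift (x : nat) : Q * val := (loc x, gval x).

(** Evenness is what [delay_grid] with [g = 1] asks for, and the bound [B0] keeps the values after
    one more delay below [Bs]. *)
Definition small (x : nat) : Prop := forall a, (dg x a <= B0)%N /\ ~~ odd (dg x a).

Definition glab (a : label R S) : Prop :=
  if a is Delay d then exists2 k : nat, (k <= dm)%N & d%:num = k%:R / D%:R else True.

Definition eqv (x1 x2 y1 y2 : nat) : Prop :=
  [/\ loc x1 = loc y1, loc x2 = loc y2 & req C (jv (gval x1) (gval x2)) (jv (gval y1) (gval y2))].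

(** A move can end on odd grid values, from which the next delay might not be matched on the grid. A
    round therefore starts from an arbitrary small pair equivalent to the current one, and [G] must
    provide an answer for each such pair. *)
Definition match_grid (A1 A2 : timed_automaton Q X S) (G : nat -> nat -> Prop) : Prop :=
  forall x1 x2, (x1 < Ns)%N -> (x2 < Ns)%N -> G x1 x2 ->
  forall y1 y2, (y1 < Ns)%N -> (y2 < Ns)%N -> small y1 -> small y2 -> eqv x1 x2 y1 y2 ->
  forall a y2', glab a -> (y2' < Ns)%N ->
    weak_step (T := ta_tts R A2) a (lift y2) (lift y2') ->
    exists y1', [/\ (y1' < Ns)%N, weak_step (T := ta_tts R A1) a (lift y1) (lift y1') & G y1' y2'].

Definition match_real (A1 A2 : timed_automaton Q X S) (Rel : Q * val -> Q * val -> Prop) : Prop :=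
  forall s p a p', Rel s p -> weak_step (T := ta_tts R A2) a p p' ->
    exists s', weak_step (T := ta_tts R A1) a s s' /\ Rel s' p'.

Definition relG (G : nat -> nat -> Prop) (s p : Q * val) : Prop :=
  exists x1 x2, [/\ (x1 < Ns)%N /\ (x2 < Ns)%N, G x1 x2, loc x1 = s.1 /\ loc x2 = p.1
    & req C (jv s.2 p.2) (jv (gval x1) (gval x2))].

Lemma wres_grid a y q Y Z : glab a -> small y ->
  exists2 y', (y' < Ns)%N & lift y' = (q, wres a (gval y) Y Z).
Proof.
move=> ga sy.
have [n nB en] : exists2 n : X -> nat, forall x, (n x < Bs)%N &
    forall x, (wres a (gval y) Y Z x)%:num = (n x)%:R / D%:R.
  case: a ga => [|c|d] /=.
  - exists (fun x => if x \in Y then 0 else dg y x)%N => x.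
      by case: ifP => _; have := (sy x).1; lia.
    by rewrite !ffunE; case: ifP => _ //=; rewrite ?mul0r.
  - exists (fun x => if x \in Y then 0 else dg y x)%N => x.
      by case: ifP => _; have := (sy x).1; lia.
    by rewrite !ffunE; case: ifP => _ //=; rewrite ?mul0r.
  - move=> [k hk ek].
    exists (fun x => if x \in Z then 0 else if x \in Y then k else (dg y x + k))%N => x.
      by case: ifP => _; [lia|case: ifP => _; have := (sy x).1; lia].
    rewrite !ffunE; case: ifP => _ /=; first by rewrite mul0r.
    rewrite ek; case: ifP => _ /=; first by rewrite add0r.
    by rewrite natrD mulrDl.
have [y' [h1 h2 h3]] := dg_onto q nB; exists y' => //.
rewrite /lift h2; congr pair; apply/ffunP => x; apply: val_inj => /=.
by rewrite ffunE /= h3 en.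
Qed.

Lemma glab_of (a : label R S) (s p : val) (y1 y2 : nat) :
  small y1 -> small y2 -> req C (jv s p) (jv (gval y1) (gval y2)) ->
  exists2 a', glab a' & pair_match C a a' s p (gval y1) (gval y2).
Proof.
move=> s1 s2 h; case: a => [|c|d]; first by exists (Eps _ _).
  by exists (Act _ c).
pose n (i : option (X + X)) : nat :=
  match i with None => 0 | Some (inl x) => dg y1 x | Some (inr x) => dg y2 x end.
have en i : jv (gval y1) (gval y2) i = grid R D n i.
  by case: i => [[x|x]|] /=; rewrite ?ffunE //= /grid mul0r.
have h' : req C (jv s p) (grid R D n) by move=> i j k l hk hl; rewrite h // !en.
have [|||||m [hm _] hr] := @delay_grid R _ C D 1 (jv s p) n None d%:num erefl erefl (jv_ge0 s p) _ _ _ _ h'.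
- by [].
- by rewrite expn_gt0.
- by rewrite muln1; case: (J) hJ => // J' _; rewrite expnS dvdn_mulr.
- by case=> [[x|x]|] //=; rewrite muln1 dvdn2; [have [] := s1 x|have [] := s2 x].
- by [].
exists (Delay S (m%:R / D%:R)%:nng) => /=; first by exists m => //; apply: leq_trans hm hdm.
apply: (req_trans hr) => i j k l _ _; rewrite /ext; case: i => [i|]; case: j => [j|] //=; by rewrite -?en.
Qed.

(** [realize] spends one factor 2 per joint clock; as [J] exceeds their number, a factor 2 is left
    over and the values are even. *)
Lemma small_of (s p : Q * val) : exists y1 y2, [/\ (y1 < Ns)%N /\ (y2 < Ns)%N, small y1 /\ small y2,
  loc y1 = s.1 /\ loc y2 = p.1 & req C (jv s.2 p.2) (jv (gval y1) (gval y2))].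
Proof.
have [||n [h1 h2 h3 h4]] := @realize R _ C J (None : option (X + X)) #|{: X + X}| (jv s.2 p.2) (@jv_ge0 _ _ _ _) erefl.
- have Si : injective (@Some (X + X)%type) by move=> ? ? [].
  rewrite -(card_imset predT Si); apply: subset_leq_card.
  apply/subsetP => -[z|]; rewrite !inE ?ltxx // => _; exact: imset_f.
- exact: ltnW.
have nB (i : option (X + X)) : (n i < Bs)%N by have := h2 i; lia.
have ev i : ~~ odd (n i).
  rewrite -dvdn2; apply: dvdn_trans (h4 i).
  by rewrite -[X in (X %| _)%N]expn1 dvdn_exp2l // subn_gt0.
have [y1 [a1 b1 c1]] := dg_onto s.1 (fun x => nB (Some (inl x))).
have [y2 [a2 b2 c2]] := dg_onto p.1 (fun x => nB (Some (inr x))).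
exists y1, y2; split=> //; first by split=> x; rewrite ?c1 ?c2; split=> //; apply: leq_trans (h2 _) hB0.
apply: (req_trans h1) => i j k l _ _.
have en z : grid R D n z = jv (gval y1) (gval y2) z.
  by case: z => [[x|x]|] /=; rewrite ?ffunE /= ?c1 ?c2 // /grid h3 // mul0r.
by rewrite !en.
Qed.

(** The challenge is replayed from a small representative of the class, answered there by [G], and
    the answer is replayed from [s]. The positions reached are equivalent again because the same
    resets were applied on both sides. *)
Lemma match_grid_real A1 A2 G : ta_bounded C A1 -> ta_bounded C A2 ->
  match_grid A1 A2 G -> match_real A1 A2 (relG G).
Proof.
move=> bA1 bA2 mg s p a p' [x1 [x2 [[hx1 hx2] Gx [l1 l2] hreq]]] st.
have [y1 [y2 [[hy1 hy2] [s1 s2] [m1 m2] hy]]] := small_of s p.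
have [a' ga hm] := glab_of a s1 s2 hy.
have [c1 c2] := req_ceq hy; have [lm1 lm2] := pair_lab_match hm.
case: s p p' st hreq l1 l2 m1 m2 hy hm c1 c2 lm1 lm2 => [q1 sv] [q2 pv] [q2' pv'] /= st hreq l1 l2 m1 m2 hy hm c1 c2 lm1 lm2.
have [Y [Z [ep st']]] := weak_transport bA2 c2 lm2 st.
have [y2' hy2' ey2'] := wres_grid q2' Y Z ga s2.
have ev : eqv x1 x2 y1 y2.
  by split; rewrite ?l1 ?l2 ?m1 ?m2 //; apply: req_trans (req_sym hreq) hy.
rewrite -ey2' -m2 -/(lift y2) in st'.
have [y1' [hy1' wy1 Gy]] := mg _ _ hx1 hx2 Gx _ _ hy1 hy2 s1 s2 ev _ _ ga hy2' st'.
have hms := pair_match_sym hm; have [lm1' _] := pair_lab_match hms.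
have [c1' _] := req_ceq (req_sym hy).
rewrite /lift in wy1; have [Y1 [Z1 [e1 wy]]] := weak_transport bA1 c1' lm1' wy1.
exists (loc y1', wres a sv Y1 Z1); split; first by rewrite -m1.
exists y1', y2'; split=> //=; first by case: ey2'.
have -> : gval y2' = wres a' (gval y2) Y Z by case: ey2'.
by rewrite e1 ep; apply: wres_req.
Qed.

Lemma match_real_grid A1 A2 (Rel : Q * val -> Q * val -> Prop) : ta_bounded C A1 -> ta_bounded C A2 ->
  match_real A1 A2 Rel -> match_grid A1 A2 (fun x1 x2 => exists s p, [/\ Rel s p, loc x1 = s.1 /\ loc x2 = p.1
    & req C (jv s.2 p.2) (jv (gval x1) (gval x2))]).
Proof.
move=> bA1 bA2 mr x1 x2 hx1 hx2 [[q1 sv] [[q2 pv] /= [hR [l1 l2] hreq]]] y1 y2 hy1 hy2 s1 s2 [e1 e2 exy] a y2' ga hy2' st.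
have hy : req C (jv (gval y1) (gval y2)) (jv sv pv) by apply: req_sym; apply: req_trans hreq exy.
have [a' hm] : exists a', pair_match C a a' (gval y1) (gval y2) sv pv.
  case: (a) => [|c|d]; first by exists (Eps _ _).
    by exists (Act _ c).
  (* The grid delay is matched by some real delay; on this side its size and denominator are
     unrestricted. *)
  have [|d' d0 hr] := @delay_real R _ C (jv (gval y1) (gval y2)) (jv sv pv) None d%:num erefl erefl
    (@jv_ge0 _ _ _ _) (@jv_ge0 _ _ _ _) hy; first by [].
  by exists (Delay S (NngNum d0)).
have [c1 c2] := req_ceq hy; have [lm1 lm2] := pair_lab_match hm.
rewrite /lift in st; have [Y [Z [ep st']]] := weak_transport bA2 c2 lm2 st.
rewrite -e2 l2 in st'; have [[q1' sv'] [ws hR']] := mr _ _ _ _ hR st'.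
have hms := pair_match_sym hm; have [lm1' _] := pair_lab_match hms.
have [c1' _] := req_ceq (req_sym hy).
have [Y1 [Z1 [es wy]]] := weak_transport bA1 c1' lm1' ws.
have [y1' hy1' ey1'] := wres_grid q1' Y1 Z1 ga s1.
exists y1'; split=> //.
  by rewrite ey1' /lift -e1 l1.
exists (q1', sv'), (loc y2', wres a' pv Y Z); split=> //=; first by case: ey1'.
have -> : gval y1' = wres a (gval y1) Y1 Z1 by case: ey1'.
by rewrite es ep; apply: req_sym; apply: wres_req.
Qed.

Lemma relG_flip G s p : relG G s p -> relG (fun x y => G y x) p s.
Proof.
move=> [x1 [x2 [[? ?] ? [? ?] h]]]; exists x2, x1; split=> //; exact: req_flip.
Qed.

(** The Boolean selects the game: with [b] the converse relation has to match too. Simulation and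
    bisimulation thus share a single abstraction. *)
Theorem game_abstraction (b : bool) A1 A2 x0 : ta_bounded C A1 -> ta_bounded C A2 ->
  (x0 < Ns)%N -> lift x0 = (ta_init A1, val0 R X) -> ta_init A2 = ta_init A1 ->
  (exists Rel : ta_tts R A1 -> ta_tts R A2 -> Prop, weak_simulation Rel /\
     (b -> weak_simulation (fun p s => Rel s p))) <->
  (exists G : nat -> nat -> Prop, [/\ G x0 x0, match_grid A1 A2 G & b -> match_grid A2 A1 (fun x y => G y x)]).
Proof.
move=> bA1 bA2 hx0 lx0 i21; have gx0 : gval x0 = val0 R X by case: lx0.
have lc0 : loc x0 = ta_init A1 by case: lx0.
split=> [[Rel [[h0 h1] h2]]|[G [h0 h1 h2]]].
  exists (fun x1 x2 => exists s p, [/\ Rel s p, loc x1 = s.1 /\ loc x2 = p.1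
    & req C (jv s.2 p.2) (jv (gval x1) (gval x2))]); split.
  - exists (ta_init A1, val0 R X), (ta_init A2, val0 R X); split=> //.
      by rewrite i21.
    by rewrite /= gx0.
  - exact: match_real_grid.
  - move=> hb; have [_ h3] := h2 hb.
    have := match_real_grid (Rel := fun p s => Rel s p) bA2 bA1 h3.
    move=> mg x1 x2 hx1 hx2 [s [p [hR [e1 e2] hr]]] y1 y2 hy1 hy2 s1 s2 ev a y2' ga hy2' st.
    have [|y1' [k1 k2 [p' [s' [hR' [e1' e2'] hr']]]]] := mg x1 x2 hx1 hx2 _ _ _ hy1 hy2 s1 s2 ev _ _ ga hy2' st.
      by exists p, s; split=> //; apply: req_flip.
    by exists y1'; split=> //; exists s', p'; split=> //; apply: req_flip.
exists (relG G); split.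
  split; last exact: match_grid_real.
  exists x0, x0; split=> //; first by rewrite /= i21.
  by rewrite /= gx0.
move=> hb; split.
  exists x0, x0; split=> //; first by rewrite /= i21.
  by rewrite /= gx0.
move=> s p a p' /relG_flip hR st.
have [s' [ws /relG_flip hR']] := match_grid_real bA2 bA1 (h2 hb) hR st.
by exists s'.
Qed.

End GameAbstraction.

(** * The winning region as a formula *)

Section Formula.
Variables (w : seq bool) (K : nat).
Notation at_ p := (nth false w p).

Definition allent (nx : nat -> nat) (p : nat) (q : nat -> bool) : bool :=
  alln (fl w) (fun k => at_ (skips w nx k p) ==> q (skips w nx k p).+1).
Definition exent (nx : nat -> nat) (p : nat) (q : nat -> bool) : bool :=
  exn (fl w) (fun k => at_ (skips w nx k p) && q (skips w nx k p).+1).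

Definition pos1 := nx_un w 0.
Definition nln := pos1 - 1.
Definition pos2 := nx_un w pos1.
Definition ncn := pos2 - pos1 - 1.
Definition pos3 := nx_un w pos2.
Definition nan := pos3 - pos2 - 1.
Definition pos4 := nx_ord w K nln pos3.
Definition pos5 := nx_seq w (nx_edge w K nln ncn nan) pos4.
Definition inv_skips q := skips w (nx_cons w K ncn true) q pos5.
Definition pos7 := nx_seq w (nx_cons w K ncn true) pos5.
Definition pos8 := nx_set w nan pos7.

(** The two marker tests say that the list of invariants has exactly [nln w] entries: none at index
    [nln w], one at the index before it unless there are no locations. *)
Definition validn : bool :=
  [&& pos8 == size w, ~~ at_ (inv_skips nln) & (nln == 0) || at_ (inv_skips (nln - 1))].

(** With [n] the input length: a constant has at most [n] bits, so it is at most [2 ^ n]; there are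
    at most [2 * n] joint clocks, hence the grid step [2 ^ -(2 * n + 1)]; and [2 ^ (4 * n + 4)]
    exceeds every grid value that can occur in a round. *)
Definition Cn := powc K 2 (size w).
Definition Dn := powc K 2 (2 * size w + 1).
Definition Bn := powc K 2 (4 * size w + 4).
Definition B0n := 2 * size w * (Cn.+1 * Dn).
Definition dmn := Cn * Dn + 1.
Definition pwn a := powc K Bn a.
(** A configuration is one number: its digits in base [Bn] are the grid values of the clocks, and
    the quotient by the power [pwn ncn] is the location. *)
Definition Nn := nln * pwn ncn.
Definition locn x := x %/ pwn ncn.
Definition dgn x a := (x %/ pwn a) %% Bn.

Definition gposn b := nx_ord w K nln b.
Definition lposn b := nx_cons w K ncn false (gposn b).
Definition rposn b := nx_label w K nan (lposn b).
Definition tposn b := nx_set w ncn (rposn b).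
Definition highn a := at_ (pos7 + a).
Definition labn b := nval w K (lposn b).+1.

(** The three bits at [q] are the code of the comparison; the constant written behind them is scaled
    by [Dn] to the grid. *)
Definition atomn (x a : nat) : bool :=
  let v := dgn x (nval w K a) in let q := nx_ord w K ncn a in
  let k := nval w K (q + 3) * Dn in
  if at_ q then k < v
  else if at_ (q + 1) then (if at_ (q + 2) then k <= v else v == k)
  else (if at_ (q + 2) then v <= k else v < k).
Definition satn (p x : nat) : bool := allent (nx_atom w K ncn false) p (atomn x).

Definition estepn b x y : bool :=
  [&& locn x == nval w K b, locn y == nval w K (tposn b), satn (gposn b) x,
      alln ncn (fun a => dgn y a == if at_ (rposn b + a) then 0 else dgn x a)
    & satn (inv_skips (locn y)).+1 y].
(** Both automata are read off the same input: with [h] a high action counts as silent, without [h]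
    its edge is absent. *)
Definition epsn (h : bool) x y : bool :=
  exent (nx_edge w K nln ncn nan) pos4
    (fun b => (~~ at_ (lposn b) || (h && highn (labn b))) && estepn b x y).
Definition actn s x y : bool :=
  exent (nx_edge w K nln ncn nan) pos4
    (fun b => [&& at_ (lposn b), labn b == s, ~~ highn s & estepn b x y]).
Definition deln d x y : bool :=
  [&& locn x == locn y, alln ncn (fun a => dgn y a == dgn x a + d)
    & satn (inv_skips (locn x)).+1 y].

Definition samen x y : bool := (locn x == locn y) && alln ncn (fun a => dgn x a == dgn y a).
Definition reachn (h : bool) x y : bool :=
  piter Nn (fun A z => A z || exn Nn (fun u => A u && epsn h u z)) (samen x) Nn y.
(** Labels are numbers: 0 is silent, [1] to [nan] are the actions, and [nan + 1 + d] is the delay by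
    [d] grid steps. *)
Definition wkn (h : bool) l x y : bool :=
  if l == 0 then reachn h x y
  else exn Nn (fun u => exn Nn (fun v =>
    [&& reachn h x u, (if l <= nan then actn (l - 1) u v else deln (l - nan - 1) u v)
      & reachn h v y])).

Definition smalln x : bool := alln ncn (fun a => (dgn x a <= B0n) && (dgn x a %% 2 == 0)).
Definition jvn x1 x2 i :=
  if i < ncn then dgn x1 i else if i < 2 * ncn then dgn x2 (i - ncn) else 0.
Definition cmpn x1 x2 i j k l : bool := jvn x1 x2 i + k * Dn <= jvn x1 x2 j + l * Dn.
Definition eqvn x1 x2 y1 y2 : bool :=
  [&& locn x1 == locn y1, locn x2 == locn y2
    & alln (2 * ncn).+1 (fun i => alln (2 * ncn).+1 (fun j =>
        alln Cn.+1 (fun k => alln Cn.+1 (fun l =>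
          (cmpn x1 x2 i j k l ==> cmpn y1 y2 i j k l) &&
          (cmpn y1 y2 i j k l ==> cmpn x1 x2 i j k l)))))].

(** The pair coded by [z] has the restricted automaton as first component, which answers the moves
    of the hidden one; with [b] the roles are exchanged as well. *)
Definition roundn (b : bool) (A : nat -> bool) (z : nat) : bool :=
  alln Nn (fun y1 => alln Nn (fun y2 =>
    [&& smalln y1, smalln y2 & eqvn (z %/ Nn) (z %% Nn) y1 y2] ==>
    alln (nan + 1 + dmn.+1) (fun l => alln Nn (fun y' =>
      (wkn true l y2 y' ==> exn Nn (fun y'' => wkn false l y1 y'' && A (y'' * Nn + y'))) &&
      (b ==> (wkn false l y1 y' ==> exn Nn (fun y'' => wkn true l y2 y'' && A (y' * Nn + y'')))))))).

Definition initn := nval w K pos3 * pwn ncn.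

Definition winn (b : bool) : bool :=
  validn && piter (Nn * Nn) (roundn b) (fun=> true) (Nn * Nn) (initn * Nn + initn).

End Formula.

(** * Definability of the winning condition *)

Section Definability.

Lemma T_double f : Tm f -> Tm (fun c => (f c).*2).
Proof. by move=> hf; apply: (T_eq _ (T_add hf hf)) => c; rewrite addnn. Qed.

Lemma T_skips nx k p : Tm1 nx -> Tm k -> Tm p -> Tm (fun c => skips (cw c) (nx c) (k c) (p c)).
Proof.
move=> hn hk hp.
by apply: (@T_biter _ _ (fun c _ q => if nth false (cw c) q then nx c q.+1 else q)); rewrite /fl; tm.
Qed.

Lemma T_nx_seq nx p : Tm1 nx -> Tm p -> Tm (fun c => nx_seq (cw c) (nx c) (p c)).
Proof. by move=> hn hp; rewrite /nx_seq /fl; tm; apply: T_skips; tm. Qed.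

Lemma T_nx_bits p : Tm p -> Tm (fun c => nx_bits (cw c) (p c)).
Proof. by move=> hp; apply: T_nx_seq => //; rewrite /fl; tm. Qed.

Lemma T_nx_un p : Tm p -> Tm (fun c => nx_un (cw c) (p c)).
Proof. by move=> hp; apply: (@T_nx_seq (fun _ x => x)) => //; tm. Qed.

(** Functions shown definable are handed to [tm] in the order of their definitions, so that every
    later formula is decomposed along its own syntax. *)
Ltac tm_user1 := lazymatch goal with
  | |- Tm (fun c => double _) => apply: T_double
  | |- Tm (fun c => powc _ _ _) => apply: T_powc
  | |- Tm (fun c => skips _ _ _ _) => apply: T_skips
  | |- Tm (fun c => nx_seq _ _ _) => apply: T_nx_seq
  | |- Tm (fun c => nx_bits _ _) => apply: T_nx_bits
  | |- Tm (fun c => nx_un _ _) => apply: T_nx_un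
  end.
Ltac tm_user ::= tm_user1.

Lemma T_nx_nat p : Tm p -> Tm (fun c => nx_nat (cw c) (p c)).
Proof. by move=> hp; rewrite /nx_nat /canon /fl; tm. Qed.

Lemma T_nval K p : Tm K -> Tm p -> Tm (fun c => nval (cw c) (K c) (p c)).
Proof.
move=> hK hp; rewrite /nval.
pose k c := (nx_bits (cw c) (p c) - p c) %/ 2.
have hk : Tm k by rewrite /k; tm.
by apply: (@T_biter _ _ (fun c j y => y + y + nth false (cw c) (p c + (k c - j.+1).*2 + 1))); tm.
Qed.

Lemma T_nx_ord K b p : Tm K -> Tm b -> Tm p -> Tm (fun c => nx_ord (cw c) (K c) (b c) (p c)).
Proof.
by move=> hK hb hp; rewrite /nx_ord /fl; tm; [apply: T_nval|apply: T_nx_nat].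
Qed.

Lemma T_nx_cmp up p : Tm p -> Tm (fun c => nx_cmp (cw c) up (p c)).
Proof. by move=> hp; rewrite /nx_cmp /cmp_ok /fl; case: up; tm. Qed.

Lemma T_nx_atom K m up p : Tm K -> Tm m -> Tm p -> Tm (fun c => nx_atom (cw c) (K c) (m c) up (p c)).
Proof. by move=> hK hm hp; apply: T_nx_nat; apply: T_nx_cmp; apply: T_nx_ord. Qed.

Lemma T_nx_cons K m up p : Tm K -> Tm m -> Tm p -> Tm (fun c => nx_cons (cw c) (K c) (m c) up (p c)).
Proof. by move=> hK hm hp; apply: T_nx_seq => //; tm; apply: T_nx_atom; tm. Qed.

Lemma T_nx_label K k p : Tm K -> Tm k -> Tm p -> Tm (fun c => nx_label (cw c) (K c) (k c) (p c)).
Proof. by move=> hK hm hp; rewrite /nx_label /fl; tm; apply: T_nx_ord; tm. Qed.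

Lemma T_nx_set m p : Tm m -> Tm p -> Tm (fun c => nx_set (cw c) (m c) (p c)).
Proof. by move=> hm hp; rewrite /nx_set /fl; tm. Qed.

Lemma T_nx_edge K n m k p : Tm K -> Tm n -> Tm m -> Tm k -> Tm p ->
  Tm (fun c => nx_edge (cw c) (K c) (n c) (m c) (k c) (p c)).
Proof.
move=> hK hn hm hk hp; apply: T_nx_ord => //; apply: T_nx_set => //; apply: T_nx_label => //.
by apply: T_nx_cons => //; apply: T_nx_ord.
Qed.

Lemma T_allent nx p (q : ctx -> nat -> bool) : Tm1 nx -> Tm p -> Tb (fun c => q (vtl c) (cv c 0)) ->
  Tb (fun c => allent (cw c) (nx c) (p c) (q c)).
Proof.
move=> hn hp hq; have hq1 : Tm1 (fun c x => nat_of_bool (q c x)) by exact: hq.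
by rewrite /allent /fl; tm.
Qed.

Lemma T_exent nx p (q : ctx -> nat -> bool) : Tm1 nx -> Tm p -> Tb (fun c => q (vtl c) (cv c 0)) ->
  Tb (fun c => exent (cw c) (nx c) (p c) (q c)).
Proof.
move=> hn hp hq; have hq1 : Tm1 (fun c x => nat_of_bool (q c x)) by exact: hq.
by rewrite /exent /fl; tm.
Qed.

Ltac tm_user2 := lazymatch goal with
  | |- Tm (fun c => nx_nat _ _) => apply: T_nx_nat
  | |- Tm (fun c => nval _ _ _) => apply: T_nval
  | |- Tm (fun c => nx_ord _ _ _ _) => apply: T_nx_ord
  | |- Tm (fun c => nx_atom _ _ _ _ _) => apply: T_nx_atom
  | |- Tm (fun c => nx_cons _ _ _ _ _) => apply: T_nx_cons
  | |- Tm (fun c => nx_label _ _ _ _) => apply: T_nx_label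
  | |- Tm (fun c => nx_set _ _ _) => apply: T_nx_set
  | |- Tm (fun c => nx_edge _ _ _ _ _ _) => apply: T_nx_edge
  | |- Tm (fun c => nat_of_bool (allent _ _ _ _)) => apply: T_allent
  | |- Tm (fun c => nat_of_bool (exent _ _ _ _)) => apply: T_exent
  | |- _ => tm_user1 end.
Ltac tm_user ::= tm_user2.

Lemma T_pos1 : Tm (fun c => pos1 (cw c)).
Proof. by rewrite /pos1; tm. Qed.

Ltac tm_user3 := lazymatch goal with
  | |- Tm (fun c => pos1 _) => apply: T_pos1
  | |- _ => tm_user2 end.
Ltac tm_user ::= tm_user3.

Lemma T_nln : Tm (fun c => nln (cw c)).
Proof. by rewrite /nln; tm. Qed.

Lemma T_pos2 : Tm (fun c => pos2 (cw c)).
Proof. by rewrite /pos2; tm. Qed.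

Ltac tm_user4 := lazymatch goal with
  | |- Tm (fun c => nln _) => apply: T_nln
  | |- Tm (fun c => pos2 _) => apply: T_pos2
  | |- _ => tm_user3 end.
Ltac tm_user ::= tm_user4.

Lemma T_ncn : Tm (fun c => ncn (cw c)).
Proof. by rewrite /ncn; tm. Qed.

Lemma T_pos3 : Tm (fun c => pos3 (cw c)).
Proof. by rewrite /pos3; tm. Qed.

Ltac tm_user5 := lazymatch goal with
  | |- Tm (fun c => ncn _) => apply: T_ncn
  | |- Tm (fun c => pos3 _) => apply: T_pos3
  | |- _ => tm_user4 end.
Ltac tm_user ::= tm_user5.

Lemma T_nan : Tm (fun c => nan (cw c)).
Proof. by rewrite /nan; tm. Qed.

Lemma T_pos4 K : Tm K -> Tm (fun c => pos4 (cw c) (K c)).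
Proof. by move=> hK; rewrite /pos4; tm. Qed.

Ltac tm_user6 := lazymatch goal with
  | |- Tm (fun c => nan _) => apply: T_nan
  | |- Tm (fun c => pos4 _ _) => apply: T_pos4
  | |- _ => tm_user5 end.
Ltac tm_user ::= tm_user6.

Lemma T_pos5 K : Tm K -> Tm (fun c => pos5 (cw c) (K c)).
Proof. by move=> hK; rewrite /pos5; tm. Qed.

Ltac tm_user7 := lazymatch goal with
  | |- Tm (fun c => pos5 _ _) => apply: T_pos5
  | |- _ => tm_user6 end.
Ltac tm_user ::= tm_user7.

Lemma T_inv_skips K q : Tm K -> Tm q -> Tm (fun c => inv_skips (cw c) (K c) (q c)).
Proof. by move=> hK hq; rewrite /inv_skips; tm. Qed.

Lemma T_pos7 K : Tm K -> Tm (fun c => pos7 (cw c) (K c)).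
Proof. by move=> hK; rewrite /pos7; tm. Qed.

Ltac tm_user8 := lazymatch goal with
  | |- Tm (fun c => inv_skips _ _ _) => apply: T_inv_skips
  | |- Tm (fun c => pos7 _ _) => apply: T_pos7
  | |- _ => tm_user7 end.
Ltac tm_user ::= tm_user8.

Lemma T_pos8 K : Tm K -> Tm (fun c => pos8 (cw c) (K c)).
Proof. by move=> hK; rewrite /pos8; tm. Qed.

Lemma T_Cn K : Tm K -> Tm (fun c => Cn (cw c) (K c)).
Proof. by move=> hK; rewrite /Cn; tm. Qed.

Lemma T_Dn K : Tm K -> Tm (fun c => Dn (cw c) (K c)).
Proof. by move=> hK; rewrite /Dn; tm. Qed.

Lemma T_Bn K : Tm K -> Tm (fun c => Bn (cw c) (K c)).
Proof. by move=> hK; rewrite /Bn; tm. Qed.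

Ltac tm_user9 := lazymatch goal with
  | |- Tm (fun c => pos8 _ _) => apply: T_pos8
  | |- Tm (fun c => Cn _ _) => apply: T_Cn
  | |- Tm (fun c => Dn _ _) => apply: T_Dn
  | |- Tm (fun c => Bn _ _) => apply: T_Bn
  | |- _ => tm_user8 end.
Ltac tm_user ::= tm_user9.

Lemma T_validn K : Tm K -> Tm (fun c => nat_of_bool (validn (cw c) (K c))).
Proof. by move=> hK; rewrite /validn; tm. Qed.

Lemma T_B0n K : Tm K -> Tm (fun c => B0n (cw c) (K c)).
Proof. by move=> hK; rewrite /B0n; tm. Qed.

Lemma T_dmn K : Tm K -> Tm (fun c => dmn (cw c) (K c)).
Proof. by move=> hK; rewrite /dmn; tm. Qed.

Lemma T_pwn K a : Tm K -> Tm a -> Tm (fun c => pwn (cw c) (K c) (a c)).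
Proof. by move=> hK ha; rewrite /pwn; tm. Qed.

Lemma T_gposn K b : Tm K -> Tm b -> Tm (fun c => gposn (cw c) (K c) (b c)).
Proof. by move=> hK hb; rewrite /gposn; tm. Qed.

Ltac tm_user10 := lazymatch goal with
  | |- Tm (fun c => nat_of_bool (validn _ _)) => apply: T_validn
  | |- Tm (fun c => B0n _ _) => apply: T_B0n
  | |- Tm (fun c => dmn _ _) => apply: T_dmn
  | |- Tm (fun c => pwn _ _ _) => apply: T_pwn
  | |- Tm (fun c => gposn _ _ _) => apply: T_gposn
  | |- _ => tm_user9 end.
Ltac tm_user ::= tm_user10.

Lemma T_Nn K : Tm K -> Tm (fun c => Nn (cw c) (K c)).
Proof. by move=> hK; rewrite /Nn; tm. Qed.

Lemma T_locn K x : Tm K -> Tm x -> Tm (fun c => locn (cw c) (K c) (x c)).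
Proof. by move=> hK hx; rewrite /locn; tm. Qed.

Lemma T_dgn K x a : Tm K -> Tm x -> Tm a -> Tm (fun c => dgn (cw c) (K c) (x c) (a c)).
Proof. by move=> hK hx ha; rewrite /dgn; tm. Qed.

Lemma T_lposn K b : Tm K -> Tm b -> Tm (fun c => lposn (cw c) (K c) (b c)).
Proof. by move=> hK hb; rewrite /lposn; tm. Qed.

Ltac tm_user11 := lazymatch goal with
  | |- Tm (fun c => Nn _ _) => apply: T_Nn
  | |- Tm (fun c => locn _ _ _) => apply: T_locn
  | |- Tm (fun c => dgn _ _ _ _) => apply: T_dgn
  | |- Tm (fun c => lposn _ _ _) => apply: T_lposn
  | |- _ => tm_user10 end.
Ltac tm_user ::= tm_user11.

Lemma T_rposn K b : Tm K -> Tm b -> Tm (fun c => rposn (cw c) (K c) (b c)).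
Proof. by move=> hK hb; rewrite /rposn; tm. Qed.

Lemma T_labn K b : Tm K -> Tm b -> Tm (fun c => labn (cw c) (K c) (b c)).
Proof. by move=> hK hb; rewrite /labn; tm. Qed.

Lemma T_highn K a : Tm K -> Tm a -> Tm (fun c => nat_of_bool (highn (cw c) (K c) (a c))).
Proof. by move=> hK ha; rewrite /highn; tm. Qed.

Lemma T_atomn K x a :
  Tm K -> Tm x -> Tm a -> Tm (fun c => nat_of_bool (atomn (cw c) (K c) (x c) (a c))).
Proof. by move=> hK hx ha; rewrite /atomn; tm. Qed.

Ltac tm_user12 := lazymatch goal with
  | |- Tm (fun c => rposn _ _ _) => apply: T_rposn
  | |- Tm (fun c => labn _ _ _) => apply: T_labn
  | |- Tm (fun c => nat_of_bool (highn _ _ _)) => apply: T_highn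
  | |- Tm (fun c => nat_of_bool (atomn _ _ _ _)) => apply: T_atomn
  | |- _ => tm_user11 end.
Ltac tm_user ::= tm_user12.

Lemma T_tposn K b : Tm K -> Tm b -> Tm (fun c => tposn (cw c) (K c) (b c)).
Proof. by move=> hK hb; rewrite /tposn; tm. Qed.

Lemma T_satn K p x :
  Tm K -> Tm p -> Tm x -> Tm (fun c => nat_of_bool (satn (cw c) (K c) (p c) (x c))).
Proof. by move=> hK hp hx; rewrite /satn; tm. Qed.

Ltac tm_user13 := lazymatch goal with
  | |- Tm (fun c => tposn _ _ _) => apply: T_tposn
  | |- Tm (fun c => nat_of_bool (satn _ _ _ _)) => apply: T_satn
  | |- _ => tm_user12 end.
Ltac tm_user ::= tm_user13.

Lemma T_estepn K b x y :
  Tm K -> Tm b -> Tm x -> Tm y -> Tm (fun c => nat_of_bool (estepn (cw c) (K c) (b c) (x c) (y c))).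
Proof. by move=> hK hb hx hy; rewrite /estepn; tm. Qed.

Ltac tm_user14 := lazymatch goal with
  | |- Tm (fun c => nat_of_bool (estepn _ _ _ _ _)) => apply: T_estepn
  | |- _ => tm_user13 end.
Ltac tm_user ::= tm_user14.

Lemma T_samen K x y : Tm K -> Tm x -> Tm y -> Tm (fun c => nat_of_bool (samen (cw c) (K c) (x c) (y c))).
Proof. by move=> hK hx hy; rewrite /samen; tm. Qed.

Lemma T_epsn K x y (h : bool) :
  Tm K -> Tm x -> Tm y -> Tm (fun c => nat_of_bool (epsn (cw c) (K c) h (x c) (y c))).
Proof. by move=> hK hx hy; rewrite /epsn; tm. Qed.

Lemma T_actn K s x y :
  Tm K -> Tm s -> Tm x -> Tm y -> Tm (fun c => nat_of_bool (actn (cw c) (K c) (s c) (x c) (y c))).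
Proof. by move=> hK hs hx hy; rewrite /actn; tm. Qed.

Lemma T_deln K d x y :
  Tm K -> Tm d -> Tm x -> Tm y -> Tm (fun c => nat_of_bool (deln (cw c) (K c) (d c) (x c) (y c))).
Proof. by move=> hK hd hx hy; rewrite /deln; tm. Qed.

Ltac tm_user15 := lazymatch goal with
  | |- Tm (fun c => nat_of_bool (epsn _ _ _ _ _)) => apply: T_epsn
  | |- Tm (fun c => nat_of_bool (actn _ _ _ _ _)) => apply: T_actn
  | |- Tm (fun c => nat_of_bool (deln _ _ _ _ _)) => apply: T_deln
  | |- Tm (fun c => nat_of_bool (samen _ _ _ _)) => apply: T_samen
  | |- _ => tm_user14 end.
Ltac tm_user ::= tm_user15.

Lemma T_reachn K x y (h : bool) :
  Tm K -> Tm x -> Tm y -> Tm (fun c => nat_of_bool (reachn (cw c) (K c) h (x c) (y c))).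
Proof. by move=> hK hx hy; apply: (@T_piter _ _ _
  (fun c A z => A z || exn (Nn (cw c) (K c)) (fun u => A u && epsn (cw c) (K c) h u z))
  (fun c => samen (cw c) (K c) (x c))); cbv beta zeta; tm. Qed.

Ltac tm_user16 := lazymatch goal with
  | |- Tm (fun c => nat_of_bool (reachn _ _ _ _ _)) => apply: T_reachn
  | |- _ => tm_user15 end.
Ltac tm_user ::= tm_user16.

Lemma T_wkn K l x y (h : bool) :
  Tm K -> Tm l -> Tm x -> Tm y -> Tm (fun c => nat_of_bool (wkn (cw c) (K c) h (l c) (x c) (y c))).
Proof. by move=> hK hl hx hy; rewrite /wkn; tm. Qed.

Lemma T_smalln K x : Tm K -> Tm x -> Tm (fun c => nat_of_bool (smalln (cw c) (K c) (x c))).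
Proof. by move=> hK hx; rewrite /smalln; tm. Qed.

Lemma T_jvn K x1 x2 i :
  Tm K -> Tm x1 -> Tm x2 -> Tm i -> Tm (fun c => jvn (cw c) (K c) (x1 c) (x2 c) (i c)).
Proof. by move=> hK hx1 hx2 hi; rewrite /jvn; tm. Qed.

Ltac tm_user17 := lazymatch goal with
  | |- Tm (fun c => nat_of_bool (wkn _ _ _ _ _ _)) => apply: T_wkn
  | |- Tm (fun c => nat_of_bool (smalln _ _ _)) => apply: T_smalln
  | |- Tm (fun c => jvn _ _ _ _ _) => apply: T_jvn
  | |- _ => tm_user16 end.
Ltac tm_user ::= tm_user17.

Lemma T_cmpn K x1 x2 i j k l :
  Tm K -> Tm x1 -> Tm x2 -> Tm i -> Tm j -> Tm k -> Tm l -> Tm (fun c => nat_of_bool (cmpn (cw c) (K c) (x1 c) (x2 c) (i c) (j c) (k c) (l c))).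
Proof. by move=> hK hx1 hx2 hi hj hk hl; rewrite /cmpn; tm. Qed.

Ltac tm_user18 := lazymatch goal with
  | |- Tm (fun c => nat_of_bool (cmpn _ _ _ _ _ _ _ _)) => apply: T_cmpn
  | |- _ => tm_user17 end.
Ltac tm_user ::= tm_user18.

Lemma T_eqvn K x1 x2 y1 y2 :
  Tm K -> Tm x1 -> Tm x2 -> Tm y1 -> Tm y2 -> Tm (fun c => nat_of_bool (eqvn (cw c) (K c) (x1 c) (x2 c) (y1 c) (y2 c))).
Proof. by move=> hK hx1 hx2 hy1 hy2; rewrite /eqvn; tm. Qed.

Ltac tm_user19 := lazymatch goal with
  | |- Tm (fun c => nat_of_bool (eqvn _ _ _ _ _ _)) => apply: T_eqvn
  | |- _ => tm_user18 end.
Ltac tm_user ::= tm_user19.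

Lemma T_winn K b : Tm K -> Tm (fun c => winn (cw c) (K c) b).
Proof.
move=> hK; rewrite /winn; apply: T_and; first by tm.
have hi : Tm (fun c => initn (cw c) (K c)) by rewrite /initn; tm.
apply: (@T_piter _ _ _ (fun c => roundn (cw c) (K c) b) (fun c z => true)); try by tm.
by rewrite /roundn; cbv beta zeta; tm.
Qed.

End Definability.

(** * Correctness of the parser on encoded instances *)

Lemma size_enc_seq_ge (T : Type) (enc : T -> seq bool) x l : List.In x l ->
  size (enc x) < size (enc_seq enc l).
Proof.
elim: l => // y l IH; rewrite enc_seq_cons => -[->|/IH h] /=; rewrite size_cat; lia.
Qed.

Lemma nth_In (T : Type) (x0 : T) l k : k < size l -> List.In (nth x0 l k) l.
Proof. by elim: l k => //= x l IH [|k] hk; [left|right; apply: IH]. Qed.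

Lemma In_nth (T : Type) (x0 : T) l x : List.In x l -> exists2 k, k < size l & nth x0 l k = x.
Proof.
elim: l => //= y l IH [->|/IH[k hk <-]]; first by exists 0.
by exists k.+1.
Qed.

Section Entries.
Variable w : seq bool.
Variables (T : Type) (P : T -> Prop) (enc : T -> seq bool) (nx : nat -> nat).
Hypothesis rg : recog w P enc nx.
Variables (p : nat) (l : seq T) (r : seq bool).
Hypothesis hp : p <= size w.
Hypothesis Pl : forall x, List.In x l -> P x.
Hypothesis e : drop p w = enc_seq enc l ++ r.

Lemma entry_pos k x0 : k < size l ->
  (skips w nx k p).+1 <= size w /\
  exists r', drop (skips w nx k p).+1 w = enc (nth x0 l k) ++ r'.
Proof.
move=> hk; have [h1 h2 _] := skips_enc rg hp Pl e (ltnW hk).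
rewrite (drop_nth x0 hk) enc_seq_cons in h2.
have h2' : drop (skips w nx k p) w = [:: true] ++ (enc (nth x0 l k) ++ (enc_seq enc (drop k.+1 l) ++ r)).
  by rewrite h2 /= catA.
have [h3 h4] := drop_cat_size h1 h2'; rewrite addn1 in h3 h4.
by split=> //; eexists; apply: h4.
Qed.

Lemma size_list_fl : size l < fl w.
Proof.
have [h _] := drop_cat_size hp e.
have : size l <= size (enc_seq enc l).
  by rewrite /enc_seq size_cat /=; elim: (l) => //= x l' IH; rewrite size_cat; lia.
by rewrite /fl; lia.
Qed.

Variables (qn : nat -> bool) (qx : T -> bool).
Hypothesis hq : forall x q r', List.In x l -> q <= size w -> drop q w = enc x ++ r' -> qn q = qx x.

Lemma exentP : reflect (exists2 x, List.In x l & qx x) (exent w nx p qn).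
Proof.
apply: (iffP (exnP _ _)) => [[k hk /andP[hm hqk]]|[x hx hqx]].
  rewrite (skips_mark rg _ hp Pl e) in hm.
  have [x0 _] : exists x0 : T, True by case: (l) hm => // x0; exists x0.
  have [h1 [r' h2]] := entry_pos x0 hm.
  exists (nth x0 l k); first exact: nth_In.
  by rewrite -(hq (nth_In x0 hm) h1 h2).
have [k hk ek] := In_nth x hx; have [h1 [r' h2]] := entry_pos x hk.
exists k; first by apply: ltn_trans size_list_fl.
by rewrite (skips_mark rg _ hp Pl e) hk /= (hq (nth_In x hk) h1 h2) ek.
Qed.

Lemma allentE : allent w nx p qn = all qx l.
Proof.
apply/(allnP _ _)/idP => [h|h k hk].
  have {}h x : List.In x l -> qx x.
    move=> hx; have [k hk ek] := In_nth x hx; have [h1 [r' h2]] := entry_pos x hk.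
    have := h k (ltn_trans hk size_list_fl); rewrite (skips_mark rg _ hp Pl e) hk /=.
    by rewrite (hq (nth_In x hk) h1 h2) ek.
  by elim: (l) h => //= x l' IH h; rewrite h ?IH //; [move=> y hy; apply: h; right|left].
apply/implyP; rewrite (skips_mark rg _ hp Pl e) => hm.
have [x0 _] : exists x0 : T, True by case: (l) hm => // x0; exists x0.
have [h1 [r' h2]] := entry_pos x0 hm.
by rewrite (hq (nth_In x0 hm) h1 h2); move/(all_nthP x0): h; apply.
Qed.

End Entries.

Lemma nx_un_decode w p : p <= size w -> nx_un w p <= size w ->
  drop p w = enc_unary (nx_un w p - p - 1) ++ drop (nx_un w p) w.
Proof.
move=> hp hn; have [k _ ek] := rg_dec (recog_un w) hp hn.
have e1 := rg_enc (recog_un w) hp I ek.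
rewrite {1}ek; congr (enc_unary _ ++ _).
by rewrite e1 /enc_unary size_cat size_nseq /=; lia.
Qed.

Lemma validn_decode w K : 2 ^ size w <= K -> validn w K -> exists i, w = encode i.
Proof.
move=> hK /and3P[/eqP h8 hm1 hm2].
have f0 : 0 <= fl w by [].
have /andP[g1 g1'] := rg_ge (recog_un w) f0; rewrite -/(pos1 w) in g1 g1'.
have /andP[g2 g2'] := rg_ge (recog_un w) g1'; rewrite -/(pos2 w) in g2 g2'.
have /andP[g3 g3'] := rg_ge (recog_un w) g2'; rewrite -/(pos3 w) in g3 g3'.
have /andP[g4 g4'] := rg_ge (recog_ord hK (nln w)) g3'; rewrite -/(pos4 w K) in g4 g4'.
have rE := recog_seq (recog_edge hK (nln w) (ncn w) (nan w)).
have /andP[g5 g5'] := rg_ge rE g4'; rewrite -/(pos5 w K) in g5 g5'.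
have rI := recog_seq (recog_cons hK (ncn w) true).
have /andP[g7 g7'] := rg_ge rI g5'; rewrite -/(pos7 w K) in g7 g7'.
have /andP[g8 g8'] := rg_ge (recog_set w (nan w)) g7'; rewrite -/(pos8 w K) in g8 g8'.
have hs : pos8 w K <= size w by rewrite h8.
have e1 := @nx_un_decode w 0 isT; rewrite -/(pos1 w) drop0 subn0 -/(nln w) in e1.
have e2 := @nx_un_decode w (pos1 w); rewrite -/(pos2 w) -/(ncn w) in e2.
have e3 := @nx_un_decode w (pos2 w); rewrite -/(pos3 w) -/(nan w) in e3.
have {}e1 := e1 ltac:(lia); have {}e2 := e2 ltac:(lia) ltac:(lia); have {}e3 := e3 ltac:(lia) ltac:(lia).
have [q0 _ e4] := rg_dec (recog_ord hK (nln w)) (p := pos3 w) ltac:(lia) ltac:(rewrite -/(pos4 w K); lia).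
have [E _ e5] := rg_dec rE (p := pos4 w K) ltac:(lia) ltac:(rewrite -/(pos5 w K); lia).
have [li hli e7] := rg_dec rI (p := pos5 w K) ltac:(lia) ltac:(rewrite -/(pos7 w K); lia).
have [H _ e8] := rg_dec (recog_set w (nan w)) (p := pos7 w K) ltac:(lia) ltac:(rewrite -/(pos8 w K); lia).
rewrite -/(pos4 w K) in e4; rewrite -/(pos5 w K) in e5; rewrite -/(pos7 w K) in e7; rewrite -/(pos8 w K) in e8.
have hp5 : pos5 w K <= size w by lia.
have mk := skips_mark (recog_cons hK (ncn w) true) _ hp5 hli e7.
rewrite /inv_skips !mk in hm1 hm2.
have sli : size li = nln w by move: hm1 hm2; lia.
pose inv : {ffun 'I_(nln w) -> constraint 'I_(ncn w)} := [ffun q : 'I_(nln w) => nth [::] li q].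
have hup : [forall q, all (fun g => is_upper (acmp g)) (inv q)].
  apply/forallP => q; rewrite ffunE; have hq : q < size li by rewrite sli.
  by have := hli _ (nth_In [::] hq).
exists (Instance (TA q0 E hup) H); rewrite /encode /=.
have -> : [seq inv q | q <- enum 'I_(nln w)] = li.
  apply: (@eq_from_nth _ [::]); first by rewrite size_map size_enum_ord sli.
  move=> k; rewrite size_map size_enum_ord => hk.
  by rewrite (nth_map (Ordinal hk)) ?size_enum_ord // ffunE nth_enum_ord.
by rewrite {1}e1 e2 e3 e4 e5 e7 e8 h8 drop_size cats0.
Qed.

Section EncodeFacts.
Variables (w : seq bool) (i : instance) (K : nat).
Hypothesis ew : w = encode i.
Hypothesis hK : 2 ^ size w <= K.
Notation A := (inst_ta i).

Lemma cat_step (T : Type) (P : T -> Prop) (enc : T -> seq bool) nx p x r : recog w P enc nx ->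
  p <= size w -> P x -> drop p w = enc x ++ r ->
  [/\ nx p = p + size (enc x), nx p <= size w & drop (nx p) w = r].
Proof.
move=> rg hp Px e; have [h1 h2] := drop_cat_size hp e.
by rewrite (rg_enc rg hp Px e).
Qed.

Definition invs := [seq ta_inv A q | q <- enum 'I_(nloc i)].

Record facts : Prop := Facts {
  f_nl : nln w = nloc i; f_nc : ncn w = nclock i; f_na : nan w = nact i;
  f_p3 : pos3 w <= size w; f_e3 : exists r, drop (pos3 w) w = enc_nat (ta_init A) ++ r;
  f_p4 : pos4 w K <= size w;
  f_e4 : exists r, drop (pos4 w K) w = enc_seq (@enc_edge _ _ _) (ta_edges A) ++ r;
  f_p5 : pos5 w K <= size w;
  f_e5 : drop (pos5 w K) w = enc_seq (@enc_constraint _) invs ++ enc_set (inst_high i);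
  f_p7 : pos7 w K <= size w; f_e7 : drop (pos7 w K) w = enc_set (inst_high i);
  f_p8 : pos8 w K = size w }.

Lemma invs_upper c : List.In c invs -> all (fun a => true ==> is_upper (acmp a)) c.
Proof.
rewrite /invs; elim: (enum _) => //= q s IH [<-|//].
by have /forallP/(_ q) := ta_inv_upper A.
Qed.

Lemma encode_facts : facts.
Proof.
have e0 : drop 0 w = encode i by rewrite drop0.
have [n1 h1 e1] := cat_step (recog_un w) (leq0n _) I e0; rewrite -/(pos1 w) in n1 h1 e1.
have [n2 h2 e2] := cat_step (recog_un w) h1 I e1; rewrite -/(pos2 w) in n2 h2 e2.
have [n3 h3 e3] := cat_step (recog_un w) h2 I e2; rewrite -/(pos3 w) in n3 h3 e3.
have su n : size (enc_unary n) = n.+1 by rewrite size_cat size_nseq addn1.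
have nl : nln w = nloc i by rewrite /nln n1 su; lia.
have nc : ncn w = nclock i by rewrite /ncn n2 su; lia.
have na : nan w = nact i by rewrite /nan n3 su; lia.
have [n4 h4 e4] := cat_step (recog_ord hK (nloc i)) h3 I e3.
have [n5 h5 e5] := cat_step (recog_seq (recog_edge hK (nloc i) (nclock i) (nact i))) h4 (fun _ _ => I) e4.
have [n7 h7 e7] := cat_step (recog_seq (recog_cons hK (nclock i) true)) h5 invs_upper e5.
have e7' := e7; rewrite -[enc_set _]cats0 in e7'.
have [n8 h8 e8] := cat_step (recog_set w (nact i)) h7 I e7'.
have p4E : nx_ord w K (nloc i) (pos3 w) = pos4 w K by rewrite /pos4 nl.
have p5E : nx_seq w (nx_edge w K (nloc i) (nclock i) (nact i)) (pos4 w K) = pos5 w K.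
  by rewrite /pos5 nl nc na.
have p7E : nx_seq w (nx_cons w K (nclock i) true) (pos5 w K) = pos7 w K by rewrite /pos7 nc.
have p8E : nx_set w (nact i) (pos7 w K) = pos8 w K by rewrite /pos8 na.
rewrite ?(p4E, p5E, p7E, p8E) in h4 e4 h5 e5 h7 e7 h8 e8.
split=> //; try by eexists; eassumption.
have : size w <= pos8 w K; last by lia.
rewrite leqNgt; apply/negP => lt; have := congr1 size e8.
by rewrite size_drop /=; lia.
Qed.

Lemma validn_encode : validn w K.
Proof.
have [nl nc na _ _ _ _ p5 e5 _ _ p8] := encode_facts.
rewrite /validn p8 eqxx /= /inv_skips nc.
have mk k := @skips_mark w _ _ _ _ (recog_cons hK (nclock i) true) _ _ _ k p5 invs_upper e5.
by rewrite !mk /invs size_map size_enum_ord nl ltnn /=; have := ltn_ord (ta_init A); lia.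
Qed.

End EncodeFacts.

Local Open Scope ring_scope.
Local Open Scope nat_scope.

(** * Membership in EXPTIME *)

Lemma digit_add B m q s a : 0 < B -> a < m ->
  ((q * B ^ m + s) %/ B ^ a) %% B = (s %/ B ^ a) %% B.
Proof.
move=> B0 am; have e : B ^ m = B ^ (m - a.+1) * B * B ^ a.
  by rewrite -expnSr -expnD; congr expn; lia.
by rewrite e !mulnA divnMDl ?expn_gt0 ?B0 // modnMDl.
Qed.

Lemma digits B m (f : nat -> nat) : 0 < B -> (forall a, f a < B) ->
  exists2 s, s < B ^ m & forall a, a < m -> (s %/ B ^ a) %% B = f a.
Proof.
move=> B0 hf; elim: m => [|m [s hs es]]; first by exists 0.
exists (f m * B ^ m + s) => [|a].
  apply: leq_trans (_ : (f m).+1 * B ^ m <= _); first by rewrite mulSn addnC ltn_add2r.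
  by rewrite expnS leq_mul2r hf orbT.
rewrite ltnS leq_eqVlt => /orP[/eqP->|am]; last by rewrite digit_add ?es.
by rewrite divnMDl ?expn_gt0 ?B0 // divn_small // addn0 modn_small.
Qed.

Section SideAutomata.
Variables (R : realType) (Q X S : finType) (A : timed_automaton Q X S) (H : {set S}).

Definition side (h : bool) := if h then ta_hide A H else ta_restrict A H.

Definition edge_step (e : edge Q X S) (s s' : Q * valuation R X) : bool :=
  [&& esrc e == s.1, etgt e == s'.1, sat (eguard e) s.2, s'.2 == val_reset s.2 (ereset e)
    & sat (ta_inv A s'.1) s'.2].

Lemma edge_stepP e s s' : reflect [/\ esrc e = s.1, etgt e = s'.1, sat (eguard e) s.2,
  s'.2 = val_reset s.2 (ereset e) & sat (ta_inv A s'.1) s'.2] (edge_step e s s').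
Proof.
apply: (iffP and5P) => [[/eqP ? /eqP ? ? /eqP ? ?]|[? ? ? ? ?]]; split=> //; exact/eqP.
Qed.

Definition eps_edge (h : bool) (e : edge Q X S) : bool :=
  if elabel e is Some a then h && (a \in H) else true.
Definition act_edge (a : S) (e : edge Q X S) : bool := (elabel e == Some a) && (a \notin H).

Lemma side_inv h : ta_inv (side h) = ta_inv A. Proof. by case: h. Qed.

Lemma In_filter (T : Type) (p : pred T) l x : List.In x (filter p l) <-> List.In x l /\ p x.
Proof.
elim: l => [|y l IH] /=; first by split=> // -[].
case: ifP => py /=; rewrite IH; split.
- by case=> [<-|[? ?]]; split=> //; [left|right].
- by case=> -[->|?] ?; [left|right].
- by case=> ? ?; split=> //; right.
- by case=> -[<-|?] //; rewrite py.
Qed.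

Lemma side_eps h (s s' : Q * valuation R X) : discrete_step (side h) None s s' <->
  exists2 e, List.In e (ta_edges A) & eps_edge h e && edge_step e s s'.
Proof.
case: h; split.
- case=> e' [/= /List.in_map_iff[e [<- ein]] [/= h1 h2 h3] h4 h5 h6]; exists e => //; apply/andP; split; last exact/edge_stepP.
  by move: h2; rewrite /eps_edge; case: (elabel e) => // a; case: ifP.
- case=> e ein /andP[he /edge_stepP[h1 h2 h3 h4 h5]]; exists (hide_edge H e); split=> //=.
    by apply/List.in_map_iff; exists e.
  by split=> //; move: he; rewrite /eps_edge; case: (elabel e) => //= a ->.
- case=> e [/= /In_filter[ein hf] [h1 h2 h3] h4 h5 h6]; exists e => //; apply/andP; split; last exact/edge_stepP.
  by rewrite /eps_edge h2.
- case=> e ein /andP[he /edge_stepP[h1 h2 h3 h4 h5]]; exists e; split=> //=.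
    by apply/In_filter; split=> //; move: he; rewrite /eps_edge; case: (elabel e).
  by split=> //; move: he; rewrite /eps_edge; case: (elabel e).
Qed.

Lemma side_act h a (s s' : Q * valuation R X) : discrete_step (side h) (Some a) s s' <->
  exists2 e, List.In e (ta_edges A) & act_edge a e && edge_step e s s'.
Proof.
case: h; split.
- case=> e' [/= /List.in_map_iff[e [<- ein]] [/= h1 h2 h3] h4 h5 h6]; exists e => //; apply/andP; split; last exact/edge_stepP.
  move: h2; rewrite /act_edge; case: (elabel e) => // b; case: ifP => // /negbT hb [<-].
  by rewrite eqxx.
- case=> e ein /andP[/andP[/eqP he ha] /edge_stepP[h1 h2 h3 h4 h5]]; exists (hide_edge H e); split=> //=.
    by apply/List.in_map_iff; exists e.
  by rewrite he (negbTE ha).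
- case=> e [/= /In_filter[ein hf] [h1 h2 h3] h4 h5 h6]; exists e => //; apply/andP; split; last exact/edge_stepP.
  by rewrite /act_edge h2 eqxx; rewrite h2 in hf.
- case=> e ein /andP[/andP[/eqP he ha] /edge_stepP[h1 h2 h3 h4 h5]]; exists e; split=> //=.
  by apply/In_filter; rewrite he.
Qed.

Lemma side_bounded C h : ta_bounded C A -> ta_bounded C (side h).
Proof.
move=> [h1 h2]; split=> [e|q]; last by rewrite side_inv.
case: h => /=; first by case/List.in_map_iff => e' [<- /h1].
by case/In_filter => /h1.
Qed.

Lemma side_delay h (d : {nonneg R}) (s s' : Q * valuation R X) : delay_step (side h) d s s' <->
  s' = (s.1, val_delay s.2 d) /\ sat (ta_inv A s.1) s'.2.
Proof.
rewrite /delay_step side_inv; split=> -[-> hs]; split=> //=; first exact: hs.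
move=> d' hd'; apply: upper_delay hd' hs.
by have /forallP := ta_inv_upper A; apply.
Qed.

End SideAutomata.

Lemma cmp_gridE (R : realType) o (d c D : nat) : 0 < D ->
  compare_sem o (d%:R / D%:R : R)%R c%:R%R =
  match o with
  | CLt => d < c * D | CLe => d <= c * D | CEq => d == c * D | CGe => c * D <= d | CGt => c * D < d
  end.
Proof.
move=> D0; have D0' : (0 < D%:R :> R)%R by rewrite ltr0n.
have le1 : (d%:R / D%:R <= c%:R :> R)%R = (d <= c * D) by rewrite ler_pdivrMr // -natrM ler_nat.
have le2 : (c%:R <= d%:R / D%:R :> R)%R = (c * D <= d) by rewrite ler_pdivlMr // -natrM ler_nat.
case: o => //=; first by rewrite ltNge le2 -ltnNge.
  by rewrite eq_le le1 le2 eqn_leq.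
by rewrite ltNge le1 -ltnNge.
Qed.

(** Each strict step of an increasing chain of subsets of [[0, M)] adds an element, so two
    consecutive members agree at some index up to [M]; by the third hypothesis the chain is constant
    from there on. *)
Lemma chain_stable M (P : nat -> nat -> bool) :
  (forall k z, P k z -> z < M) ->
  (forall k z, P k z -> P k.+1 z) ->
  (forall k, P k =1 P k.+1 -> P k.+1 =1 P k.+2) -> P M =1 P M.+1.
Proof.
move=> hM inc det; pose c k := count (P k) (iota 0 M).
have cle k : c k <= M by rewrite -[X in _ <= X](size_iota 0) count_size.
have ceq k : c k.+1 <= c k -> P k =1 P k.+1.
  move=> h z; apply/idP/idP => [|hz]; first exact: inc.
  have zM := hM _ _ hz; have : z \in iota 0 M by rewrite mem_iota.
  move: h; rewrite /c; elim: (iota 0 M) => //= y s IH; rewrite inE => h.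
  have sub : count (P k) s <= count (P k.+1) s by apply: sub_count => x; apply: inc.
  case/orP=> [/eqP e|zs]; last first.
    apply: IH => //; move: h; have := inc k y.
    by case: (P k y); case: (P k.+1 y) => //= h1; first [lia | by have := h1 isT].
  by subst y; move: h; rewrite hz; case: (P k z) => //=; lia.
have [k kM ek] : exists2 k, k <= M & P k =1 P k.+1.
  suff : (exists2 k, k <= M & c k.+1 <= c k) by case=> k kM /ceq; exists k.
  case: (altP (@hasP _ (fun k => c k.+1 <= c k) (iota 0 M.+1))) => [[k]|/hasPn no].
    by rewrite mem_iota => /andP[_ ?] ?; exists k.
  have : forall k, k <= M.+1 -> k <= c k.
    elim=> // k IH hk; have /no : k \in iota 0 M.+1 by rewrite mem_iota.
    by rewrite -ltnNge; have := IH (ltnW hk); lia.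
  by move=> /(_ M.+1 (leqnn _)); have := cle M.+1; lia.
have main j : P (k + j) =1 P (k + j).+1 by elim: j => [|j IH]; rewrite ?addn0 // addnS; apply: det.
by have := main (M - k); rewrite subnKC.
Qed.

Lemma iff_of_reflect (P : Prop) (b : bool) : reflect P b -> b <-> P.
Proof. by move=> h; split=> /h. Qed.

Section Correctness.
Variables (R : realType) (i : instance) (w : seq bool) (K : nat).
Hypothesis ew : w = encode i.
Notation n := (size w).
Hypothesis hK : 2 ^ ((4 * n + 4) * n) <= K.
Notation A := (inst_ta i).
Notation H := (inst_high i).
Notation m := (nclock i).
Notation J := (2 * n + 1).

Lemma n_gt0 : 0 < n.
Proof. by rewrite ew /encode !size_cat /enc_unary ?size_cat /=; lia. Qed.

Lemma hK1 : 2 ^ n <= K.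
Proof. by apply: leq_trans hK; rewrite leq_exp2l // leq_pmull //; lia. Qed.

Let F := encode_facts ew hK1.

Lemma m_le : m <= n.
Proof. by rewrite ew /encode !size_cat /enc_unary ?size_cat !size_nseq /=; lia. Qed.

Lemma CnE : Cn w K = 2 ^ n. Proof. exact: powcE hK1. Qed.
Lemma DnE : Dn w K = 2 ^ J.
Proof.
apply: powcE => //; apply: leq_trans hK; rewrite leq_exp2l //; have := n_gt0; nia.
Qed.
Lemma BnE : Bn w K = 2 ^ (4 * n + 4).
Proof.
apply: powcE => //; apply: leq_trans hK; rewrite leq_exp2l //; have := n_gt0; nia.
Qed.
Lemma Bn_gt0 : 0 < Bn w K. Proof. by rewrite BnE expn_gt0. Qed.
(** [Bn ^ n = 2 ^ ((4 * n + 4) * n)] is the largest power that the formula computes; it dictates the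
    lower bound on [K]. *)
Lemma pwnE a : a <= n -> pwn w K a = Bn w K ^ a.
Proof.
move=> ha; apply: powcE; first exact: Bn_gt0.
by apply: leq_trans hK; rewrite BnE -expnM leq_exp2l // leq_mul2l ha orbT.
Qed.
Lemma NnE : Nn w K = nloc i * Bn w K ^ m.
Proof. by rewrite /Nn (f_nl F) (f_nc F) pwnE // m_le. Qed.

Definition loc x : 'I_(nloc i) := insubd (ta_init A) (locn w K x).
Definition dg x (a : 'I_m) : nat := dgn w K x a.
Notation gv x := (gval R J dg x).
Notation lf x := (lift R J loc dg x).

Lemma locE x : x < Nn w K -> loc x = locn w K x :> nat.
Proof.
rewrite NnE => hx; rewrite val_insubd /locn (f_nc F) pwnE ?m_le //.
by rewrite ltn_divLR ?expn_gt0 ?Bn_gt0 // hx.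
Qed.

Lemma dg_onto q (f : 'I_m -> nat) : (forall a, f a < Bn w K) ->
  exists x, [/\ x < Nn w K, loc x = q & forall a, dg x a = f a].
Proof.
move=> hf; pose g a := if insub a is Some a' then f a' else 0.
have hg a : g a < Bn w K by rewrite /g; case: insubP => // _; apply: Bn_gt0.
have [s hs es] := digits m Bn_gt0 hg.
exists (q * Bn w K ^ m + s).
have hx : q * Bn w K ^ m + s < Nn w K.
  rewrite NnE; apply: leq_trans (_ : q.+1 * Bn w K ^ m <= _); first by rewrite mulSn addnC ltn_add2r.
  by rewrite leq_mul2r ltn_ord orbT.
split=> // [|a].
  apply: ord_inj; rewrite locE // /locn (f_nc F) pwnE ?m_le // divnMDl ?expn_gt0 ?Bn_gt0 //.
  by rewrite divn_small // addn0.
have ha := ltn_ord a; rewrite /dg /dgn pwnE; last by have := m_le; lia.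
by rewrite digit_add ?Bn_gt0 // es // /g valK.
Qed.

Lemma dg_lt x a : dg x a < Bn w K. Proof. by rewrite ltn_mod Bn_gt0. Qed.

Lemma D_pos : 0 < 2 ^ J. Proof. by rewrite expn_gt0. Qed.

Lemma size_pos_bits_le c : c < 2 ^ size (enc_nat c).
Proof.
rewrite -{1}(bits_val_nat c); apply: leq_trans (bits_val_lt _) _.
by rewrite leq_exp2l // /enc_nat enc_bits_size; lia.
Qed.

Lemma atomnE x q (a : atom 'I_m) r : q <= n -> drop q w = enc_atom a ++ r ->
  atomn w K x q = compare_sem (acmp a) (gv x (aclock a))%:num%R (aconst a)%:R%R.
Proof.
move=> hq e0; have e : drop q w = enc_nat (aclock a) ++ (enc_cmp_op (acmp a) ++ (enc_nat (aconst a) ++ r)).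
  by rewrite e0 /enc_atom !catA.
have [e1 h1 e2] := cat_step (recog_ord hK1 m) hq I e.
have [h2 e3] := drop_cat_size h1 e2.
rewrite /atomn (nvalP hK1 hq e) (f_nc F) DnE.
have s3 : size (enc_cmp_op (acmp a)) = 3 by case: (acmp a).
rewrite s3 in h2 e3; rewrite (nvalP hK1 h2 e3).
have nt j : j < 3 -> nth false w (nx_ord w K m q + j) = nth false (enc_cmp_op (acmp a)) j.
  by move=> hj; rewrite -nth_drop e2 nth_cat s3 hj.
rewrite -{1}[nx_ord w K m q]addn0 !nt // ffunE /= cmp_gridE ?D_pos // -/(dg x (aclock a)).
by case: (acmp a).
Qed.

Lemma satnE x p (g : constraint 'I_m) r : p <= n -> drop p w = enc_constraint g ++ r ->
  satn w K p x = sat g (gv x).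
Proof.
move=> hp e; rewrite /satn (f_nc F).
apply: (@allentE w _ _ _ _ (recog_atom hK1 m false) p g r) => //.
by move=> a q r' _ hq; apply: atomnE.
Qed.

Lemma inv_posn (q : 'I_(nloc i)) : (inv_skips w K q).+1 <= n /\
  exists r, drop (inv_skips w K q).+1 w = enc_constraint (ta_inv A q) ++ r.
Proof.
rewrite /inv_skips (f_nc F).
have sz : q < size (invs i) by rewrite size_map size_enum_ord.
have [h1 [r h2]] := entry_pos (recog_cons hK1 m true) (f_p5 F) (@invs_upper i) (f_e5 F) [::] sz.
split=> //; exists r; rewrite h2 (nth_map q) ?size_enum_ord //.
by congr (enc_constraint (ta_inv A _) ++ _); apply: val_inj; rewrite /= nth_enum_ord.
Qed.

Lemma satn_inv x y : y < Nn w K -> satn w K (inv_skips w K (locn w K y)).+1 x = sat (ta_inv A (loc y)) (gv x).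
Proof.
by move=> hy; rewrite -locE //; have [h1 [r h2]] := inv_posn (loc y); apply: satnE h2.
Qed.

Lemma gval_reset x y (Y : {set 'I_m}) :
  gv y = val_reset (gv x) Y <-> forall a, dg y a = if a \in Y then 0 else dg x a.
Proof.
have D0 : ((2 ^ J)%:R != 0 :> R)%R by rewrite pnatr_eq0 -lt0n D_pos.
have inj a b : (a%:R / (2 ^ J)%:R = b%:R / (2 ^ J)%:R :> R)%R -> a = b.
  by move/(mulIf (invr_neq0 D0))/eqP; rewrite eqr_nat => /eqP.
split=> [/ffunP e a|e].
  have := congr1 (fun z : {nonneg R} => z%:num%R) (e a); rewrite !ffunE; case: ifP => _ /=.
    by rewrite -[X in _ = X](mul0r ((2 ^ J)%:R^-1)%R) => /(inj _ 0).
  by move/inj.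
by apply/ffunP => a; apply: val_inj; rewrite !ffunE /= e; case: ifP => _ /=; rewrite ?mul0r.
Qed.

Lemma gval_delay x y d : gv y = val_delay (gv x) (d%:R / (2 ^ J)%:R)%:nng%R <->
  forall a, dg y a = dg x a + d.
Proof.
have D0 : ((2 ^ J)%:R != 0 :> R)%R by rewrite pnatr_eq0 -lt0n D_pos.
split=> [/ffunP e a|e].
  have := congr1 (fun z : {nonneg R} => z%:num%R) (e a); rewrite !ffunE /= -mulrDl -natrD.
  by move/(mulIf (invr_neq0 D0))/eqP; rewrite eqr_nat => /eqP.
by apply/ffunP => a; apply: val_inj; rewrite !ffunE /= e natrD mulrDl.
Qed.

Lemma gval_eq x y : gv y = gv x <-> forall a, dg y a = dg x a.
Proof.
have := gval_reset x y set0; rewrite val_reset0 => ->.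
by split=> e a; rewrite e inE.
Qed.

Lemma alln_ord (p : nat -> bool) : reflect (forall a : 'I_m, p a) (alln (ncn w) p).
Proof.
rewrite (f_nc F); apply: (iffP (allnP _ _)) => [h a|h a ha]; first exact: h.
exact: (h (Ordinal ha)).
Qed.

Section OneEdge.
Variables (b : nat) (e : edge 'I_(nloc i) 'I_m 'I_(nact i)) (r : seq bool).
Hypothesis hb : b <= n.
Hypothesis eb : drop b w = enc_edge e ++ r.

Lemma edge_positions :
  [/\ nval w K b = esrc e,
      gposn w K b <= n /\ exists r, drop (gposn w K b) w = enc_constraint (eguard e) ++ r,
      lposn w K b <= n /\ exists r, drop (lposn w K b) w = enc_label (elabel e) ++ r,
      forall a : 'I_m, nth false w (rposn w K b + a) = (a \in ereset e)
    & nval w K (tposn w K b) = etgt e].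
Proof.
have e0 : drop b w = enc_nat (esrc e) ++ (enc_constraint (eguard e) ++
    (enc_label (elabel e) ++ (enc_set (ereset e) ++ (enc_nat (etgt e) ++ r)))).
  by rewrite eb /enc_edge !catA.
have [_ h1 e1] := cat_step (recog_ord hK1 (nloc i)) hb I e0.
have Pg : all (fun a => false ==> is_upper (acmp a)) (eguard e) by elim: (eguard e).
have [_ h2 e2] := cat_step (recog_cons hK1 m false) h1 Pg e1.
have [_ h3 e3] := cat_step (recog_label hK1 (nact i)) h2 I e2.
have [_ h4 e4] := cat_step (recog_set w m) h3 I e3.
rewrite /tposn /rposn /lposn /gposn (f_nl F) (f_nc F) (f_na F); split.
- exact: (nvalP hK1 hb e0).
- by split=> //; eexists; apply: e1.
- by split=> //; eexists; apply: e2.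
- move=> a; rewrite -nth_drop e3 nth_cat size_map size_enum_ord ltn_ord.
  by rewrite (nth_map a) ?size_enum_ord // nth_ord_enum.
- exact: (nvalP hK1 h4 e4).
Qed.

Lemma estepnP x y : x < Nn w K -> y < Nn w K ->
  estepn w K b x y = edge_step A e (lf x) (lf y).
Proof.
move=> hx hy; have [e1 [h2 [r2 e2]] _ e4 e5] := edge_positions.
rewrite /estepn e1 e5 (satnE x h2 e2) satn_inv // -!locE //.
apply/idP/edge_stepP => /=.
  case/and5P=> /eqP/val_inj l1 /eqP/val_inj l2 hg /alln_ord hr hi; split=> //=.
  by apply/gval_reset => a; rewrite -e4; apply/eqP/hr.
case=> /= <- <- hg /gval_reset hr hi; rewrite !eqxx hg hi /= andbT.
by apply/alln_ord => a; rewrite e4; apply/eqP/hr.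
Qed.

Lemma lab_positions :
  nth false w (lposn w K b) = isSome (elabel e) /\
  forall a, elabel e = Some a -> labn w K b = a.
Proof.
have [_ _ [h [r' e']] _ _] := edge_positions.
case el : (elabel e) e' => [a|] e'; split=> //.
- exact: nth_drop_head e'.
- move=> _ [<-]; rewrite /labn.
  have [h1 h2] := @drop_cat_size w _ [:: true] (enc_nat a ++ r') h e'.
  by rewrite addn1 in h1 h2; apply: (nvalP hK1 h1 h2).
- exact: nth_drop_head e'.
Qed.

End OneEdge.

Lemma highnE (a : 'I_(nact i)) : highn w K a = (a \in H).
Proof.
rewrite /highn -nth_drop (f_e7 F) /enc_set (nth_map a) ?size_enum_ord //.
by rewrite nth_ord_enum.
Qed.

Lemma epsnP h x y : x < Nn w K -> y < Nn w K ->
  epsn w K h x y <-> discrete_step (side A H h) None (lf x) (lf y).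
Proof.
move=> hx hy; rewrite side_eps; have [r4 e4] := f_e4 F.
rewrite /epsn (f_nl F) (f_nc F) (f_na F).
apply: iff_of_reflect; apply: (exentP (recog_edge hK1 _ _ _) (f_p4 F) (fun _ _ => I) e4) => e b r _ hb eb.
rewrite (estepnP hb eb) //; congr andb; have [l1 l2] := lab_positions hb eb.
rewrite l1 /eps_edge; case el: (elabel e) => [a|] //=.
by rewrite (l2 a el) highnE.
Qed.

Lemma actnP h (s : 'I_(nact i)) x y : x < Nn w K -> y < Nn w K ->
  actn w K s x y <-> discrete_step (side A H h) (Some s) (lf x) (lf y).
Proof.
move=> hx hy; rewrite side_act; have [r4 e4] := f_e4 F.
rewrite /actn (f_nl F) (f_nc F) (f_na F).
apply: iff_of_reflect; apply: (exentP (recog_edge hK1 _ _ _) (f_p4 F) (fun _ _ => I) e4) => e b r _ hb eb.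
rewrite (estepnP hb eb) //; have [l1 l2] := lab_positions hb eb.
rewrite l1 /act_edge highnE; case el: (elabel e) => [a|] //=.
by rewrite (l2 a el) -andbA.
Qed.

Lemma delnP h d x y : x < Nn w K -> y < Nn w K ->
  deln w K d x y <-> delay_step (side A H h) (d%:R / (2 ^ J)%:R)%:nng%R (lf x) (lf y).
Proof.
move=> hx hy; rewrite side_delay /deln satn_inv //= -!locE //; split.
  case/and3P=> /eqP/val_inj l1 /alln_ord hr hi; split=> //.
  by rewrite /lift l1; congr pair; apply/gval_delay => a; apply/eqP/hr.
case=> -[l1 /gval_delay hr] hi; rewrite l1 eqxx hi andbT /=.
by apply/alln_ord => a; apply/eqP/hr.
Qed.

Lemma samenP x y : x < Nn w K -> y < Nn w K -> samen w K x y <-> lf x = lf y.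
Proof.
move=> hx hy; rewrite /samen -!locE //; split.
  case/andP=> /eqP/val_inj l1 /alln_ord hr.
  by rewrite /lift l1; congr pair; apply/gval_eq => a; apply/eqP/hr.
case=> l1 /gval_eq hr; rewrite l1 eqxx /=.
by apply/alln_ord => a; apply/eqP/hr.
Qed.

Lemma grid_reset x q (Y : {set 'I_m}) : exists2 y, y < Nn w K & lf y = (q, val_reset (gv x) Y).
Proof.
have [a|y [h1 h2 h3]] := @dg_onto q (fun a => if a \in Y then 0 else dg x a).
  by case: ifP => _; [apply: Bn_gt0|apply: dg_lt].
by exists y => //; rewrite /lift h2; congr pair; apply/gval_reset.
Qed.

Lemma reachnP h x y : x < Nn w K -> y < Nn w K ->
  reachn w K h x y <-> eps_steps (T := ta_tts R (side A H h)) (lf x) (lf y).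
Proof.
move=> hx hy; rewrite /reachn; set Phi := fun _ _ => _; set M := Nn w K in hx hy *.
have lt k z : piter M Phi (samen w K x) k z -> z < M by case: k => [|k] /= /andP[].
have inc k z : piter M Phi (samen w K x) k z -> piter M Phi (samen w K x) k.+1 z.
  by move=> hz; rewrite /= (lt _ _ hz) /Phi hz.
have st := @chain_stable M (piter M Phi (samen w K x)) lt inc.
have {}st : piter M Phi (samen w K x) M =1 piter M Phi (samen w K x) M.+1.
  apply: st => k e; have {}e : piter M Phi (samen w K x) k = piter M Phi (samen w K x) k.+1.
    exact: functional_extensionality.
  by move=> z; rewrite [LHS]/= [in LHS]e.
split.
  suff main k : forall y, y < M -> piter M Phi (samen w K x) k y ->
    eps_steps (T := ta_tts R (side A H h)) (lf x) (lf y) by apply: main.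
  elim: k => [|k IH] {hy}y hy /=; rewrite hy /=.
    by move/(samenP hx hy) => ->; apply: rt_refl.
  case/orP=> [/IH|/exnP[z hz /andP[/IH e1 /(epsnP h hz hy) e2]]]; first by apply.
  by apply: rt_trans (e1 hz) _; apply: rt_step.
move=> hs; have main s : eps_steps (T := ta_tts R (side A H h)) (lf x) s ->
    exists2 z, lf z = s & z < M /\ piter M Phi (samen w K x) M z.
  move=> h0; elim: (clos_rt_rtn1 _ _ _ _ h0) => [|s1 s2 s12 _ [z ez [hz rz]]].
    exists x => //; split=> //.
    have all_k k : piter M Phi (samen w K x) k x.
      by elim: k => [|k]; [rewrite /= hx; apply/samenP|apply: inc].
    exact: all_k.
  rewrite -ez in s12; case: s2 s12 => q2 v2 s12.
  have [e ein /andP[he /edge_stepP[_ _ _ /= ev _]]] := (side_eps A H h (lf z) (q2, v2)).1 s12.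
  (* A silent step only resets clocks, so its target lies on the grid again and has a code. *)
  have [z2 hz2 ez2] := grid_reset z q2 (ereset e).
  exists z2; first by rewrite ez2 ev.
  split=> //; rewrite st /= hz2 /=; apply/orP; right; apply/exnP; exists z => //.
  by rewrite rz; apply/(epsnP h hz hz2); rewrite ez2 -ev.
have [z ez [hz rz]] := main _ hs; have hzy : samen w K z y by apply/samenP.
(* The path ends at some code [z] of the configuration of [y]; membership is carried over to [y]
   because the iterates depend on a code only through its configuration. *)
suff closed k u v : u < M -> v < M -> lf u = lf v -> piter M Phi (samen w K x) k u -> piter M Phi (samen w K x) k v.
  exact: closed rz.
elim: k u v => [|k IH] u v hu hv euv /=; rewrite hu hv /=.
  by move/(samenP hx hu) => e; apply/(samenP hx hv); rewrite e.
case/orP=> [h1|/exnP[z' hz' /andP[h1 /(epsnP h hz' hu) h2]]]; first by apply/orP; left; apply: IH h1.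
by apply/orP; right; apply/exnP; exists z' => //; rewrite h1; apply/(epsnP h hz' hv); rewrite -euv.
Qed.

Lemma enc_nat_bound c : size (enc_nat c) <= n -> c <= 2 ^ n.
Proof.
move=> h; apply: ltnW; apply: leq_trans (size_pos_bits_le c) _.
by rewrite leq_exp2l.
Qed.

Lemma constraint_bound (g : constraint 'I_m) : size (enc_constraint g) <= n -> cons_bounded (2 ^ n) g.
Proof.
move=> hg; have h a : List.In a g -> aconst a <= 2 ^ n.
  move=> ain; apply: enc_nat_bound.
  apply: leq_trans hg; apply: leq_trans (ltnW (size_enc_seq_ge (@enc_atom m) ain)).
  by rewrite /enc_atom catA size_cat leq_addl.
rewrite /cons_bounded; elim: (g) h => //= a g' IH h; rewrite h ?IH //; last by left.
by move=> a' ha'; apply: h; right.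
Qed.

Lemma inst_bounded : ta_bounded (2 ^ n) A.
Proof.
split=> [e ein|q]; apply: constraint_bound.
  have h1 := size_enc_seq_ge (@enc_edge _ _ _) ein; have [r e4] := f_e4 F.
  have [h _] := drop_cat_size (f_p4 F) e4.
  have : size (enc_constraint (eguard e)) <= size (enc_edge e).
    by rewrite /enc_edge size_cat; apply: leq_trans (leq_addl _ _); rewrite size_cat leq_addr.
  lia.
have qin : List.In (ta_inv A q) (invs i).
  have sz : q < size (invs i) by rewrite size_map size_enum_ord.
  by have := nth_In [::] sz; rewrite (nth_map q) ?size_enum_ord // nth_ord_enum.
have := size_enc_seq_ge (@enc_constraint _) qin.
have [h _] := drop_cat_size (f_p5 F) (f_e5 F).
lia.
Qed.

Lemma hJ : #|{: 'I_m + 'I_m}| < J.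
Proof. by rewrite card_sum !card_ord; have := m_le; lia. Qed.

Lemma hB0 : #|{: 'I_m + 'I_m}| * ((2 ^ n).+1 * 2 ^ J) <= B0n w K.
Proof.
by rewrite card_sum !card_ord /B0n CnE DnE leq_mul2r; apply/orP; right; have := m_le; lia.
Qed.

Lemma hdm : 2 ^ n * 2 ^ J + 1 <= dmn w K. Proof. by rewrite /dmn CnE DnE. Qed.

Lemma hBs : B0n w K + dmn w K < Bn w K.
Proof.
rewrite /B0n /dmn CnE DnE BnE.
have -> : 2 ^ (4 * n + 4) = 16 * (2 ^ n * 2 ^ n * (2 ^ n * 2 ^ n)).
  have e4 : 2 ^ (4 * n) = 2 ^ n * 2 ^ n * (2 ^ n * 2 ^ n) by rewrite -!expnD; congr expn; lia.
  by rewrite expnD e4 mulnC.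
have -> : 2 ^ J = 2 * (2 ^ n * 2 ^ n).
  have e2 : 2 ^ (2 * n) = 2 ^ n * 2 ^ n by rewrite -!expnD; congr expn; lia.
  by rewrite expnD e2 mulnC.
have : n < 2 ^ n by apply: ltn_expl.
have : 0 < 2 ^ n by rewrite expn_gt0.
move: (2 ^ n) => a; move: n => k a0 ka.
(* As [k < a] with [a = 2 ^ n], the sum is at most [4 * a ^ 4 + 6 * a ^ 3 + 1], which is below
   [16 * a ^ 4]. *)
have h1 : 2 * k * (a.+1 * (2 * (a * a))) <= 2 * a * (a.+1 * (2 * (a * a))) by rewrite leq_mul2r leq_mul2l (ltnW ka) !orbT.
have h2 : a * (a * a) <= a * a * (a * a) by rewrite mulnA leq_mul2l leq_pmulr ?orbT.
have h3 : 0 < a * a * (a * a) by rewrite !muln_gt0 a0.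
have e1 : 2 * a * (a.+1 * (2 * (a * a))) = 4 * (a * a * (a * a)) + 4 * (a * (a * a)) by nia.
have e2 : a * (2 * (a * a)) = 2 * (a * (a * a)) by nia.
lia.
Qed.

Notation sml x := (small (B0n w K) dg x).

Lemma smallnP x : reflect (sml x) (smalln w K x).
Proof.
apply: (iffP (alln_ord _)) => h a; have := h a; rewrite modn2 eqb0 => /andP.
  by [].
by case.
Qed.

Definition lab l : label R 'I_(nact i) :=
  if l == 0 then Eps _ _ else
  if insub (l - 1) is Some s then Act R s else Delay _ ((l - nact i - 1)%:R / (2 ^ J)%:R)%:nng%R.

Lemma ceq_refl (v : valuation R 'I_m) C : ceq C v v. Proof. by []. Qed.

Lemma wknP h l x y : x < Nn w K -> y < Nn w K -> sml x -> l < nact i + 1 + (dmn w K).+1 ->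
  wkn w K h l x y <-> weak_step (T := ta_tts R (side A H h)) (lab l) (lf x) (lf y).
Proof.
move=> hx hy sx hl; rewrite /wkn /lab; case: eqP => [_|/eqP l0]; first exact: reachnP.
have bS := side_bounded H h inst_bounded.
rewrite (f_na F); case: insubP => [s hs es|hs].
  have -> : l <= nact i by lia.
  split.
    case/exnP=> u hu /exnP[v hv /and3P[/(reachnP h hx hu) h1 h2 /(reachnP h hv hy) h3]].
    exists (lf u), (lf v); split=> //; apply/(actnP h s hu hv); by rewrite -es in h2.
  case=> -[q1 v1] [[q2 v2] [h1 h2 h3]].
  (* Transport to the same valuation exposes the intermediate state as a reset of [gv x], for which
     a code exists. *)
  have [Y eY _] := transport_eps bS (@ceq_refl (gv x) _) h1.
  have [u hu eu] := grid_reset x q1 Y; rewrite eY -eu in h1 h2.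
  have [e ein /andP[he /edge_stepP[_ _ _ /= ev _]]] := (side_act A H h s (lf u) (q2, v2)).1 h2.
  have [v hv ev'] := grid_reset u q2 (ereset e); rewrite ev -ev' in h2 h3.
  apply/exnP; exists u => //; apply/exnP; exists v => //; apply/and3P; split.
  - exact/(reachnP h hx hu).
  - by rewrite -es; apply/(actnP h s hu hv).
  - exact/(reachnP h hv hy).
have -> : (l <= nact i) = false by lia.
split.
  case/exnP=> u hu /exnP[v hv /and3P[/(reachnP h hx hu) h1 h2 /(reachnP h hv hy) h3]].
  by exists (lf u), (lf v); split=> //; apply/(delnP h _ hu hv).
case=> -[q1 v1] [[q2 v2] [h1 h2 h3]].
have [Y eY _] := transport_eps bS (@ceq_refl (gv x) _) h1.
have [u hu eu] := grid_reset x q1 Y; rewrite eY -eu in h1 h2.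
have [v hv ev] : exists2 v, v < Nn w K & lf v = (q2, v2).
  have [-> _] := h2.
  (* Smallness of [x] enters here: the clock values after the delay must still be digits in base
     [Bn]. *)
  have [a|v [k1 k2 k3]] := @dg_onto (loc u) (fun a => dg u a + (l - nact i - 1)).
    have [_ /gval_reset ->] := eu.
    by case: ifP => _; have := hBs; have [? _] := sx a; lia.
  by exists v => //; rewrite /lift k2; congr pair; apply/gval_delay.
rewrite -ev in h2 h3.
apply/exnP; exists u => //; apply/exnP; exists v => //; apply/and3P; split.
- exact/(reachnP h hx hu).
- exact/(delnP h _ hu hv).
- exact/(reachnP h hv hy).
Qed.

Definition jidx (o : option ('I_m + 'I_m)) : nat :=
  match o with None => 2 * m | Some (inl a) => a | Some (inr a) => m + a end.

Lemma jvnE x1 x2 o : (jv (gv x1) (gv x2) o = (jvn w K x1 x2 (jidx o))%:R / (2 ^ J)%:R)%R.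
Proof.
case: o => [[a|a]|] /=; rewrite /jvn (f_nc F); have := m_le => hm.
- by rewrite ltn_ord ffunE.
- have ha := ltn_ord a; have -> : (m + a < m) = false by lia.
  have -> : m + a < 2 * m by lia.
  by rewrite addKn ffunE.
- have -> : (2 * m < m) = false by lia.
  by rewrite ltnn mul0r.
Qed.

Lemma cmpnE x1 x2 o o' k l :
  (jv (gv x1) (gv x2) o + k%:R <= jv (gv x1) (gv x2) o' + l%:R)%R =
  cmpn w K x1 x2 (jidx o) (jidx o') k l.
Proof.
have D0 : (0 < (2 ^ J)%:R :> R)%R by rewrite ltr0n D_pos.
rewrite !jvnE /cmpn DnE -(ler_pM2r D0) !mulrDl !divfK ?gt_eqF // -!natrM -!natrD ler_nat.
by [].
Qed.

Lemma jidx_onto j : j < (2 * m).+1 -> exists o, jidx o = j.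
Proof.
move=> hj; case: (ltnP j m) => h1; first by exists (Some (inl (Ordinal h1))).
case: (ltnP j (2 * m)) => h2; last by exists None => /=; lia.
have h3 : j - m < m by lia.
by exists (Some (inr (Ordinal h3))) => /=; lia.
Qed.

Lemma jidx_lt o : jidx o < (2 * m).+1.
Proof. by case: o => [[a|a]|] //=; have := ltn_ord a; lia. Qed.

Lemma eqvnP x1 x2 y1 y2 : x1 < Nn w K -> x2 < Nn w K -> y1 < Nn w K -> y2 < Nn w K ->
  eqvn w K x1 x2 y1 y2 <-> eqv R (2 ^ n) J loc dg x1 x2 y1 y2.
Proof.
move=> hx1 hx2 hy1 hy2; rewrite /eqvn (f_nc F) CnE -!locE //; split.
  case/and3P=> /eqP/ord_inj l1 /eqP/ord_inj l2 /allnP hr; split=> // o o' k l hk hl.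
  rewrite !cmpnE; have /allnP hr1 := hr _ (jidx_lt o); have /allnP hr2 := hr1 _ (jidx_lt o').
  have /allnP hr3 := hr2 k hk; have /andP[i1 i2] := hr3 l hl.
  by apply/idP/idP; [apply/implyP: i1|apply/implyP: i2].
case=> -> -> hr; rewrite !eqxx /=.
apply/allnP => j hj; apply/allnP => j' hj'; apply/allnP => k hk; apply/allnP => l hl.
have [o <-] := jidx_onto hj; have [o' <-] := jidx_onto hj'.
by rewrite -!cmpnE hr // !implybb.
Qed.

Lemma lab_glab l : l < nact i + 1 + (dmn w K).+1 -> glab J (dmn w K) (lab l).
Proof.
move=> hl; rewrite /lab; case: eqP => // _; case: insubP => //= _.
by exists (l - nact i - 1) => //; lia.
Qed.

Lemma glab_lab a : glab J (dmn w K) a -> exists2 l, l < nact i + 1 + (dmn w K).+1 & lab l = a.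
Proof.
case: a => [|s|d] /=; first by exists 0 => //; lia.
  move=> _; exists s.+1; first by have := ltn_ord s; lia.
  by rewrite /lab /= subn1 /= valK.
case=> k hk ek; exists (nact i + 1 + k); first by lia.
rewrite /lab; have -> : (nact i + 1 + k == 0) = false by lia.
rewrite insubF; last by lia.
have -> : nact i + 1 + k - nact i - 1 = k by lia.
by congr Delay; apply: val_inj; rewrite /= ek.
Qed.

Notation Ns := (Nn w K).

Lemma initn_lt : initn w K < Ns /\ lf (initn w K) = (ta_init A, val0 R _).
Proof.
have [r3 e3] := f_e3 F; have e : initn w K = ta_init A * Bn w K ^ m + 0.
  by rewrite addn0 /initn (nvalP hK1 (f_p3 F) e3) (f_nc F) pwnE ?m_le.
have hlt : initn w K < Ns.
  by rewrite e NnE addn0 ltn_pmul2r ?expn_gt0 ?Bn_gt0.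
split=> //; rewrite /lift; congr pair.
  apply: ord_inj; rewrite locE // e /locn (f_nc F) pwnE ?m_le // divnMDl ?expn_gt0 ?Bn_gt0 //.
  by rewrite div0n addn0.
apply/ffunP => a; apply: val_inj; rewrite !ffunE /= /dg /dgn e pwnE; last first.
  by have := m_le; have := ltn_ord a; lia.
by rewrite digit_add ?Bn_gt0 // div0n mod0n mul0r.
Qed.

Lemma pair_lt x y : x < Ns -> y < Ns -> x * Ns + y < Ns * Ns.
Proof. by move=> hx hy; nia. Qed.

Lemma roundn_le b (A1 A2 : nat -> bool) z : (forall x, A1 x -> A2 x) -> roundn w K b A1 z -> roundn w K b A2 z.
Proof.
move=> h12 /allnP h; apply/allnP => y1 hy1; apply/allnP => y2 hy2.
apply/implyP => hs; have /allnP := h _ hy1 => /(_ _ hy2)/implyP/(_ hs)/allnP {}h.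
apply/allnP => l hl; apply/allnP => y' hy'; have /allnP/(_ _ hy')/andP[k1 k2] := h _ hl.
apply/andP; split.
  apply/implyP => hw; have /exnP[z1 hz1 /andP[p1 p2]] := implyP k1 hw.
  by apply/exnP; exists z1 => //; rewrite p1 h12.
apply/implyP => hb; apply/implyP => hw; have /exnP[z1 hz1 /andP[p1 p2]] := implyP (implyP k2 hb) hw.
by apply/exnP; exists z1 => //; rewrite p1 h12.
Qed.

(** The iterates decrease from the full set, so [chain_stable] is applied to their complements. *)
Lemma win_stable b : let P := piter (Ns * Ns) (roundn w K b) (fun=> true) in
  P (Ns * Ns) =1 P (Ns * Ns).+1.
Proof.
move=> P; set M := Ns * Ns.
have lt k z : P k z -> z < M by case: k => [|k] /= /andP[].
have dec k z : P k.+1 z -> P k z.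
  elim: k z => [|k IH] z /andP[hz h]; rewrite /P /= hz //=.
  by apply: roundn_le h => x; apply: IH.
pose P' k z := (z < M) && ~~ P k z.
have st : P' M =1 P' M.+1.
  apply: chain_stable => [k z /andP[]//|k z /andP[hz h]|k e].
    by rewrite /P' hz; apply: contra h; apply: dec.
  have ek : P k = P k.+1.
    apply: functional_extensionality => z; have := e z; rewrite /P'.
    case: (ltnP z M) => hz /=; first by move/negb_inj.
    by move=> _; apply/idP/idP => /lt; lia.
  by move=> z; rewrite /P' -[P k.+1 z]/((z < M) && roundn w K b (P k) z) ek.
move=> z; have := st z; rewrite /P'; case: (ltnP z M) => hz /=; first by move/negb_inj.
by move=> _; apply/idP/idP => /lt; lia.
Qed.

Theorem winnP b : winn w K b <->
  exists Rel : ta_tts R (side A H false) -> ta_tts R (side A H true) -> Prop, weak_simulation Rel /\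
     (b -> weak_simulation (fun p s => Rel s p)).
Proof.
have [hi li] := initn_lt.
have Ns0 : 0 < Ns by lia.
have bS h := side_bounded H h inst_bounded.
rewrite (@game_abstraction R _ _ _ (2 ^ n) J (B0n w K) (dmn w K) (Bn w K) Ns loc dg hJ hB0 hdm hBs dg_onto b
  _ _ (initn w K) (bS false) (bS true) hi li erefl).
rewrite /winn (validn_encode ew hK1) andTb.
have dv x1 x2 : x2 < Ns -> ((x1 * Ns + x2) %/ Ns = x1) /\ ((x1 * Ns + x2) %% Ns = x2).
  by move=> h; rewrite divnMDl // divn_small // addn0 modnMDl modn_small.
have naE := f_na F; split.
  (* Being stable, the last iterate is itself a matching relation. *)
  move=> hw; exists (fun x1 x2 => piter (Ns * Ns) (roundn w K b) (fun=> true) (Ns * Ns) (x1 * Ns + x2)).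
  have key x1 x2 y1 y2 a : x1 < Ns -> x2 < Ns ->
      piter (Ns * Ns) (roundn w K b) (fun=> true) (Ns * Ns) (x1 * Ns + x2) ->
      y1 < Ns -> y2 < Ns -> sml y1 -> sml y2 -> eqv R (2 ^ n) J loc dg x1 x2 y1 y2 ->
      glab J (dmn w K) a -> exists2 l, lab l = a & l < nact i + 1 + (dmn w K).+1 /\ forall y', y' < Ns ->
      (wkn w K true l y2 y' ==> exn Ns (fun y'' => wkn w K false l y1 y'' &&
         piter (Ns * Ns) (roundn w K b) (fun=> true) (Ns * Ns) (y'' * Ns + y'))) &&
      (b ==> (wkn w K false l y1 y' ==> exn Ns (fun y'' => wkn w K true l y2 y'' &&
         piter (Ns * Ns) (roundn w K b) (fun=> true) (Ns * Ns) (y' * Ns + y'')))).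
    move=> hx1 hx2; rewrite win_stable /= => /andP[_ hr] hy1 hy2 s1 s2 ev ga.
    have [l hl el] := glab_lab ga; exists l => //; split=> // y' hy'.
    have [e1 e2] := dv x1 x2 hx2; move: hr; rewrite /roundn e1 e2.
    move/allnP/(_ _ hy1)/allnP/(_ _ hy2)/implyP; rewrite naE.
    have -> : [&& smalln w K y1, smalln w K y2 & eqvn w K x1 x2 y1 y2].
      by apply/and3P; split; [apply/smallnP|apply/smallnP|apply/eqvnP].
    by move/(_ isT)/allnP/(_ _ hl)/allnP/(_ _ hy').
  split=> //.
  - move=> x1 x2 hx1 hx2 hG y1 y2 hy1 hy2 s1 s2 ev a y2' ga hy2' st.
    have [l el [hl hk]] := key _ _ _ _ _ hx1 hx2 hG hy1 hy2 s1 s2 ev ga.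
    have /andP[/implyP h1 _] := hk _ hy2'.
    rewrite -el in st; have /exnP[y1' hy1' /andP[h2 h3]] := h1 ((wknP true hy2 hy2' s2 hl).2 st).
    by exists y1'; split=> //; rewrite -el; apply/(wknP false hy1 hy1' s1 hl).
  - move=> hb x2 x1 hx2 hx1 hG y2 y1 hy2 hy1 s2 s1 [l2 l1 hr] a y1' ga hy1' st.
    have ev : eqv R (2 ^ n) J loc dg x1 x2 y1 y2 by split=> //; apply: req_flip.
    have [l el [hl hk]] := key _ _ _ _ _ hx1 hx2 hG hy1 hy2 s1 s2 ev ga.
    have /andP[_ /implyP/(_ hb)/implyP h1] := hk _ hy1'.
    rewrite -el in st; have /exnP[y2' hy2' /andP[h2 h3]] := h1 ((wknP false hy1 hy1' s1 hl).2 st).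
    by exists y2'; split=> //; rewrite -el; apply/(wknP true hy2 hy2' s2 hl).
case=> G [G0 m1 m2].
(* Every matching relation is contained in each iterate, by induction on the number of rounds. *)
suff main k : forall x1 x2, x1 < Ns -> x2 < Ns -> G x1 x2 ->
    piter (Ns * Ns) (roundn w K b) (fun=> true) k (x1 * Ns + x2) by apply: main.
elim: k => [|k IH] x1 x2 hx1 hx2 hG /=; rewrite pair_lt //=.
have [e1 e2] := dv x1 x2 hx2; rewrite /roundn e1 e2.
apply/allnP => y1 hy1; apply/allnP => y2 hy2; apply/implyP.
case/and3P=> /smallnP s1 /smallnP s2 /(eqvnP hx1 hx2 hy1 hy2) ev.
apply/allnP => l hl; apply/allnP => y' hy'; rewrite naE in hl; have ga := lab_glab hl.
apply/andP; split.
  apply/implyP => /(wknP true hy2 hy' s2 hl) st.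
  have [y1' [h1 h2 h3]] := m1 _ _ hx1 hx2 hG _ _ hy1 hy2 s1 s2 ev _ _ ga hy' st.
  apply/exnP; exists y1' => //; apply/andP; split; last exact: IH.
  exact/(wknP false hy1 h1 s1 hl).
apply/implyP => hb; apply/implyP => /(wknP false hy1 hy' s1 hl) st.
have ev' : eqv R (2 ^ n) J loc dg x2 x1 y2 y1 by case: ev => ? ? ?; split=> //; apply: req_flip.
have [y2' [h1 h2 h3]] := m2 hb _ _ hx2 hx1 hG _ _ hy2 hy1 s2 s1 ev' _ _ ga hy' st.
apply/exnP; exists y2' => //; apply/andP; split; last exact: IH.
exact/(wknP true hy2 h1 s2 hl).
Qed.

End Correctness.

Section Membership.
Variable R : realType.

(** The identity is a simulation, because hiding keeps all transitions of the restriction. Only the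
    other half of CSNNI has to be decided. *)
Lemma hide_simulates_restrict (Q X S : finType) (A : timed_automaton Q X S) H :
  weakly_simulates (ta_tts R (ta_hide A H)) (ta_tts R (ta_restrict A H)).
Proof.
have eps s s' : discrete_step (R := R) (ta_restrict A H) None s s' -> discrete_step (ta_hide A H) None s s'.
  move/(side_eps A H false) => [e ein /andP[he hs]]; apply/(side_eps A H true); exists e => //.
  by rewrite hs andbT; move: he; rewrite /eps_edge; case: (elabel e).
have epss s s' : eps_steps (T := ta_tts R (ta_restrict A H)) s s' ->
    eps_steps (T := ta_tts R (ta_hide A H)) s s'.
  elim=> [x y /eps|x|x y z _ h1 _ h2]; [exact: rt_step|exact: rt_refl|exact: rt_trans h1 h2].
exists eq; split=> // s p a p' -> hw; exists p'; split=> //; case: a hw => [|a|d] /=; first exact: epss.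
- case=> s1 [s2 [h1 h2 h3]]; exists s1, s2; split; auto.
  by move/(side_act A H false): h2 => h2; apply/(side_act A H true).
- by case=> s1 [s2 [h1 h2 h3]]; exists s1, s2; split; auto.
Qed.

Lemma EXPTIME_problem (b : bool) (L : seq bool -> Prop) :
  (forall w, L w <-> exists i, w = encode i /\
     if b then is_BSNNI R (inst_ta i) (inst_high i) else is_CSNNI R (inst_ta i) (inst_high i)) ->
  EXPTIME L.
Proof.
move=> hL; have [x hx] := T_winn b (T_var 0).
(* The exponent 10 is generous: [n ^ 10 + 10] has to reach [(4 * n + 4) * n] for every [n]. *)
apply: (@EXPTIME_of_ex L x 10) => w; rewrite hx /= hL lt0b.
set K := 2 ^ _; set n := size w.
have hK : 2 ^ ((4 * n + 4) * n) <= K.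
  rewrite leq_exp2l // -/n; case: (n) => [|[|k]] //.
  have -> : k.+2 ^ 10 = k.+2 ^ 8 * (k.+2 * k.+2) by rewrite mulnn -expnD.
  have : 2 ^ 8 <= k.+2 ^ 8 by rewrite leq_exp2r.
  rewrite -[2 ^ 8]/256; move: (k.+2 ^ 8) => z hz; nia.
have simE i : w = encode i -> winn w K b <->
     if b then is_BSNNI R (inst_ta i) (inst_high i) else is_CSNNI R (inst_ta i) (inst_high i).
  move=> ew; rewrite (winnP R ew hK); case: b {hL hx}.
    by split=> -[Rel [h1 h2]]; exists Rel; split=> //; apply: h2.
  split=> [[Rel [h1 _]]|[[Rel h1] _]]; last by exists Rel.
  by split; [exists Rel|apply: hide_simulates_restrict].
split=> [hw|[i [ew h]]]; last by apply/(simE i ew).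
have [i ew] : exists i, w = encode i.
  case/andP: (hw) => hv _; apply: validn_decode hv; apply: leq_trans hK.
  by rewrite leq_exp2l // -/n; case: (n) => // k; nia.
by exists i; split=> //; apply/(simE i ew).
Qed.

End Membership.

(** * The claim game *)

(** A weak move of the challenger is a path, matched one strong step at a time; the silent steps
    around the answers compose. *)
Lemma weak_simulation_of_steps (R : realType) (S : finType) (T1 T2 : TTS R S) (Rel : T1 -> T2 -> Prop) :
  Rel (tinit T1) (tinit T2) ->
  (forall s p a p', Rel s p -> tstep a p p' -> exists s', weak_step a s s' /\ Rel s' p') ->
  weak_simulation Rel.
Proof.
move=> h0 hs; split=> // s p a p' hR.
have eps s1 p1 p2 : Rel s1 p1 -> eps_steps p1 p2 -> exists s2, eps_steps s1 s2 /\ Rel s2 p2.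
  move=> + h; elim: h s1 => {p1 p2} [p1 p2 h|p1|p1 p2 p3 _ IH1 _ IH2] s1 h1.
  - exact: (hs _ _ (Eps _ _) _ h1 h).
  - by exists s1; split=> //; apply: rt_refl.
  - have [s2 [e2 h2]] := IH1 _ h1; have [s3 [e3 h3]] := IH2 _ h2.
    by exists s3; split=> //; apply: rt_trans e2 e3.
case: a => [|a|d] /=; first exact: eps.
- case=> p1 [p2 [e1 e2 e3]]; have [s1 [f1 h1]] := eps _ _ _ hR e1.
  have [s2 [[u1 [u2 [g1 g2 g3]]] h2]] := hs _ _ (Act R a) _ h1 e2.
  have [s3 [f3 h3]] := eps _ _ _ h2 e3; exists s3; split=> //.
  by exists u1, u2; split=> //; [apply: rt_trans f1 g1|apply: rt_trans g3 f3].
- case=> p1 [p2 [e1 e2 e3]]; have [s1 [f1 h1]] := eps _ _ _ hR e1.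
  have [s2 [[u1 [u2 [g1 g2 g3]]] h2]] := hs _ _ (Delay S d) _ h1 e2.
  have [s3 [f3 h3]] := eps _ _ _ h2 e3; exists s3; split=> //.
  by exists u1, u2; split=> //; [apply: rt_trans f1 g1|apply: rt_trans g3 f3].
Qed.

Section Views.
Variable M : TM.
Notation Jt := 'I_(tm_tapes M).+1.
Definition cellF : finType := option (bool + tm_aux M)%type.
Definition view : finType := (tm_state M * {ffun Jt -> cellF})%type.

Definition vw (c : config M) : view := (cstate c, [ffun j => tape_read (ctapes c j)]).

Definition vstep (s : view) : tm_state M * (Jt -> cellF * head_move) :=
  if tm_halt s.1 then (s.1, fun j => (s.2 j, Stay))
  else ((tm_delta s.1 s.2).1, fun j => (tm_delta s.1 s.2).2 j).

(* The cell at distance [k - O] from the head. *)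
Definition cellat (O : nat) (t : tape (tm_aux M)) (k : nat) : cellF :=
  if k < O then nth None (tleft t) (O - k.+1) else nth None (tright t) (k - O).

(** Positions are relative to the head, so a head move shifts all of them: cell [k] after the step
    was cell [sh mv k] before it. *)
Definition sh (mv : head_move) (k : nat) : nat :=
  match mv with MoveL => k.-1 | Stay => k | MoveR => k.+1 end.

Lemma cellat_act O t b mv k : 0 < k -> 0 < O ->
  cellat O (tape_act t (b, mv)) k = if sh mv k == O then b else cellat O t (sh mv k).
Proof.
move=> k0 O0; rewrite /cellat /tape_act; case: mv => /=.
- case: (ltngtP k O) => h.
  + rewrite nth_behead (_ : (k.-1 == O) = false); last by lia.
    by rewrite (_ : k.-1 < O); [congr nth; lia|lia].
  + have [d e] : exists d, k = O + d.+1 by exists (k - O).-1; lia.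
    rewrite e addKn; case: d e => [|d] e /=; first by rewrite addn1 eqxx.
    rewrite nth_behead (_ : ((O + d.+2).-1 == O) = false); last by lia.
    by rewrite (_ : ((O + d.+2).-1 < O) = false); [congr nth; lia|lia].
  + rewrite h subnn /= (_ : (O.-1 == O) = false); last by lia.
    by rewrite (_ : O.-1 < O); [rewrite -nth0; congr nth; lia|lia].
- case: (ltngtP k O) => h //; last by rewrite h subnn.
  have [d e] : exists d, k = O + d.+1 by exists (k - O).-1; lia.
  by rewrite e addKn /= nth_behead.
- case: (ltngtP k O) => h.
  + have [d e] : exists d, O = k + d.+1 by exists (O - k).-1; lia.
    rewrite e (_ : k + d.+1 - k.+1 = d); last by lia.
    case: d e => [|d] e /=; first by rewrite addn1 eqxx.
    rewrite (_ : (k.+1 == k + d.+2) = false); last by lia.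
    by rewrite (_ : k.+1 < k + d.+2); [congr nth; lia|lia].
  + rewrite nth_behead (_ : (k.+1 == O) = false); last by lia.
    by rewrite (_ : (k.+1 < O) = false); [congr nth; lia|lia].
  + rewrite h nth_behead subnn (_ : (O.+1 == O) = false); last by lia.
    by rewrite (_ : (O.+1 < O) = false); [congr nth; lia|lia].
Qed.

Lemma cellat_head O t : cellat O t O = tape_read t.
Proof. by rewrite /cellat ltnn subnn nth0. Qed.

Lemma step_state c : cstate (tm_step c) = (vstep (vw c)).1.
Proof. by rewrite /tm_step /vstep /=; case: ifP => // _; case: (tm_delta _ _). Qed.

Lemma step_cell O c j k : 0 < k -> 0 < O ->
  cellat O (ctapes (tm_step c) j) k =
  let: (b, mv) := (vstep (vw c)).2 j in
  if sh mv k == O then b else cellat O (ctapes c j) (sh mv k).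
Proof.
move=> k0 O0; rewrite /tm_step /vstep /=; case: ifP => _ /=.
  by rewrite ffunE; case: eqP => [->|//]; rewrite cellat_head.
case: (tm_delta _ _) => q acts /=; rewrite ffunE; case: (acts j) => b mv /=.
exact: cellat_act.
Qed.

Lemma run_halted w t t' : t <= t' -> tm_halt (cstate (tm_run M w t)) -> tm_run M w t' = tm_run M w t.
Proof.
move=> le h; rewrite -(subnK le) /tm_run iterD -/(tm_run M w t).
elim: (t' - t) => //= d ->.
by rewrite /tm_step h.
Qed.

End Views.

(** * The automaton of the reduction *)

Variant cst := K0 | KO | KOm | KOp | KP | KPm | KPp | KG | KOn | KOj.

Section Reduction.
Variables (M : TM) (cc : nat).
Notation Jt := 'I_(tm_tapes M).+1.
Notation view := (view M).
Notation cellF := (cellF M).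

(* A claim: the state is accepting, the state is [q], or the current cell of
   tape [j] contains [a]. *)
Definition claim : finType := option (tm_state M + Jt * cellF)%type.
(* [None]: the position becomes that of the head; [Some mv]: it moves by [mv]. *)
Definition mode : finType := option (option bool).
(** A round has two phases. In [Pl s th d] an announcement is due, and [s = true] obliges it to be
    an actual view; [Ul th o] remembers what was announced. The contested pairs are [Pl true]
    against [Pl false] and [Ul th (Some sg)] against [Ul th None]. *)
Definition Loc : finType := ((bool * claim * mode) + (claim * option view))%type.
Definition Lab : finType := (option bool + view * option (option Jt))%type.

Definition Pl s th d : Loc := inl (s, th, d).
Definition Ul th o : Loc := inr (th, o).
Definition La : Lab := inl None.
Definition Lz : Lab := inl (Some true).
Definition Lh : Lab := inl (Some false).
Definition Lb sg ka : Lab := inr (sg, ka).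

Definition cx : 'I_3 := Ordinal (isT : 0 < 3).
Definition cy : 'I_3 := Ordinal (isT : 1 < 3).
Definition cg : 'I_3 := Ordinal (isT : 2 < 3).

Definition mode_of (mv : head_move) : mode :=
  Some (match mv with MoveL => Some false | Stay => None | MoveR => Some true end).
Definition msh (d : option bool) (k : nat) : nat :=
  match d with None => k | Some true => k.+1 | Some false => k.-1 end.

Definition sguard := seq ('I_3 * cmp_op * cst).
(** Guards carry symbolic constants, so that the list of edges, apart from those that read an input
    cell, depends on the machine alone and only its constants are filled in from the input. *)
Record sedge := SEdge { ssrc : Loc; sgrd : sguard; slab : Lab; srst : {set 'I_3}; stgt : Loc }.

(** The position at the end of a round is the time since [cy] was reset. A reset when [cy] shows [P]
    reproduces the old position, at [P - 1] it grows by one, at [P + 1] it drops by one. A reset at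
    [cx = O] yields [P - O = O], the place of the head. *)
Definition mode_guard (d : mode) : sguard :=
  [:: match d with
      | None => (cx, CEq, KO)
      | Some None => (cy, CEq, KP)
      | Some (Some true) => (cy, CEq, KPm)
      | Some (Some false) => (cy, CEq, KPp)
      end].
(** The clock [cg] is never reset: when the round for time [t] ends it shows [(T - t + 1) * P].
    Hence [cg < KG] reads [t > 0], and [cg = KG] reads [t = 0]. *)
Definition round_guard : sguard := [:: (cx, CEq, KP); (cg, CLt, KG)].
Definition end_guard : sguard := [:: (cx, CEq, KP); (cg, CEq, KG)].
(* The position that the move takes to the head. *)
Definition kmv (mv : head_move) : cst :=
  match mv with MoveL => KOp | Stay => KO | MoveR => KOm end.

(* The continuations of a claim once the previous view is known: a carried
   claim, or [None] when the view refutes the claim. *)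
Definition check (th : claim) (sg : view) : seq (sguard * option mode) :=
  match th with
  | None => if tm_accept (vstep sg).1 then [::] else [:: ([::], None)]
  | Some (inl q) => if (vstep sg).1 == q then [::] else [:: ([::], None)]
  | Some (inr (j, a)) =>
      let: (b, mv) := (vstep sg).2 j in
      [:: ([:: (cy, CLt, kmv mv)], Some (mode_of mv)); ([:: (cy, CGt, kmv mv)], Some (mode_of mv))]
      ++ if a == b then [::] else [:: ([:: (cy, CEq, kmv mv)], None)]
  end.

(** At time 0 a nonblank content is wrong outside the input block, and everywhere on the tapes other
    than the first. Inside the block, the comparison with the input bit, which also refutes a blank,
    is left to [edges_inp]. *)
Definition zcheck (th : claim) : seq sguard :=
  match th with
  | None => [::]
  | Some (inl q) => if q == tm_start M then [::] else [:: [::]]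
  | Some (inr (j, a)) =>
      if a == None then [::] else
      if j == ord0 then [:: [:: (cy, CLt, KO)]; [:: (cy, CGe, KOn)]] else [:: [::]]
  end.

Definition edges_P : seq sedge :=
  [seq SEdge (Pl x.1.1 x.1.2.1 x.1.2.2) (mode_guard x.1.2.2) La [set cy] (Ul x.1.2.1 x.2)
  | x <- enum {: (bool * (claim * mode)) * option view} & x.1.1 ==> isSome x.2].
(** The label names a view, and the bit [o == Some sg] punishes a wrong guess: a view that was not
    announced sends both sides to the same location. If the right one is named, the announcing side
    keeps its obligation and the other stays free. *)
Definition edges_st : seq sedge :=
  [seq SEdge (Ul x.1.1 x.1.2) round_guard (Lb x.2 (Some None)) [set cx]
     (Pl (x.1.2 == Some x.2) (Some (inl x.2.1)) None)
  | x <- enum {: (claim * option view) * view}].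
Definition edges_ce : seq sedge :=
  [seq SEdge (Ul x.1.1.1 x.1.1.2) round_guard (Lb x.1.2 (Some (Some x.2))) [set cx]
     (Pl (x.1.1.2 == Some x.1.2) (Some (inr (x.2, x.1.2.2 x.2))) None)
  | x <- enum {: ((claim * option view) * view) * Jt}].
(** A refuting edge is missing exactly where the refuting view itself was announced, so that whoever
    announced it cannot follow the challenge. *)
Definition edges_check : seq sedge :=
  flatten [seq [seq SEdge (Ul x.1.1 x.1.2) (round_guard ++ y.1) (Lb x.2 None) [set cx]
      (if y.2 is Some d then Pl (x.1.2 == Some x.2) x.1.1 d else Pl false x.1.1 None)
    | y <- check x.1.1 x.2 & isSome y.2 || (x.1.2 != Some x.2)]
  | x <- enum {: (claim * option view) * view}].
(** Final edges leave only from locations without an announcement; the obliged side can never answer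
    one. *)
Definition zedge th g : sedge := SEdge (Ul th None) (end_guard ++ g) Lz set0 (Pl false th None).
Definition edges_z : seq sedge := flatten [seq [seq zedge th g | g <- zcheck th] | th <- enum claim].
(** The only high edge lifts the obligation, and only at time zero. Hidden, it is a silent step;
    restricted, it is gone. *)
Definition edge_h : sedge :=
  SEdge (Pl true None None) [:: (cx, CEq, K0); (cg, CEq, K0)] Lh set0 (Pl false None None).
Definition edges_fix : seq sedge := edge_h :: edges_P ++ edges_st ++ edges_ce ++ edges_check ++ edges_z.
Definition edges_inp (b : bool) : seq sedge :=
  [seq zedge (Some (inr (ord0, a))) [:: (cy, CEq, KOj)] | a <- enum cellF & a != Some (inl b)].

Section Input.
Variable w : seq bool.
(** The exponent [cc.+1] keeps the input length below [Tn] even for [cc = 0]; the further factor 2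
    in [Tn] absorbs the case [0 ^ 0 = 1] in the bound on the running time. *)
Definition mm := size w ^ cc.+1 + cc.
Definition Tn := 2 ^ mm.+1.
Definition On := 2 ^ mm.+2.
Definition Pn := 2 ^ mm.+3.

Definition kval (j : nat) (k : cst) : nat :=
  match k with
  | K0 => 0 | KO => On | KOm => On - 1 | KOp => On + 1 | KP => Pn | KPm => Pn - 1 | KPp => Pn + 1
  | KG => Tn.+1 * Pn | KOn => On + size w | KOj => On + j
  end.

Definition inst_edge (j : nat) (e : sedge) : edge 'I_#|{: Loc}| 'I_3 'I_#|{: Lab}| :=
  Edge (enum_rank (ssrc e)) [seq Atom a.1.1 a.1.2 (kval j a.2) | a <- sgrd e]
    (Some (enum_rank (slab e))) (srst e) (enum_rank (stgt e)).

Definition red_edges :=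
  [seq inst_edge 0 e | e <- edges_fix] ++
  flatten [seq [seq inst_edge j e | e <- edges_inp (nth false w j)] | j <- iota 0 (size w)].

Definition red_inv : {ffun 'I_#|{: Loc}| -> constraint 'I_3} := [ffun=> [::]].

Lemma red_inv_upper : [forall q, all (fun g => is_upper (acmp g)) (red_inv q)].
Proof. by apply/forallP => q; rewrite ffunE. Qed.

Definition red_ta : timed_automaton 'I_#|{: Loc}| 'I_3 'I_#|{: Lab}| :=
  TA (enum_rank (Pl true None None)) red_edges red_inv_upper.

Definition red_inst : instance := Instance red_ta [set enum_rank Lh].

Definition conf t := tm_run M w t.
Definition holds (t k : nat) (th : claim) : Prop :=
  match th with
  | None => tm_accept (cstate (conf t))
  | Some (inl q) => cstate (conf t) = q
  | Some (inr (j, a)) => cellat On (ctapes (conf t) j) k = a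
  end.

Lemma Tn_gt1 : 1 < Tn.
Proof. by rewrite /Tn -[1]/(2 ^ 0) ltn_exp2l. Qed.
Lemma OnE : On = 2 * Tn. Proof. by rewrite /On expnS. Qed.
Lemma PnE : Pn = 4 * Tn. Proof. by rewrite /Pn /Tn !expnS; lia. Qed.
Lemma w_lt : size w < Tn.
Proof.
apply: leq_trans (ltn_expl (size w) (leqnn 2)) _; rewrite leq_exp2l // /mm.
apply: leq_trans (_ : (size w ^ cc.+1).+1 <= _); last by lia.
by case: (size w) => // k; rewrite expnS; apply: leqW; apply: leq_pmulr; rewrite expn_gt0.
Qed.

Section Semantics.
Variable R : realType.
Notation val := (valuation R 'I_3).

Definition gsat (j : nat) (g : sguard) (v : val) : bool :=
  sat [seq Atom a.1.1 a.1.2 (kval j a.2) | a <- g] v.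

Lemma gsat_cat j g g' v : gsat j (g ++ g') v = gsat j g v && gsat j g' v.
Proof. by rewrite /gsat /sat map_cat all_cat. Qed.

(* The transitions of the automaton, with the guards already evaluated at [v]. *)
Inductive trans (v : val) : Loc -> Lab -> {set 'I_3} -> Loc -> Prop :=
| tr_h : gsat 0 [:: (cx, CEq, K0); (cg, CEq, K0)] v ->
    trans v (Pl true None None) Lh set0 (Pl false None None)
| tr_P s th d o : s ==> isSome o -> gsat 0 (mode_guard d) v -> trans v (Pl s th d) La [set cy] (Ul th o)
| tr_st th o sg : gsat 0 round_guard v ->
    trans v (Ul th o) (Lb sg (Some None)) [set cx] (Pl (o == Some sg) (Some (inl sg.1)) None)
| tr_ce th o sg j : gsat 0 round_guard v ->
    trans v (Ul th o) (Lb sg (Some (Some j))) [set cx] (Pl (o == Some sg) (Some (inr (j, sg.2 j))) None)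
| tr_carry th o sg g d : List.In (g, Some d) (check th sg) -> gsat 0 round_guard v -> gsat 0 g v ->
    trans v (Ul th o) (Lb sg None) [set cx] (Pl (o == Some sg) th d)
| tr_bad th o sg g : List.In (g, None) (check th sg) -> o != Some sg -> gsat 0 round_guard v -> gsat 0 g v ->
    trans v (Ul th o) (Lb sg None) [set cx] (Pl false th None)
| tr_z th g : List.In g (zcheck th) -> gsat 0 end_guard v -> gsat 0 g v ->
    trans v (Ul th None) Lz set0 (Pl false th None)
| tr_w j a : j < size w -> a != Some (inl (nth false w j)) -> gsat 0 end_guard v ->
    gsat j [:: (cy, CEq, KOj)] v ->
    trans v (Ul (Some (inr (ord0, a))) None) Lz set0 (Pl false (Some (inr (ord0, a))) None).

Lemma InP (T : eqType) (x : T) (l : seq T) : List.In x l <-> x \in l.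
Proof.
elim: l => //= y l IH; rewrite inE; split=> [[->|/IH->]|/orP[/eqP->|/IH]]; rewrite ?eqxx ?orbT //; auto.
Qed.

Lemma In_cat (T : Type) (l1 l2 : seq T) x : List.In x (l1 ++ l2) <-> List.In x l1 \/ List.In x l2.
Proof. exact: List.in_app_iff. Qed.

Lemma In_flatten_map (T U : Type) (f : T -> seq U) l y :
  List.In y (flatten (map f l)) <-> exists2 x, List.In x l & List.In y (f x).
Proof.
elim: l => /= [|x l IH]; first by split=> // -[].
rewrite In_cat; split.
  case=> [h|/IH[z hz hy]]; first by exists x => //; left.
  by exists z => //; right.
case=> z [<-|hz] hy; first by left.
by right; apply/IH; exists z.
Qed.

Lemma In_map (T U : Type) (f : T -> U) l y : List.In y (map f l) <-> exists2 x, List.In x l & y = f x.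
Proof.
elim: l => /= [|x l IH]; first by split=> // -[].
split=> [[<-|/IH[z hz ->]]|[z [<-|hz] e]].
- by exists x => //; left.
- by exists z => //; right.
- by left.
- by right; apply/IH; exists z.
Qed.

Lemma edge_trans e v : List.In e red_edges -> sat (eguard e) v ->
  exists l a l', [/\ esrc e = enum_rank l, elabel e = Some (enum_rank a), etgt e = enum_rank l'
    & trans v l a (ereset e) l'].
Proof.
case/In_cat.
  case/In_map => se + -> /=; rewrite /edges_fix => /= -[<-|].
    by move=> h; do 3!eexists; split=> //; apply: tr_h.
  rewrite !In_cat => -[|[|[|[|]]]].
  - case/In_map => -[[b [th d]] o] /In_filter[_ /= hb] -> /= h.
    by do 3!eexists; split=> //; apply: tr_P.
  - case/In_map => -[[th o] sg] _ -> /= h.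
    by do 3!eexists; split=> //; apply: tr_st.
  - case/In_map => -[[[th o] sg] j] _ -> /= h.
    by do 3!eexists; split=> //; apply: tr_ce.
  - case/In_flatten_map => -[[th o] sg] _ /= /In_map[[g r] /In_filter[hin /= hr] -> /=].
    move=> h; have : gsat 0 (round_guard ++ g) v by exact: h.
    rewrite gsat_cat => /andP[h1 h2].
    case: r hin hr => [d|] hin hr; do 3!eexists; split=> //.
      exact: (@tr_carry v th o sg g d).
    exact: (@tr_bad v th o sg g).
  - case/In_flatten_map => th _ /In_map[g hin -> /=].
    move=> h; have : gsat 0 (end_guard ++ g) v by exact: h.
    rewrite gsat_cat => /andP[h1 h2].
    by do 3!eexists; split=> //; apply: tr_z h2.
case/In_flatten_map => j /InP; rewrite mem_iota add0n => /= hj /In_map[se + ->].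
case/In_map => a /In_filter[_ ha] -> /= h.
have : gsat j (end_guard ++ [:: (cy, CEq, KOj)]) v by [].
rewrite gsat_cat => /andP[h1 h2].
by do 3!eexists; split=> //; apply: (tr_w hj).
Qed.

Lemma trans_edge v l a r l' : trans v l a r l' ->
  exists2 e, List.In e red_edges &
    [/\ esrc e = enum_rank l, elabel e = Some (enum_rank a), etgt e = enum_rank l', ereset e = r
      & sat (eguard e) v].
Proof.
have fx se : List.In se edges_fix -> gsat 0 (sgrd se) v -> exists2 e, List.In e red_edges &
    [/\ esrc e = enum_rank (ssrc se), elabel e = Some (enum_rank (slab se)),
        etgt e = enum_rank (stgt se), ereset e = srst se & sat (eguard e) v].
  move=> hin hg; exists (inst_edge 0 se); last by split.
  by apply/In_cat; left; apply/In_map; exists se.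
have en (T : finType) (x : T) : List.In x (enum T) by apply/InP; rewrite mem_enum.
have sub se : List.In se edges_P \/ List.In se edges_st \/ List.In se edges_ce \/
    List.In se edges_check \/ List.In se edges_z -> List.In se edges_fix.
  by move=> h; right; rewrite !In_cat.
case=> {l a r l'}.
- by move=> h; apply: (fx edge_h) => //; left.
- move=> s th d o hs h.
  apply: (fx (SEdge (Pl s th d) (mode_guard d) La [set cy] (Ul th o))) => //.
  apply: sub; left; apply/In_map; exists ((s, (th, d)), o) => //.
  by apply/In_filter; split.
- move=> th o sg h; apply: (fx (SEdge (Ul th o) round_guard (Lb sg (Some None)) [set cx] _)) => //.
  by apply: sub; right; left; apply/In_map; exists ((th, o), sg).
- move=> th o sg j h; apply: (fx (SEdge (Ul th o) round_guard (Lb sg (Some (Some j))) [set cx] _)) => //.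
  by apply: sub; do 2!right; left; apply/In_map; exists (((th, o), sg), j).
- move=> th o sg g d hin h1 h2.
  apply: (fx (SEdge (Ul th o) (round_guard ++ g) (Lb sg None) [set cx] (Pl (o == Some sg) th d))).
    apply: sub; do 3!right; left; apply/In_flatten_map; exists ((th, o), sg) => //.
    by apply/In_map; exists (g, Some d) => //; apply/In_filter; split.
  by suff : gsat 0 (round_guard ++ g) v by []; rewrite gsat_cat h1.
- move=> th o sg g hin ho h1 h2.
  apply: (fx (SEdge (Ul th o) (round_guard ++ g) (Lb sg None) [set cx] (Pl false th None))).
    apply: sub; do 3!right; left; apply/In_flatten_map; exists ((th, o), sg) => //.
    by apply/In_map; exists (g, None) => //; apply/In_filter; split.
  by suff : gsat 0 (round_guard ++ g) v by []; rewrite gsat_cat h1.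
- move=> th g hin h1 h2; apply: (fx (zedge th g)); last first.
    by suff : gsat 0 (end_guard ++ g) v by []; rewrite gsat_cat h1.
  by apply: sub; do 4!right; apply/In_flatten_map; exists th => //; apply/In_map; exists g.
- move=> j a hj ha h1 h2; set se := zedge (Some (inr (ord0, a))) [:: (cy, CEq, KOj)].
  exists (inst_edge j se); last first.
    split=> //; rewrite -[sat _ v]/(gsat j (end_guard ++ [:: (cy, CEq, KOj)]) v) gsat_cat h2 andbT.
    exact: h1.
  apply/In_cat; right; apply/In_flatten_map; exists j; first by apply/InP; rewrite mem_iota.
  apply/In_map; exists se => //; apply/In_map; exists a => //; apply/In_filter; split=> //.
Qed.

Notation H := [set enum_rank Lh].
Notation sd := (side red_ta H).
Notation stt := ('I_#|{: Loc}| * val)%type.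

Lemma act_inv h a (s s' : stt) : discrete_step (sd h) (Some a) s s' ->
  exists l b r l', [/\ s.1 = enum_rank l, a = enum_rank b, b != Lh, trans s.2 l b r l'
    & s' = (enum_rank l', val_reset s.2 r)].
Proof.
case/side_act => e ein /andP[/andP[/eqP he ha] /edge_stepP[h1 h2 h3 h4 _]].
have [l [b [l' [e1 e2 e3 ht]]]] := edge_trans ein h3.
exists l, b, (ereset e), l'; split=> //; first by rewrite -h1.
- by move: he; rewrite e2 => -[].
- move: ha; rewrite inE; move: he; rewrite e2 => -[<-].
  by apply: contra => /eqP->.
- by rewrite -h4 -e3 h2; case: (s').
Qed.

Lemma act_intro h l b r l' v : b != Lh -> trans v l b r l' ->
  discrete_step (sd h) (Some (enum_rank b)) (enum_rank l, v) (enum_rank l', val_reset v r).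
Proof.
move=> hb /trans_edge[e ein [e1 e2 e3 e4 e5]]; apply/side_act; exists e => //.
apply/andP; split; last by apply/edge_stepP; split; rewrite ?e4 //= ffunE.
by rewrite /act_edge e2 eqxx inE (inj_eq enum_rank_inj).
Qed.

Lemma eps_inv h (s s' : stt) : discrete_step (sd h) None s s' ->
  h /\ exists l r l', [/\ s.1 = enum_rank l, trans s.2 l Lh r l' & s' = (enum_rank l', val_reset s.2 r)].
Proof.
case/side_eps => e ein /andP[he /edge_stepP[h1 h2 h3 h4 _]].
have [l [b [l' [e1 e2 e3 ht]]]] := edge_trans ein h3.
move: he; rewrite /eps_edge e2 inE (inj_eq enum_rank_inj) => /andP[-> /eqP eb]; split=> //.
rewrite eb in ht; exists l, (ereset e), l'; split=> //; first by rewrite -h1.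
by rewrite -h4 -e3 h2; case: (s').
Qed.

Lemma eps_intro l r l' v : trans v l Lh r l' ->
  discrete_step (sd true) None (enum_rank l, v) (enum_rank l', val_reset v r).
Proof.
move=> /trans_edge[e ein [e1 e2 e3 e4 e5]]; apply/side_eps; exists e => //.
apply/andP; split; last by apply/edge_stepP; split; rewrite ?e4 //= ffunE.
by rewrite /eps_edge e2 inE eqxx.
Qed.

Lemma delay_intro h d (s : stt) : delay_step (sd h) d s (s.1, val_delay s.2 d).
Proof. by apply/side_delay; split=> //=; rewrite ffunE. Qed.

Lemma restrict_eps (s s' : stt) : eps_steps (T := ta_tts R (sd false)) s s' -> s' = s.
Proof.
elim=> [x y h|//|x y z _ -> _ -> //].
by have [] := eps_inv (h := false) h.
Qed.

(** * Clock values during a round *)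

Implicit Types v : val.
Local Notation V c v := ((v c)%:num%R).

(** Going back from time [Tn] to [t], a position moves at most [Tn - t] away from [On]. As
    [On = 2 * Tn] and [Pn = 4 * Tn], it stays between [Tn] and [3 * Tn], strictly inside a round. *)
Definition bnd t k := [&& t <= Tn, On <= k + (Tn - t) & k <= On + (Tn - t)].

(** Here [e] is the time since the round began: [cx] shows it, [cg] is ahead by the completed rounds
    and [cy] by the old position [k0]. The index [k] is the position that the pending reset is going
    to produce. *)
Definition invP t k (d : mode) (v : val) : Prop :=
  exists e : R, [/\ (0 <= e)%R, V cx v = e, V cg v = (((Tn - t) * Pn)%:R + e)%R
    & match d with
      | None => k = On
      | Some d0 => exists2 k0 : nat, 0 < k0 /\ k = msh d0 k0 & V cy v = (k0%:R + e)%R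
      end].

(** Now [e] is the time since [cy] was reset, which happened when [cx] showed [Pn - k]. *)
Definition invU t k (v : val) : Prop :=
  exists e : R, [/\ (0 <= e)%R, V cy v = e, V cx v = ((Pn - k)%:R + e)%R
    & V cg v = (((Tn - t) * Pn + (Pn - k))%:R + e)%R].

Lemma invP_delay t k d v dl : invP t k d v -> invP t k d (val_delay v dl).
Proof.
case=> e [e0 ex eg hd]; exists (e + dl%:num)%R; split.
- by rewrite addr_ge0.
- by rewrite ffunE /= ex.
- by rewrite ffunE /= eg addrA.
- by case: d hd => // d0 [k0 h1 h2]; exists k0 => //; rewrite ffunE /= h2 addrA.
Qed.

Lemma invU_delay t k v dl : invU t k v -> invU t k (val_delay v dl).
Proof.
case=> e [e0 ex ey eg]; exists (e + dl%:num)%R; split; rewrite ?addr_ge0 // ffunE /= ?ex ?ey ?eg ?addrA //.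
Qed.

Lemma bnd_k t k : bnd t k -> Tn <= k <= 3 * Tn.
Proof. by case/and3P=> h1 h2 h3; move: h2 h3; rewrite OnE; lia. Qed.

Lemma natP : (Pn%:R = 4 * Tn%:R :> R)%R. Proof. by rewrite PnE natrM. Qed.
Lemma natO : (On%:R = 2 * Tn%:R :> R)%R. Proof. by rewrite OnE natrM. Qed.

Lemma natPk t k : bnd t k -> ((Pn - k)%:R = Pn%:R - k%:R :> R)%R.
Proof. by move/bnd_k => h; rewrite natrB // PnE; lia. Qed.

Lemma inv_PU t k d v : bnd t k -> invP t k d v -> gsat 0 (mode_guard d) v -> invU t k (val_reset v [set cy]).
Proof.
move=> hb [e [e0 ex eg hd]] hg; exists 0%R; rewrite !ffunE !inE /=.
have hPk := natPk hb; have T1 := Tn_gt1.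
suff ee : e = (Pn - k)%:R%R by split; rewrite ?addr0 // ?ex ?eg ee ?natrD.
move: hg; rewrite hPk /gsat /=; case: d hd => [[[]|]|] /=; rewrite andbT => hd /eqP.
- case: hd => k0 [k0p ->] -> h; rewrite natrB in h; last by rewrite expn_gt0.
  by rewrite -natr1; lra.
- case: hd => k0 [k0p ->] -> h; rewrite natrD in h.
  by case: k0 k0p h => // k0 _; rewrite -natr1 /=; lra.
- by case: hd => k0 [k0p ->] -> h; lra.
- by rewrite hd ex natP natO => ->; lra.
Qed.

Lemma U_at t k v : bnd t k -> invU t k v -> V cx v = Pn%:R%R ->
  V cy v = k%:R%R /\ V cg v = ((Tn - t).+1 * Pn)%:R%R.
Proof.
move=> hb [e [e0 ey ex eg]] h; have hPk := natPk hb; rewrite ex hPk in h.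
have ek : e = k%:R%R by lra.
by split; rewrite ?ey ?eg ek // natrD hPk mulSn natrD; lra.
Qed.

Lemma round_at t k v : bnd t k -> invU t k v -> gsat 0 round_guard v ->
  [/\ 0 < t, V cx v = Pn%:R%R, V cy v = k%:R%R & V cg v = ((Tn - t).+1 * Pn)%:R%R].
Proof.
move=> hb hU; rewrite /gsat /= andbT => /andP[/eqP hx hg].
have [hy hg'] := U_at hb hU hx; split=> //.
move: hg; rewrite hg' ltr_nat ltn_pmul2r ?expn_gt0 //.
by case/and3P: hb; lia.
Qed.

Lemma end_at t k v : bnd t k -> invU t k v -> gsat 0 end_guard v -> t = 0 /\ V cy v = k%:R%R.
Proof.
move=> hb hU; rewrite /gsat /= andbT => /andP[/eqP hx /eqP hg].
have [hy hg'] := U_at hb hU hx; split=> //.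
move/eqP: hg; rewrite hg' eqr_nat eqn_pmul2r ?expn_gt0 // => /eqP.
by case/and3P: hb; lia.
Qed.

Lemma inv_UP t k v d k' : bnd t.+1 k -> V cy v = k%:R%R -> V cg v = ((Tn - t.+1).+1 * Pn)%:R%R ->
  match d with None => k' = On | Some d0 => k' = msh d0 k end ->
  bnd t k' /\ invP t k' d (val_reset v [set cx]).
Proof.
move=> hb hy hg hd; have hk := bnd_k hb; have T1 := Tn_gt1.
case/and3P: (hb) => b1 b2 b3; split.
  rewrite /bnd; case: d hd => [[[]|]|] /= ->; lia.
exists 0%R; rewrite !ffunE !inE /= hy hg; split=> //.
- by rewrite addr0; congr (_ * _)%:R%R; lia.
- by case: d hd => // d0 ->; exists k; rewrite ?addr0 //; split=> //; lia.
Qed.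

Lemma kmv_cmp k mv v : 0 < k -> V cy v = k%:R%R ->
  [/\ gsat 0 [:: (cy, CEq, kmv mv)] v = (sh mv k == On),
      gsat 0 [:: (cy, CLt, kmv mv)] v -> sh mv k != On,
      gsat 0 [:: (cy, CGt, kmv mv)] v -> sh mv k != On
    & sh mv k != On -> gsat 0 [:: (cy, CLt, kmv mv)] v \/ gsat 0 [:: (cy, CGt, kmv mv)] v].
Proof.
move=> k0 hy; rewrite /gsat /= !andbT hy eqr_nat !ltr_nat.
have O1 : 0 < On by rewrite expn_gt0.
by case: mv => /=; split; lia.
Qed.

Lemma msh_mode mv k : match mode_of mv with Some d0 => msh d0 k | None => 0 end = sh mv k.
Proof. by case: mv. Qed.

(** With the true view, a claim on the scanned cell is compared with what was written there, and any
    other cell is inherited unchanged at its shifted position. So a true claim is never refuted and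
    what is carried is true. *)
Lemma check_sound t k th v g r : 0 < k -> V cy v = k%:R%R -> holds t.+1 k th ->
  List.In (g, r) (check th (vw (conf t))) -> gsat 0 g v ->
  exists2 d0, r = Some (Some d0) & holds t (msh d0 k) th.
Proof.
move=> k0 hy; have O1 : 0 < On by rewrite expn_gt0.
case: th => [[q|[j a]]|] /=.
- by rewrite step_state => ->; rewrite eqxx.
- rewrite step_cell //; case: (vstep _).2 => b mv /=.
  have [h1 h2 h3 h4] := kmv_cmp mv k0 hy; move=> ha.
  have car : sh mv k != On -> exists2 d0, Some (mode_of mv) = Some (Some d0) &
      cellat On (ctapes (conf t) j) (msh d0 k) = a.
    move=> hn; rewrite (negbTE hn) in ha; rewrite -msh_mode in ha.
    by case: mv {h1 h2 h3 h4 hn} ha => ha; [exists (Some false)|exists None|exists (Some true)].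
  case=> [[<- <-] /h2/car //|[[<- <-] /h3/car //|]].
  case: eqP => // ne [[<- _]|//]; rewrite h1 => e; rewrite e in ha.
  by case: ne.
- by rewrite step_state => ->.
Qed.

(** Dually, a false claim disagrees with what the true view produces and is refuted, or concerns a
    cell that was not written and was false already one step earlier. *)
Lemma check_complete t k th v : 0 < k -> V cy v = k%:R%R -> ~ holds t.+1 k th ->
  exists g r, [/\ List.In (g, r) (check th (vw (conf t))), gsat 0 g v
    & r = None \/ exists2 d0, r = Some (Some d0) & ~ holds t (msh d0 k) th].
Proof.
move=> k0 hy; have O1 : 0 < On by rewrite expn_gt0.
case: th => [[q|[j a]]|] /=.
- rewrite step_state => /eqP/negbTE ->; exists [::], None; split=> //; by left.
- rewrite step_cell //; case: (vstep _).2 => b mv /=.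
  have [h1 h2 h3 h4] := kmv_cmp mv k0 hy; case: ifP => hs ha.
    exists [:: (cy, CEq, kmv mv)], None; split; [|by rewrite h1|by left].
    by right; right; case: eqP => [e|_]; [case: ha|left].
  have car : exists2 d0, Some (mode_of mv) = Some (Some d0) &
      cellat On (ctapes (conf t) j) (msh d0 k) <> a.
    by rewrite -msh_mode in ha; case: mv {h1 h2 h3 h4 hs} ha => ha; [exists (Some false)|exists None|exists (Some true)].
  have [g|g] := h4 (negbT hs).
    by exists [:: (cy, CLt, kmv mv)], (Some (mode_of mv)); split=> //; [left|right].
  by exists [:: (cy, CGt, kmv mv)], (Some (mode_of mv)); split=> //; [right; left|right].
- rewrite step_state => /negP/negbTE ->; exists [::], None; split=> //; by left.
Qed.

Lemma cell_init (j : Jt) k : cellat On (ctapes (conf 0) j) k =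
  if (j == ord0) && (On <= k < On + size w) then Some (inl (nth false w (k - On))) else None.
Proof.
rewrite /conf /tm_run /= ffunE /cellat; case: (j == ord0) => /=; last by case: ifP; rewrite nth_nil.
case: ltnP => h /=; first by rewrite nth_nil.
case: ltnP => h2; first by rewrite (nth_map false) //; lia.
by rewrite nth_default // size_map; lia.
Qed.

Lemma cy_eq j k v : V cy v = k%:R%R -> gsat j [:: (cy, CEq, KOj)] v = (k == On + j).
Proof. by move=> hy; rewrite /gsat /= andbT hy eqr_nat. Qed.

Lemma z_sound k th v : V cy v = k%:R%R -> holds 0 k th ->
  (forall g, List.In g (zcheck th) -> gsat 0 g v -> False) /\
  forall j a, th = Some (inr (ord0, a)) -> j < size w -> a != Some (inl (nth false w j)) ->
    gsat j [:: (cy, CEq, KOj)] v -> False.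
Proof.
move=> hy; case: th => [[q|[j a]]|] //=; first by move=> <-; rewrite eqxx.
rewrite cell_init => ha; split.
  move=> g; case: eqP => // na; case: eqP ha => /= [_|_ e]; last by case: na.
  case: ifP => hk ea; last by case: na.
  case=> [<-|[<-|//]]; rewrite /gsat /= andbT hy.
    by rewrite ltr_nat; lia.
  by rewrite ler_nat; lia.
move=> i b [e1 e2] hi; rewrite -e2 -ha e1 eqxx /= => nb; rewrite (cy_eq _ hy) => /eqP ek.
by move: nb; rewrite ek addKn; case: ifP => [_|]; rewrite ?eqxx //; lia.
Qed.

Lemma z_complete k th v : V cy v = k%:R%R -> th <> None -> ~ holds 0 k th ->
  (exists2 g, List.In g (zcheck th) & gsat 0 g v) \/
  exists j a, [/\ th = Some (inr (ord0, a)), j < size w, a != Some (inl (nth false w j))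
    & gsat j [:: (cy, CEq, KOj)] v].
Proof.
move=> hy; case: th => [[q|[j a]]|] //= _.
  by move/eqP; rewrite eq_sym => /negbTE ->; left; exists [::] => //; left.
rewrite cell_init => ha.
case: (boolP ((j == ord0) && (On <= k < On + size w))) ha => [/andP[/eqP -> hk] ha|hn ha].
  right; exists (k - On), a; split=> //; first by lia.
    by apply/eqP => e; apply: ha.
  by rewrite (cy_eq _ hy); lia.
left; have -> : (a == None) = false by apply/eqP => e; apply: ha.
move: hn; case: eqP => /= [_ hk|_ _]; last by exists [::] => //; left.
case: (ltnP k On) => h.
  by exists [:: (cy, CLt, KO)]; [left|rewrite /gsat /= andbT hy ltr_nat].
by exists [:: (cy, CGe, KOn)]; [right; left|rewrite /gsat /= andbT hy ler_nat; lia].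
Qed.

(** * The bisimulation for an accepting run *)

Inductive BR : stt -> stt -> Prop :=
| BR_eq s : BR s s
| BR_P th d v t k : bnd t k -> invP t k d v -> holds t k th -> (th = None -> 0 < t) ->
    BR (enum_rank (Pl true th d), v) (enum_rank (Pl false th d), v)
| BR_U th sg v t k : bnd t k -> invU t k v -> holds t k th -> (th = None -> 0 < t) ->
    (forall t', t = t'.+1 -> sg = vw (conf t')) ->
    BR (enum_rank (Ul th (Some sg)), v) (enum_rank (Ul th None), v).

(** If the obligation is lost the two sides coincide, so only [s = true] calls for a true claim. *)
Lemma BR_pair (s : bool) th d v :
  (s -> exists t k, [/\ bnd t k, invP t k d v, holds t k th & th = None -> 0 < t]) ->
  BR (enum_rank (Pl s th d), v) (enum_rank (Pl false th d), v).
Proof.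
case: s => [/(_ isT)[t [k [h1 h2 h3 h4]]]|_]; last exact: BR_eq.
exact: BR_P h1 h2 h3 h4.
Qed.

Lemma next_st (th : claim) (sg : view) (v : val) (t k : nat) (hb : bnd t k) (hU : invU t k v)
  (hh : holds t k th) (hsg : forall t', t = t'.+1 -> sg = vw (conf t')) sg0 : gsat 0 round_guard v -> Some sg == Some sg0 ->
  exists t' k', [/\ bnd t' k', invP t' k' None (val_reset v [set cx]), holds t' k' (Some (inl sg0.1))
    & Some (inl sg0.1) = None :> claim -> 0 < t'].
Proof.
move=> hg /eqP[<-]; have [t0 _ hy hG] := round_at hb hU hg.
case: (t) t0 hb hG hsg => // t' _ hb' hG hsg'.
have [b' i'] := inv_UP (d := None) hb' hy hG erefl.
by exists t', On; split=> //=; rewrite (hsg' _ erefl).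
Qed.

Lemma next_ce (th : claim) (sg : view) (v : val) (t k : nat) (hb : bnd t k) (hU : invU t k v)
  (hh : holds t k th) (hsg : forall t', t = t'.+1 -> sg = vw (conf t')) sg0 j : gsat 0 round_guard v -> Some sg == Some sg0 ->
  exists t' k', [/\ bnd t' k', invP t' k' None (val_reset v [set cx]),
    holds t' k' (Some (inr (j, sg0.2 j))) & Some (inr (j, sg0.2 j)) = None :> claim -> 0 < t'].
Proof.
move=> hg /eqP[<-]; have [t0 _ hy hG] := round_at hb hU hg.
case: (t) t0 hb hG hsg => // t' _ hb' hG hsg'.
have [b' i'] := inv_UP (d := None) hb' hy hG erefl.
by exists t', On; split=> //=; rewrite (hsg' _ erefl) cellat_head ffunE.
Qed.

Lemma next_check (th : claim) (sg : view) (v : val) (t k : nat) (hb : bnd t k) (hU : invU t k v)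
  (hh : holds t k th) (hsg : forall t', t = t'.+1 -> sg = vw (conf t')) sg0 g r : List.In (g, r) (check th sg0) -> gsat 0 round_guard v -> gsat 0 g v ->
  Some sg == Some sg0 -> exists d, r = Some d /\
  exists t' k', [/\ bnd t' k', invP t' k' d (val_reset v [set cx]), holds t' k' th & th = None -> 0 < t'].
Proof.
move=> hin hg hg2 /eqP[e]; rewrite -e in hin; have [t0 _ hy hG] := round_at hb hU hg.
case: (t) t0 hb hG hsg hh => // t' _ hb' hG hsg' hh'.
have k0 : 0 < k by have := bnd_k hb'; have := Tn_gt1; lia.
rewrite (hsg' _ erefl) in hin.
have [d0 er hd] := check_sound k0 hy hh' hin hg2; exists (Some d0); split=> //.
have [b' i'] := inv_UP (d := Some d0) hb' hy hG erefl.
exists t', (msh d0 k); split=> // eth; move: hin; rewrite eth er /=; case: ifP => // _ [[]|] //.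
Qed.

(** Final edges are the ones that the announcing side cannot answer; a true claim about the initial
    configuration disables their guards. *)
Lemma no_z (th : claim) (sg : view) (v : val) (t k : nat) (hb : bnd t k) (hU : invU t k v)
  (hh : holds t k th) (hsg : forall t', t = t'.+1 -> sg = vw (conf t')) b r l : trans v (Ul th None) b r l -> b <> Lz.
Proof.
move El : (Ul th None) => l0 ht; case: ht El => {l0 b r l} //.
- move=> th0 g hin he hg [e]; rewrite -e in hin; have [t0 hy] := end_at hb hU he.
  by rewrite t0 in hh; have [h1 _] := z_sound hy hh; case: (h1 _ hin hg).
- move=> j a hj ha he hg [e]; have [t0 hy] := end_at hb hU he.
  by rewrite t0 in hh; have [_ h1] := z_sound hy hh; case: (h1 _ _ e hj ha hg).
Qed.

Lemma U_fwd (th : claim) (sg : view) (v : val) (t k : nat) (hb : bnd t k) (hU : invU t k v)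
  (hh : holds t k th) (hsg : forall t', t = t'.+1 -> sg = vw (conf t')) b r l : trans v (Ul th None) b r l -> exists2 l2, trans v (Ul th (Some sg)) b r l2 &
  BR (enum_rank l2, val_reset v r) (enum_rank l, val_reset v r).
Proof.
move=> ht; have nz := no_z hb hU hh hsg ht; move: ht nz.
move El : (Ul th None) => l0 ht; case: ht El => {l0 b r l} //.
- move=> th0 o sg0 hg [e1 e2] _; subst th0 o; exists (Pl (Some sg == Some sg0) (Some (inl sg0.1)) None).
    exact: tr_st.
  by apply: BR_pair => hs; apply: (next_st hb hU hh hsg).
- move=> th0 o sg0 j hg [e1 e2] _; subst th0 o.
  exists (Pl (Some sg == Some sg0) (Some (inr (j, sg0.2 j))) None); first exact: tr_ce.
  by apply: BR_pair => hs; apply: (next_ce hb hU hh hsg).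
- move=> th0 o sg0 g d hin hg hg2 [e1 e2] _; subst th0 o.
  exists (Pl (Some sg == Some sg0) th d); first exact: tr_carry hin _ _.
  by apply: BR_pair => hs; have [d' [[<-] h]] := next_check hb hU hh hsg hin hg hg2 hs.
- move=> th0 o sg0 g hin ho hg hg2 [e1 e2] _; subst th0 o.
  (* The announced view is the true one and cannot refute a true claim. So another view was named,
     and both sides meet in the same location. *)
  case: (boolP (Some sg == Some sg0)) => hs; first by have [d' []] := next_check hb hU hh hsg hin hg hg2 hs.
  by exists (Pl false th None); [apply: tr_bad hin _ _ _|apply: BR_eq].
Qed.

Lemma U_bwd (th : claim) (sg : view) (v : val) (t k : nat) (hb : bnd t k) (hU : invU t k v)
  (hh : holds t k th) (hsg : forall t', t = t'.+1 -> sg = vw (conf t')) b r l : trans v (Ul th (Some sg)) b r l -> exists2 l2, trans v (Ul th None) b r l2 &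
  BR (enum_rank l, val_reset v r) (enum_rank l2, val_reset v r).
Proof.
move El : (Ul th (Some sg)) => l0 ht; case: ht El => {l0 b r l} //.
- move=> th0 o sg0 hg [e1 e2]; subst th0 o; exists (Pl (None == Some sg0) (Some (inl sg0.1)) None).
    exact: tr_st.
  by apply: BR_pair => hs; apply: (next_st hb hU hh hsg).
- move=> th0 o sg0 j hg [e1 e2]; subst th0 o.
  exists (Pl (None == Some sg0) (Some (inr (j, sg0.2 j))) None); first exact: tr_ce.
  by apply: BR_pair => hs; apply: (next_ce hb hU hh hsg).
- move=> th0 o sg0 g d hin hg hg2 [e1 e2]; subst th0 o.
  exists (Pl (None == Some sg0) th d); first exact: tr_carry hin _ _.
  by apply: BR_pair => hs; have [d' [[<-] h]] := next_check hb hU hh hsg hin hg hg2 hs.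
- move=> th0 o sg0 g hin ho hg hg2 [e1 e2]; subst th0 o.
  by exists (Pl false th None); [apply: tr_bad hin _ _ _|apply: BR_eq].
Qed.

Lemma weak_act h a (s s' : stt) : discrete_step (sd h) (Some a) s s' ->
  weak_step (T := ta_tts R (sd h)) (Act R a) s s'.
Proof. by move=> hs; exists s, s'; split=> //; apply: rt_refl. Qed.

Lemma weak_delay h d (s : stt) : weak_step (T := ta_tts R (sd h)) (Delay _ d) s (s.1, val_delay s.2 d).
Proof.
by exists s, (s.1, val_delay s.2 d); split; [apply: rt_refl|apply: delay_intro|apply: rt_refl].
Qed.

Lemma BR_delay s p d : BR s p -> BR (s.1, val_delay s.2 d) (p.1, val_delay p.2 d).
Proof.
case=> {s p} [s|th dd v t k h1 h2 h3 h4|th sg v t k h1 h2 h3 h4 h5] /=; first exact: BR_eq.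
  by apply: BR_P h1 _ h3 h4; apply: invP_delay.
by apply: BR_U h1 _ h3 h4 h5; apply: invU_delay.
Qed.

Lemma trans_P v s th d b r l : trans v (Pl s th d) b r l -> b != Lh ->
  exists2 o, [/\ b = La, r = [set cy], l = Ul th o & s ==> isSome o] & gsat 0 (mode_guard d) v.
Proof.
move El : (Pl s th d) => l0 ht; case: ht El => {l0 b r l} //.
by move=> s0 th0 d0 o hs hg [-> -> ->] _; exists o.
Qed.

Lemma inv_start v : gsat 0 [:: (cx, CEq, K0); (cg, CEq, K0)] v -> bnd Tn On /\ invP Tn On None v.
Proof.
rewrite /gsat /= andbT => /andP[/eqP hx /eqP hg]; split; first by rewrite /bnd leqnn subnn; lia.
by exists 0%R; split=> //; rewrite hg subnn mul0n addr0.
Qed.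

Lemma accept_bisimilar : tm_accept (cstate (conf Tn)) -> is_BSNNI R red_ta H.
Proof.
move=> acc; exists BR; split; apply: weak_simulation_of_steps; try exact: BR_eq.
- move=> s p a p' hR; case: a => [|a|d] /=.
  + case/(eps_inv (h := true)) => _ [l [r [l' [e1 ht ->]]]].
    exists s; split; first exact: rt_refl.
    move: ht; move Eb : Lh => b ht; case: ht Eb e1 => {b r l l'} // hg _.
    case: hR hg => {s p} [[q v]|th dd v t k h1 h2 h3 h4|th sg v t k h1 h2 h3 h4 h5] /= hg.
    (* The high edge is answered by staying put; the resulting pair contests the claim of
       acceptance, which is true at [Tn]. *)
    * move=> ->; rewrite val_reset0; have [b1 i1] := inv_start hg.
      exact: (@BR_P None None v Tn On b1 i1 acc (fun _ => ltnW Tn_gt1)).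
    * by move/enum_rank_inj.
    * by move/enum_rank_inj.
  + case/(act_inv (h := true)) => l [b [r [l' [e1 -> hb ht ->]]]].
    case: hR ht e1 => {s p} [[q v]|th dd v t k h1 h2 h3 h4|th sg v t k h1 h2 h3 h4 h5] /= ht.
    * move=> ->; exists (enum_rank l', val_reset v r); split; last exact: BR_eq.
      exact: (weak_act (act_intro false hb ht)).
    * move/enum_rank_inj => e; subst l; have [o [-> -> -> _] hg] := trans_P ht hb.
      case: o => [sg|].
        exists (enum_rank (Ul th (Some sg)), val_reset v [set cy]); split; last exact: BR_eq.
        exact: (weak_act (act_intro false (isT : La != Lh) (tr_P (s := true) (o := Some sg) th isT hg))).
      (* Against a withheld announcement the defender announces the true view one step earlier; the
         truncated predecessor also supplies a view at [t = 0], where [BR] puts no constraint on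
         it. *)
      exists (enum_rank (Ul th (Some (vw (conf t.-1)))), val_reset v [set cy]); split.
        exact: (weak_act (act_intro false (isT : La != Lh) (tr_P (s := true) (o := Some (vw (conf t.-1))) th isT hg))).
      by apply: (BR_U h1 (inv_PU h1 h2 hg) h3 h4) => t' ->.
    * move/enum_rank_inj => e; subst l; have [l2 ht2 hR2] := U_fwd h1 h2 h3 h5 ht.
      by exists (enum_rank l2, val_reset v r); split=> //; exact: (weak_act (act_intro false hb ht2)).
  + case/(side_delay red_ta H true) => -> _; exists (s.1, val_delay s.2 d); split; last exact: BR_delay.
    exact: (weak_delay false d s).
- move=> p s a s' hR; case: a => [|a|d] /=.
  + by case/(eps_inv (h := false)).
  + case/(act_inv (h := false)) => l [b [r [l' [e1 -> hb ht ->]]]].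
    case: hR ht e1 => {s p} [[q v]|th dd v t k h1 h2 h3 h4|th sg v t k h1 h2 h3 h4 h5] /= ht.
    * move=> ->; exists (enum_rank l', val_reset v r); split; last exact: BR_eq.
      exact: (weak_act (act_intro true hb ht)).
    * move/enum_rank_inj => e; subst l; have [o [-> -> -> ho] hg] := trans_P ht hb.
      exists (enum_rank (Ul th o), val_reset v [set cy]); split; last exact: BR_eq.
      exact: (weak_act (act_intro true (isT : La != Lh) (tr_P (s := false) (o := o) th isT hg))).
    * move/enum_rank_inj => e; subst l; have [l2 ht2 hR2] := U_bwd h1 h2 h3 h5 ht.
      by exists (enum_rank l2, val_reset v r); split=> //; exact: (weak_act (act_intro true hb ht2)).
  + case/(side_delay red_ta H false) => -> _; exists (p.1, val_delay p.2 d); split; last exact: BR_delay.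
    exact: (weak_delay true d p).
Qed.

Lemma restrict_act a (s s' : stt) : weak_step (T := ta_tts R (sd false)) (Act R a) s s' ->
  discrete_step (sd false) (Some a) s s'.
Proof. by case=> s1 [s2 [/restrict_eps -> h /restrict_eps ->]]. Qed.

Lemma restrict_delay d (s s' : stt) : weak_step (T := ta_tts R (sd false)) (Delay _ d) s s' ->
  s' = (s.1, val_delay s.2 d).
Proof. by case=> s1 [s2 [/restrict_eps -> [-> _] /restrict_eps ->]]. Qed.

Lemma mode_guard_at t k d v (dl : {nonneg R}) : bnd t k -> invP t k d v -> V cx v = 0%R ->
  dl%:num%R = (Pn - k)%:R%R -> gsat 0 (mode_guard d) (val_delay v dl).
Proof.
move=> hb [e [e0 ex eg hd]] x0 hdl; have hPk := natPk hb; have T1 := Tn_gt1.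
have ez : e = 0%R by rewrite -ex.
rewrite /gsat /=; case: d hd => [[[]|]|] /=; rewrite andbT ffunE /= hdl hPk.
- by case=> k0 [k0p ->] ->; rewrite natrB ?expn_gt0 // -natr1 ez; apply/eqP; lra.
- case=> k0 [k0p ->] ->; rewrite natrD ez; case: k0 k0p => // k0 _; rewrite -natr1 /=.
  by apply/eqP; lra.
- by case=> k0 [k0p ->] ->; rewrite ez; apply/eqP; lra.
- by move=> ->; rewrite x0 natP natO; apply/eqP; lra.
Qed.

(** Refuting and carrying edges share a label, but their guards exclude each other at an exact
    position: a refutation cannot be answered by carrying the claim on. *)
Lemma check_excl th sg g g' d v k : 0 < k -> V cy v = k%:R%R ->
  List.In (g, None) (check th sg) -> List.In (g', Some d) (check th sg) -> gsat 0 g v -> gsat 0 g' v -> False.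
Proof.
move=> k0 hy; case: th => [[q|[j a]]|] /=; try by case: ifP => _ // _ [[]|].
case: ((vstep sg).2 j) => b mv /=; have [h1 h2 h3 _] := kmv_cmp mv k0 hy.
case=> [[]//|[[]//|]]; case: eqP => // _ [[<-]|//].
case=> [[<- _]|[[<- _]|[[]//|//]]]; rewrite h1 => e; [move/h2|move/h3]; by rewrite e.
Qed.

(** The mode is dictated by the head move in the view, so the answer to a carried claim is
    forced. *)
Lemma check_mode th sg g g' d d' : List.In (g, Some d) (check th sg) ->
  List.In (g', Some d') (check th sg) -> d = d'.
Proof.
case: th => [[q|[j a]]|]; try by rewrite /=; case: ifP => _ // [[]|].
have E g0 d0 : List.In (g0, Some d0) (check (Some (inr (j, a))) sg) -> d0 = mode_of ((vstep sg).2 j).2.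
  rewrite /check; case: ((vstep sg).2 j) => b mv /=.
  by case=> [[_ <-]|[[_ <-]|]] //; case: eqP => //= _ [].
by move=> /E -> /E ->.
Qed.

(** * The attack for a rejecting run *)

Section Attack.
Variable Rel : stt -> stt -> Prop.
Hypothesis hRel : forall s p a p', Rel s p -> weak_step (T := ta_tts R (sd true)) a p p' ->
  exists s', weak_step (T := ta_tts R (sd false)) a s s' /\ Rel s' p'.

Lemma Rel_act s v p b r l : Rel s (enum_rank p, v) -> b != Lh -> trans v p b r l ->
  exists2 s', discrete_step (sd false) (Some (enum_rank b)) s s' & Rel s' (enum_rank l, val_reset v r).
Proof.
move=> hR hb ht; have [s' [/restrict_act h1 h2]] := hRel hR (weak_act (act_intro true hb ht)).
by exists s'.
Qed.

(** Delays of [Pn - k] and [k] make up a round, in which the attacker withholds the announcement and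
    the defender commits to a view [sg]. If [sg] is the true view, the false claim is refuted or
    inherited. If not, its state or one of its scanned cells is a false claim one step earlier. At
    [t = 0] a final edge ends the game. *)
Lemma attack t : forall th d k v, bnd t k -> invP t k d v -> V cx v = 0%R -> ~ holds t k th ->
  (th = None -> 0 < t) -> Rel (enum_rank (Pl true th d), v) (enum_rank (Pl false th d), v) -> False.
Proof.
elim: t => [|t IH] th d k v hb hP x0 nh good hR.
all: have k0 : 0 < k by have := bnd_k hb; have := Tn_gt1; lia.
all: pose d1 : {nonneg R} := NngNum (ler0n R (Pn - k)).
all: have [s1 [/restrict_delay /= -> hR1]] := hRel hR (weak_delay true d1 _); rewrite /= in hR1.
all: have hg1 := mode_guard_at (dl := d1) hb hP x0 erefl.
all: have hU := inv_PU hb (invP_delay d1 hP) hg1.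
all: have [s2 /(act_inv (h := false)) hs2 hR2] := Rel_act hR1 (isT : La != Lh) (tr_P (s := false) (o := None) th isT hg1).
all: case: hs2 => l1 [b1 [r1 [l2 [/enum_rank_inj el /enum_rank_inj eb hb1 ht es2]]]].
all: rewrite -el /= in ht; have [[sg|] [_ er el2 //] _] := trans_P ht hb1; move=> _.
all: rewrite es2 er el2 /= in hR2; clear l1 b1 r1 l2 el eb hb1 ht es2 er el2 s1 s2.
all: pose v2 := val_reset (val_delay v d1) [set cy]; rewrite -/v2 in hU hR2.
all: pose d2 : {nonneg R} := NngNum (ler0n R k).
all: have [s3 [/restrict_delay /= -> hR3]] := hRel hR2 (weak_delay true d2 _); rewrite /= in hR3.
all: pose v3 := val_delay v2 d2; rewrite -/v3 in hR3.
all: have hU3 : invU _ k v3 := invU_delay d2 hU.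
all: have hx3 : V cx v3 = Pn%:R%R by rewrite !ffunE !inE /= x0 (natPk hb); lra.
all: have [hy3 hg3] := U_at hb hU3 hx3.
- have he : gsat 0 end_guard v3 by rewrite /gsat /= hx3 hg3 subn0 !eqxx.
  have nt : th <> None by move=> e; have := good e.
  have [r [l ht]] : exists r l, trans v3 (Ul th None) Lz r l.
    case: (z_complete hy3 nt nh) => [[g h1 h2]|[j [a [e h1 h2 h3]]]].
      by do 2!eexists; apply: tr_z h1 he h2.
    by rewrite e; do 2!eexists; apply: tr_w h1 h2 he h3.
  (* The defender stands at an announced view, where no edge is labelled [Lz]. *)
  have [s4 hs4 _] := Rel_act hR3 (isT : Lz != Lh) ht.
  have [l1 [b1 [r1 [l2 [/= /enum_rank_inj el /enum_rank_inj eb _ ht' _]]]]] := act_inv hs4.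
  by move: el eb; case: ht'.
- have hr : gsat 0 round_guard v3.
    by rewrite /gsat /= hx3 hg3 eqxx ltr_nat ltn_pmul2r ?expn_gt0 //; case/and3P: hb; lia.
  (* The hypothesis on the edges of the defender says that the answer is forced; a false claim [th']
     at time [t] then contradicts the induction hypothesis. *)
  have next th' d' k' b : b = Lb sg None \/ (exists c, b = Lb sg (Some c)) ->
      trans v3 (Ul th None) b [set cx] (Pl false th' d') ->
      (forall r l, trans v3 (Ul th (Some sg)) b r l -> r = [set cx] /\ l = Pl true th' d') ->
      match d' with None => k' = On | Some d0 => k' = msh d0 k end ->
      ~ holds t k' th' -> (th' = None -> 0 < t) -> False.
    move=> hbb ht uq hk' nh' good'; have nb : b != Lh by case: hbb => [->|[c ->]].
    have [s4 hs4 hR4] := Rel_act hR3 nb ht.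
    have [l1 [b1 [r1 [l2 [/= /enum_rank_inj el /enum_rank_inj eb _ ht' es4]]]]] := act_inv hs4.
    rewrite -el -eb in ht'; have [er el2] := uq _ _ ht'.
    rewrite es4 er el2 /= in hR4.
    have [b' i'] := inv_UP hb hy3 hg3 hk'.
    by apply: (IH _ _ _ _ b' i' _ nh' good' hR4); rewrite ffunE inE.
  have badcase g : List.In (g, None) (check th sg) -> gsat 0 g v3 -> False.
    move=> hin hg; have ht := tr_bad (o := None) hin isT hr hg.
    have [s4 hs4 _] := Rel_act hR3 (isT : Lb sg None != Lh) ht.
    have [l1 [b1 [r1 [l2 [/= /enum_rank_inj el /enum_rank_inj eb _ ht' es4]]]]] := act_inv hs4.
    move: el eb; case: ht' => // [th0 o sg0 g' d' hin' _ hg' [e1 e2] [e3]|th0 o sg0 g' hin' ho _ hg' [e1 e2] [e3]]; subst th0 o sg0.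
      exact: (check_excl k0 hy3 hin hin' hg hg').
    by rewrite eqxx in ho.
  case: (eqVneq sg (vw (conf t))) => [e|ne].
    have [g [r [hin hg [er|[d0 er nh']]]]] := check_complete k0 hy3 nh.
      by rewrite er -e in hin; apply: badcase hin hg.
    rewrite er -e in hin.
    apply: (next th (Some d0) (msh d0 k) (Lb sg None)) => //; first by left.
    + exact: (tr_carry None hin hr hg).
    + move=> r' l'; move El : (Ul th (Some sg)) => l0; move Eb : (Lb sg None) => b ht.
      case: ht El Eb => // [th0 o sg0 g' d' hin' _ _ [e1 e2] [e3]|th0 o sg0 g' _ ho _ _ [e1 e2] [e3]]; subst th0 o sg0.
        by rewrite eqxx (check_mode hin hin').
      by rewrite eqxx in ho.
    + by move=> eth; move: hin; rewrite eth /=; case: ifP => _ // [[]|].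
  case: (eqVneq sg.1 (cstate (conf t))) => [e1|ne1].
    have [j hj] : exists j, sg.2 j != tape_read (ctapes (conf t) j).
      apply/existsP; apply: contra_neqT ne => /existsPn h.
      rewrite [sg]surjective_pairing /vw; congr pair => //.
      by apply/ffunP => j; rewrite ffunE; apply/eqP; have := h j; rewrite negbK.
    apply: (next (Some (inr (j, sg.2 j))) None On (Lb sg (Some (Some j)))) => //.
    + by right; exists (Some j).
    + exact: (tr_ce th None sg j hr).
    + move=> r' l'; move El : (Ul th (Some sg)) => l0; move Eb : (Lb sg _) => b ht.
      by case: ht El Eb => // th0 o sg0 j0 _ [_ <-] [<- <-]; rewrite eqxx.
    + by rewrite /= cellat_head => e; rewrite e eqxx in hj.
  apply: (next (Some (inl sg.1)) None On (Lb sg (Some None))) => //.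
  + by right; exists None.
  + exact: (tr_st th None sg hr).
  + move=> r' l'; move El : (Ul th (Some sg)) => l0; move Eb : (Lb sg _) => b ht.
    by case: ht El Eb => // th0 o sg0 _ [_ <-] [<-]; rewrite eqxx.
  + by move=> /= e; rewrite e eqxx in ne1.
Qed.

End Attack.

Lemma reject_not_CSNNI : ~ tm_accept (cstate (conf Tn)) -> ~ is_CSNNI R red_ta H.
Proof.
move=> rej [[Rel [h0 hs]] _].
have hg : gsat 0 [:: (cx, CEq, K0); (cg, CEq, K0)] (val0 R 'I_3) by rewrite /gsat /= !ffunE /= eqxx.
have ht := tr_h hg.
(* The restricted automaton has no silent step, so it answers the hidden high edge by staying in the
   initial state and has to defend the claim of acceptance. *)
have [s' [/(restrict_eps (s := _)) es hR]] := hs _ _ (Eps _ _) _ h0 (rt_step _ _ _ _ (eps_intro ht)).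
rewrite es val_reset0 in hR; have [b1 i1] := inv_start hg.
have x0 : V cx (val0 R 'I_3) = 0%R by rewrite ffunE.
refine (@attack Rel hs _ None None On _ b1 i1 x0 rej (fun _ => ltnW Tn_gt1) hR).
Qed.

End Semantics.
End Input.
End Reduction.

(** * Computing the reduction *)

Definition zero_ex : ex := Lt One One.

(** The empty word is the output of a loop with no rounds. *)
Fixpoint glit (s : seq bool) : gen :=
  if s is b :: s' then GCat (GEmit (if b then One else zero_ex)) (glit s') else GFor zero_ex (GEmit One).

Lemma glitE s c : gsem (glit s) c = s.
Proof. by elim: s => //= b s ->; case: b. Qed.

Definition encb (l : seq bool) : seq bool := flatten [seq [:: true; b] | b <- l].

Lemma encb_cat l1 l2 : encb (l1 ++ l2) = encb l1 ++ encb l2.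
Proof. by rewrite /encb map_cat flatten_cat. Qed.

Lemma enc_nat_bits l : (l == [::]) || last false l -> enc_nat (bits_val l) = encb l ++ [:: false].
Proof. by move=> h; rewrite /enc_nat nat_bits_val // /enc_seq /encb. Qed.

Lemma bits_val_cat l1 l2 : bits_val (l1 ++ l2) = bits_val l1 + 2 ^ size l1 * bits_val l2.
Proof. by elim: l1 => [|b l1 IH] /=; rewrite ?mul1n // IH expnS; lia. Qed.

Lemma bits_val_false k : bits_val (nseq k false) = 0.
Proof. by elim: k => //= k ->. Qed.

Lemma bits_val_true k : bits_val (nseq k true) = 2 ^ k - 1.
Proof. by elim: k => //= k ->; have := expn_gt0 2 k; rewrite expnS; lia. Qed.

Definition bit (v b : nat) : bool := odd (v %/ 2 ^ b).

Lemma bits_val_bit v k : v < 2 ^ k -> bits_val (mkseq (bit v) k) = v.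
Proof.
elim: k v => [|k IH] v hv; first by case: v hv.
rewrite /mkseq -add1n iotaD map_cat -[map _ (iota (0 + 1) k)]/(map (bit v) (iota (1 + 0) k)).
rewrite iotaDl -map_comp /= (_ : map _ _ = mkseq (bit (v %/ 2)) k); last first.
  by apply: eq_map => i /=; rewrite /bit -divnMA -expnS.
rewrite IH; last by rewrite ltn_divLR // mulnC -expnS.
by rewrite /bit divn1; lia.
Qed.

Lemma powc2 K i : 0 < K -> powc K 2 i = minn K (2 ^ i).
Proof.
move=> hK; case: (leqP (2 ^ i) K) => h; first by rewrite powcE.
elim: i h => [|i IH] h; first by rewrite expn0 in h; lia.
rewrite /powc /biter /= -/(biter _ _ _ _) -/(powc K 2 i).
case: (leqP (2 ^ i) K) => hi; last by rewrite IH //; lia.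
by rewrite powcE //; rewrite expnS in h; lia.
Qed.

(** Cutting [2 ^ b] off at [K > v] does not change the quotient, which is 0 in both cases. The bits
    of a position are thus computed without exponentially large values. *)
Lemma bit_powc v K b : v < K -> v %/ powc K 2 b %% 2 = bit v b :> nat.
Proof.
move=> h; rewrite powc2; last by lia.
rewrite modn2 /bit; case: (leqP K (2 ^ b)) => hb; last by [].
by rewrite !divn_small //; lia.
Qed.

(* Inside the loop over the bit index, the variables are: [0] that index,
   [1] the index of the enclosing loop, [2] the input position [j]. *)
Lemma bit_n_ex : exists x, forall c, eval x c = bit (size (cw c)) (cv c 0) :> nat.
Proof.
have [x hx] : Tm (fun c => size (cw c) %/ powc (size (cw c)).+1 2 (cv c 0) %% 2).
  by apply: T_mod; [apply: T_div; [exact: T_len|apply: T_powc; [apply: T_succ; exact: T_len|exact: T_cst|exact: T_var]]|exact: T_cst].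
by exists x => c; rewrite hx bit_powc.
Qed.

Lemma bit_j_ex : exists x, forall c, cv c 2 <= size (cw c) -> eval x c = bit (cv c 2) (cv c 0) :> nat.
Proof.
have [x hx] : Tm (fun c => cv c 2 %/ powc (size (cw c)).+1 2 (cv c 0) %% 2).
  by apply: T_mod; [apply: T_div; [exact: T_var|apply: T_powc; [apply: T_succ; exact: T_len|exact: T_cst|exact: T_var]]|exact: T_cst].
by exists x => c hc; rewrite hx bit_powc.
Qed.

Definition gbits (x : ex) (b : bool) : gen := GFor x (glit [:: true; b]).
Definition gvar (x y : ex) : gen := GFor x (GCat (glit [:: true]) (GEmit y)).

Lemma gbitsE x b c : gsem (gbits x b) c = encb (nseq (eval x c) b).
Proof.
have E (l : seq nat) : flatten [seq gsem (glit [:: true; b]) (vcons i c) | i <- l] = encb (nseq (size l) b).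
  by elim: l => //= i l ->; case: b.
by rewrite -[LHS]/(flatten [seq gsem (glit [:: true; b]) (vcons i c) | i <- iota 0 (eval x c)]) E size_iota.
Qed.

Lemma gvarE x y c (f : nat -> bool) : (forall i, eval y (vcons i c) = f i :> nat) ->
  gsem (gvar x y) c = encb (mkseq f (eval x c)).
Proof.
move=> hf; rewrite /= /encb /mkseq -map_comp; congr flatten; apply: eq_map => i /=.
by rewrite hf; case: (f i).
Qed.

Section Generator.
Variables (M : TM) (cc : nat).

Definition mm_ex (d : nat) : ex := Add (Add (pow_ex cc.+1) (cst_ex cc)) (cst_ex d).

Lemma mm_exE d c : eval (mm_ex d) c = mm cc (cw c) + d.
Proof.
by rewrite -[LHS]/(eval (pow_ex cc.+1) c + eval (cst_ex cc) c + eval (cst_ex d) c) eval_pow !eval_cst.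
Qed.

Definition one_bit : gen := glit [:: true; true].

(** The constants are exponential, so they are written bit by bit, lowest first. For instance
    [Pn - 1] is a block of ones, and [KG], which is [Pn + Tn * Pn], has exactly two ones. Adding
    [On] to [size w] or [j] only appends a top bit, as both are below [On]. *)
Definition gcst (xn xj : ex) (k : cst) : gen :=
  GCat (match k with
  | K0 => glit [::]
  | KO => GCat (gbits (mm_ex 2) false) one_bit
  | KOm => gbits (mm_ex 2) true
  | KOp => GCat one_bit (GCat (gbits (mm_ex 1) false) one_bit)
  | KP => GCat (gbits (mm_ex 3) false) one_bit
  | KPm => gbits (mm_ex 3) true
  | KPp => GCat one_bit (GCat (gbits (mm_ex 2) false) one_bit)
  | KG => GCat (GCat (gbits (mm_ex 3) false) one_bit) (GCat (gbits (mm_ex 0) false) one_bit)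
  | KOn => GCat (gvar (mm_ex 2) xn) one_bit
  | KOj => GCat (gvar (mm_ex 2) xj) one_bit
  end) (glit [:: false]).

Definition cst_bits (m n j : nat) (k : cst) : seq bool :=
  match k with
  | K0 => [::]
  | KO => nseq (m + 2) false ++ [:: true]
  | KOm => nseq (m + 2) true
  | KOp => [:: true] ++ nseq (m + 1) false ++ [:: true]
  | KP => nseq (m + 3) false ++ [:: true]
  | KPm => nseq (m + 3) true
  | KPp => [:: true] ++ nseq (m + 2) false ++ [:: true]
  | KG => (nseq (m + 3) false ++ [:: true]) ++ nseq (m + 0) false ++ [:: true]
  | KOn => mkseq (bit n) (m + 2) ++ [:: true]
  | KOj => mkseq (bit j) (m + 2) ++ [:: true]
  end.

Lemma cst_bitsE w j k : j <= size w ->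
  kval cc w j k = bits_val (cst_bits (mm cc w) (size w) j k).
Proof.
move=> hj; have hw := w_lt cc w; have e0 := expn_gt0 2 (mm cc w).
have hT : Tn cc w = 2 * 2 ^ mm cc w by rewrite /Tn expnS.
have hO : On cc w = 4 * 2 ^ mm cc w by rewrite OnE hT; lia.
have hP : Pn cc w = 8 * 2 ^ mm cc w by rewrite PnE hT; lia.
case: k => /=; rewrite ?(bits_val_cat, bits_val_false, bits_val_true, size_cat, size_nseq, size_mkseq) /=;
  rewrite ?(bits_val_cat, bits_val_false, size_nseq) ?hO ?hP ?hT ?expnD ?expn0 /=; try lia; try nia.
- by rewrite bits_val_bit; [lia|rewrite expnD; lia].
- by rewrite bits_val_bit; [lia|rewrite expnD; lia].
Qed.

Lemma gcstE xn xj k c : (forall c, eval xn c = bit (size (cw c)) (cv c 0) :> nat) ->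
  (forall c, cv c 2 <= size (cw c) -> eval xj c = bit (cv c 2) (cv c 0) :> nat) ->
  cv c 1 <= size (cw c) -> gsem (gcst xn xj k) c = enc_nat (kval cc (cw c) (cv c 1) k).
Proof.
move=> hn hj hc; rewrite (cst_bitsE k hc) enc_nat_bits; last first.
  have lt m : last true (nseq m true) by elim: m.
  by case: k; rewrite /cst_bits ?addn2 ?addn3 ?last_cat /= ?lt ?orbT.
rewrite -[gsem _ c]/(gsem _ c ++ [:: false]); congr (_ ++ _).
have gnE : gsem (gvar (mm_ex 2) xn) c = encb (mkseq (bit (size (cw c))) (mm cc (cw c) + 2)).
  by rewrite (@gvarE _ _ _ (bit (size (cw c)))) ?mm_exE // => i; rewrite hn.
have gjE : gsem (gvar (mm_ex 2) xj) c = encb (mkseq (bit (cv c 1)) (mm cc (cw c) + 2)).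
  by rewrite (@gvarE _ _ _ (bit (cv c 1))) ?mm_exE // => i; rewrite hj.
have catE g1 g2 : gsem (GCat g1 g2) c = gsem g1 c ++ gsem g2 c by [].
have oneE : gsem one_bit c = encb [:: true] by [].
by case: k; rewrite /cst_bits ?catE ?oneE ?gbitsE ?gnE ?gjE ?mm_exE ?encb_cat.
Qed.

Definition gcats (l : seq gen) : gen := foldr GCat (glit [::]) l.

Lemma gcatsE l c : gsem (gcats l) c = flatten [seq gsem g c | g <- l].
Proof. by elim: l => //= g l ->. Qed.

Variables xn xj : ex.
Hypothesis xnE : forall c, eval xn c = bit (size (cw c)) (cv c 0) :> nat.
Hypothesis xjE : forall c, cv c 2 <= size (cw c) -> eval xj c = bit (cv c 2) (cv c 0) :> nat.

Definition gatom (a : 'I_3 * cmp_op * cst) : gen :=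
  GCat (glit (true :: enc_nat a.1.1 ++ enc_cmp_op a.1.2)) (gcst xn xj a.2).

Definition gedge (e : sedge M) : gen :=
  GCat (glit (true :: enc_nat (enum_rank (ssrc e))))
  (GCat (gcats [seq gatom a | a <- sgrd e])
  (glit (false :: enc_label (Some (enum_rank (slab e))) ++ enc_set (srst e) ++
     enc_nat (enum_rank (stgt e))))).

Lemma enc_seqE (T : Type) (enc : T -> seq bool) s :
  enc_seq enc s = flatten [seq true :: enc x | x <- s] ++ [:: false].
Proof. by []. Qed.

Lemma gedgeE e c : cv c 1 <= size (cw c) ->
  gsem (gedge e) c = true :: enc_edge (inst_edge cc (cw c) (cv c 1) e).
Proof.
have catE g1 g2 : gsem (GCat g1 g2) c = gsem g1 c ++ gsem g2 c by [].
move=> hc; rewrite /gedge !catE !glitE gcatsE.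
rewrite -[RHS]/(true :: enc_nat (enum_rank (ssrc e)) ++
  enc_seq (@enc_atom 3) [seq Atom a.1.1 a.1.2 (kval cc (cw c) (cv c 1) a.2) | a <- sgrd e] ++
  enc_label (Some (enum_rank (slab e))) ++ enc_set (srst e) ++ enc_nat (enum_rank (stgt e))).
suff F l : flatten [seq gsem g c | g <- [seq gatom a | a <- l]] = flatten [seq true :: enc_atom x
    | x <- [seq Atom a.1.1 a.1.2 (kval cc (cw c) (cv c 1) a.2) | a <- l]].
  by rewrite enc_seqE F cat_cons -!catA.
elim: l => // a l IH.
rewrite -[LHS]/(gsem (gatom a) c ++ flatten [seq gsem g c | g <- [seq gatom a | a <- l]]) IH.
by rewrite /gatom catE glitE (gcstE _ xnE xjE hc) /= -!catA.
Qed.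

Definition gedges (es : seq (sedge M)) : gen := gcats [seq gedge e | e <- es].

Lemma gedgesE es c : cv c 1 <= size (cw c) ->
  gsem (gedges es) c = flatten [seq true :: enc_edge (inst_edge cc (cw c) (cv c 1) e) | e <- es].
Proof.
by move=> hc; rewrite gcatsE -map_comp; congr flatten; apply: eq_map => e /=; apply: gedgeE.
Qed.

(* The one-step inner loops act as tests and shift the position into variable [1]. *)
Definition ginput : gen :=
  GFor Len (GCat (GFor (Inp (Var 0)) (gedges (edges_inp M true)))
                 (GFor (Lt (Inp (Var 0)) One) (gedges (edges_inp M false)))).

Lemma ginputE c : gsem ginput c = flatten [seq true :: enc_edge e | e <-
  flatten [seq [seq inst_edge cc (cw c) j e | e <- edges_inp M (nth false (cw c) j)] | j <- iota 0 (size (cw c))]].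
Proof.
have E (l : seq nat) : {subset l <= iota 0 (size (cw c))} ->
  flatten [seq gsem (GCat (GFor (Inp (Var 0)) (gedges (edges_inp M true)))
                 (GFor (Lt (Inp (Var 0)) One) (gedges (edges_inp M false)))) (vcons i c) | i <- l] =
  flatten [seq true :: enc_edge e | e <-
    flatten [seq [seq inst_edge cc (cw c) j e | e <- edges_inp M (nth false (cw c) j)] | j <- l]].
  elim: l => // j l IH hl; rewrite map_cons [LHS]/= -[flatten (map _ l)]/(flatten (map _ l)).
  rewrite [X in _ ++ X = _](_ : _ = flatten [seq true :: enc_edge e | e <-
    flatten [seq [seq inst_edge cc (cw c) j e | e <- edges_inp M (nth false (cw c) j)] | j <- l]]); last first.
    by apply: IH => x hx; apply: hl; rewrite inE hx orbT.
  rewrite /= map_cat flatten_cat; congr cat; rewrite -map_comp.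
  have hj : j <= size (cw c) by have := hl j; rewrite mem_head mem_iota => /(_ isT); lia.
  by case: (nth false (cw c) j) => /=; rewrite gedgesE //= ?cats0.
exact: E.
Qed.

Definition gred : gen :=
  gcats [:: glit (enc_unary #|{: Loc M}| ++ enc_unary 3 ++ enc_unary #|{: Lab M}| ++
                  enc_nat (enum_rank (Pl true (None : claim M) None)));
    gedges (edges_fix M); ginput;
    glit ([:: false] ++ enc_seq (@enc_constraint 3) [seq red_inv M q | q <- enum 'I_#|{: Loc M}|] ++
          enc_set [set enum_rank (Lh M)])].

Lemma gredE w : encode (red_inst M cc w) = gsem gred (base_ctx w).
Proof.
have fE (a b c d : seq bool) : flatten [:: a; b; c; d] = a ++ b ++ c ++ d by rewrite /= cats0.
have h1 : cv (base_ctx w) 1 <= size (cw (base_ctx w)) by [].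
rewrite /gred gcatsE !map_cons fE !glitE (gedgesE _ h1) ginputE.
rewrite -[LHS]/(enc_unary #|{: Loc M}| ++ enc_unary 3 ++ enc_unary #|{: Lab M}| ++
  enc_nat (enum_rank (Pl true (None : claim M) None)) ++ enc_seq (@enc_edge _ _ _) (red_edges M cc w) ++
  enc_seq (@enc_constraint 3) [seq red_inv M q | q <- enum 'I_#|{: Loc M}|] ++ enc_set [set enum_rank (Lh M)]).
by rewrite enc_seqE /red_edges map_cat flatten_cat -map_comp -!catA.
Qed.

End Generator.

Lemma polytime_red (M : TM) cc : polytime (fun w => encode (red_inst M cc w)).
Proof.
have [xn hn] := bit_n_ex; have [xj hj] := bit_j_ex.
exact: (polytime_gen (gredE M cc hn hj)).
Qed.

Lemma BSNNI_CSNNI (R : realType) (Q X S : finType) (A : timed_automaton Q X S) (H : {set S}) :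
  is_BSNNI R A H -> is_CSNNI R A H.
Proof. by case=> Rel [h1 h2]; split; [exists Rel|exists (fun p s => Rel s p)]. Qed.

(** Acceptance yields a bisimulation, while rejection excludes even one of the two simulations. This
    gap lets the same reduction serve every language between the two problems. *)
Lemma EXPTIME_hard_of_sandwich (R : realType) (L : seq bool -> Prop) :
  (forall w, BSNNI_problem R w -> L w) -> (forall w, L w -> CSNNI_problem R w) -> EXPTIME_hard L.
Proof.
move=> h1 h2 L' [M [cc hM]]; exists (fun w => encode (red_inst M cc w)); split; first exact: polytime_red.
move=> w; have [t [ht hh ha]] := hM w.
have le : t <= Tn cc w.
  apply: leq_trans ht _; rewrite leq_exp2l // /mm.
  suff : size w ^ cc <= (size w ^ cc.+1).+1 by lia.
  case: (size w) => [|n]; first by case: (cc) => // k; rewrite exp0n.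
  by apply: leqW; apply: leq_pexp2l.
(* A halted machine repeats its configuration, so the verdict can be read at time [Tn]. *)
have e := run_halted le hh; rewrite -[tm_run M w (Tn cc w)]/(conf M w (Tn cc w)) in e.
rewrite -ha -e; split=> [acc|/h2[i [/encode_inj <- hC]]].
  by apply: h1; exists (red_inst M cc w); split=> //; apply: accept_bisimilar.
by apply/negPn/negP => rej; apply: (reject_not_CSNNI (R := R)) hC => acc; rewrite acc in rej.
Qed.

Theorem theorem2 (R : realType) :
  EXPTIME_complete (CSNNI_problem R) /\ EXPTIME_complete (BSNNI_problem R).
Proof.
have incl w : BSNNI_problem R w -> CSNNI_problem R w.
  by case=> i [-> h]; exists i; split=> //; apply: BSNNI_CSNNI.
split; split.
- by apply: (@EXPTIME_problem R false).
- exact: (EXPTIME_hard_of_sandwich (R := R)).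
- by apply: (@EXPTIME_problem R true).
- exact: (EXPTIME_hard_of_sandwich (R := R)).
Qed.
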